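(* Let $\Phi,\Psi$ be Young functions such that $$\int_0^\tau\frac{\Phi(\sigma)}{\sigma^2}\,d\sigma\le c\,\frac{\Psi(\tau)}{\tau},\qquad\tau>0,$$ and $\Phi(\tau)/\tau^q$ decreases for some $1<q<\infty$, and let $(w,v)$ be weights that satisfy condition $F$. Let $T$ be a Calderón-Zygmund singular integral operator of weak-type $(1,1)$ that satisfies the splitting property with $M_T=M$ (see context). Then $$\int_{\mathbb{R}^n}\Phi(|Tf(x)|)\,w(x)\,dx\le c\int_{\mathbb{R}^n}\Psi(|f(x)|)\,Mv(x)\,dx.$$ Moreover, if $w\in C_q$ for some $1<q<\infty$, $$\int_{\mathbb{R}^n}\Phi(|Tf(x)|)\,w(x)\,dx\le c\int_{\mathbb{R}^n}\Psi(|f(x)|)\,M_{L\log L}(w)(x)\,dx.$$ Here $c$ is independent of $f$, and $f$ is in the class $\mathcal{S}$ of the splitting property.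
   Context: All cubes have sides parallel to the axes. A weight is a nonnegative locally integrable function on $\mathbb{R}^n$. $M$ is the Hardy-Littlewood maximal operator. A continuous function $\Phi$ satisfies condition $C$ with doubling constant $c_0$ if it is increasing on $[0,\infty)$, $\Phi(0)=0$, and $\Phi(2\tau)\le c_0\Phi(\tau)$ for all $\tau>0$; a function satisfying condition $C$ which is convex and such that $\Phi(\tau)\to\infty$ (or, more generally, $\Phi(\tau)/\tau\to\infty$) as $\tau\to\infty$ is called a Young function. For a Young function $A$, $\|f\|_{L^A(Q)}=\inf\{\lambda>0:\frac{1}{|Q|}\int_QA(|f(y)|/\lambda)\,dy\le1\}$ and $M_Af(x)=\sup_{x\in Q}\|f\|_{L^A(Q)}$; $M_{L\log L}=M_A$ with $A(\tau)=\tau\log(1+\tau)$. Condition $F$: $(w,v)$ satisfy condition $F$ if there exist positive constants $c_1,\alpha,\beta$ with $0<\alpha<1$ such that for any cube $Q$ and measurable $E\subset Q$ with $|E|\le\alpha|Q|$, $\int_Ew\,dx\le c_1(|E|/|Q|)^\beta\int_{Q\setminus E}v\,dx$. Class $C_q$: $w\in C_q$ if there exist positive constants $\beta,c$ such that $\int_Ew(x)\,dx\le c\,(|E|/|Q|)^\beta\int_{\mathbb{R}^n}M(\mathbf{1}_Q)(x)^q\,w(x)\,dx$ whenever $E$ is a (measurable) subset of a cube $Q\subset\mathbb{R}^n$. If $w\in C_q$, then $(w,Mw)$ satisfy condition $F$. $T$ is given by $Tf(x)=\mathrm{p.v.}\int_{\mathbb{R}^n}k(x,y)f(y)\,dy$.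 Splitting property with $M_T=M$: there are constants $c_1',c_2'>0$ and a dense class $\mathcal{S}$ of functions of the domain of $T$ such that for every cube $Q_0$ and any cube $Q\subset Q_0$ there exists $x_Q\in Q$ such that every $f\in\mathcal{S}$ can be written as $f=f_1+f_2$ (the decomposition may depend on $Q$) with $|\{z\in Q:|Tf_1(z)|>c_1'\inf_{y\in Q}Mf(y)\}|<s|Q|$ and $\|Tf_2-Tf_2(x_Q)\|_{L^\infty(Q)}\le c_2'\inf_{y\in Q}Mf(y)$. Here $s$ is a fixed parameter for which there is $t$ with $0<s\le1/2$, $1/2<t<1-s$ and $c_0(s/(1-t))^\beta<1$, where $c_0$ is the doubling constant of $\Phi$ and $\beta$ the exponent in condition $F$ of the pair $(w,v)$ (of the pair $(w,Mw)$ in the second inequality). *)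

(* Defs.v *)
From HB Require Import structures.
From mathcomp Require Import all_boot all_order all_algebra.
From mathcomp Require Import all_classical all_reals all_analysis.

Set Implicit Arguments.
Unset Strict Implicit.
Unset Printing Implicit Defensive.

Import Order.TTheory GRing.Theory Num.Def Num.Theory.
Import numFieldNormedType.Exports.

Local Open Scope classical_set_scope.
Local Open Scope ring_scope.

Definition measure_rV_display : measure_display -> measure_display.
Proof. exact. Qed.

(* The product sigma-algebra on row vectors, generated by the coordinates in
   the same way as the library's sigma-algebra on n.-tuple T; for T = R it is
   the Borel sigma-algebra of R^n. *)
Section measurable_rV.
Context {d} {T : measurableType d}.
Variable n : nat.

Let coors : 'I_n -> 'rV[T]_n -> T := fun i x => x ord0 i.

Let rV_set0 : g_sigma_preimage coors set0.
Proof. exact: sigma_algebra0. Qed.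

Let rV_setC A : g_sigma_preimage coors A -> g_sigma_preimage coors (~` A).
Proof. exact: sigma_algebraC. Qed.

Let rV_bigcup (F : _^nat) : (forall i, g_sigma_preimage coors (F i)) ->
  g_sigma_preimage coors (\bigcup_i (F i)).
Proof. exact: sigma_algebra_bigcup. Qed.

HB.instance Definition _ := @isMeasurable.Build (measure_rV_display d)
  'rV[T]_n (g_sigma_preimage coors) rV_set0 rV_setC rV_bigcup.

End measurable_rV.

Lemma measurable_coord d (T : measurableType d) n (i : 'I_n) :
  measurable_fun [set: 'rV[T]_n] (fun x => x ord0 i).
Proof.
move=> _ Y mY; rewrite setTI; apply: sub_sigma_algebra => /=.
rewrite -bigcup_seq/=; exists i => /=; first by rewrite mem_index_enum.
by exists Y => //; rewrite setTI.
Qed.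

Lemma measurable_fun_rV d1 d2 (T1 : measurableType d1) (T2 : measurableType d2)
    n (f : T1 -> 'rV[T2]_n) :
  (forall i, measurable_fun [set: T1] (fun x => f x ord0 i)) ->
  measurable_fun [set: T1] f.
Proof.
move=> mf; suff : g_sigma_preimage
    (fun i : 'I_n => (fun x : 'rV[T2]_n => x ord0 i) \o f) `<=` measurable.
  rewrite g_sigma_preimage_comp => prefS.
  by move=> _ A mA; apply: prefS; exists A.
apply: smallest_sub; first exact: sigma_algebra_measurable.
case: n => [|n] in f mf *; first by rewrite big_ord0.
rewrite -bigcup_mkord_ord; apply: bigcup_sub => i Ii.
by move=> A [B mB <-]; exact: mf.
Qed.

Definition cons_rV (R : realType) n (p : measurableTypeR R * 'rV[R]_n) :
    'rV[R]_n.+1 :=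
  \row_i (if unlift ord0 i is Some j then p.2 ord0 j else p.1).

Lemma measurable_cons_rV (R : realType) n :
  measurable_fun setT (@cons_rV R n).
Proof.
apply: measurable_fun_rV => i.
under eq_fun do rewrite mxE.
case: (unlift ord0 i) => [j|]; last exact: measurable_fst.
apply: (@measurableT_comp _ _ _ _ _ _ (fun x : 'rV_n => x ord0 j)).
  exact: measurable_coord.
exact: measurable_snd.
Qed.

Section lebesgue_step.
Context {R : realType} {n : nat}.
Variable m : {sigma_finite_measure set 'rV[R]_n -> \bar R}.
Local Open Scope ereal_scope.

(* Lebesgue measure on R^(n+1) from the one on R^n. *)
Definition lebesgue_step : set 'rV[R]_n.+1 -> \bar R :=
  pushforward (@lebesgue_measure R \x m) (@cons_rV R n).

Let step0 : lebesgue_step set0 = 0.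
Proof. by rewrite /lebesgue_step /pushforward preimage_set0 measure0. Qed.

Let step_ge0 A : 0 <= lebesgue_step A.
Proof. by rewrite /lebesgue_step /pushforward measure_ge0. Qed.

Let step_sigma_additive : semi_sigma_additive lebesgue_step.
Proof.
move=> F mF tF mUF; rewrite /lebesgue_step /pushforward preimage_bigcup.
apply: measure_semi_sigma_additive.
- by move=> i; rewrite -[X in measurable X]setTI; exact: measurable_cons_rV.
- apply/trivIsetP => /= i j _ _ ij; rewrite -preimage_setI.
  by move/trivIsetP : tF => /(_ _ _ _ _ ij) ->//; rewrite preimage_set0.
- by rewrite -preimage_bigcup -[X in measurable X]setTI;
    exact: measurable_cons_rV.
Qed.

HB.instance Definition _ := isMeasure.Build _ _ _
  lebesgue_step step0 step_ge0 step_sigma_additive.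

Let behead_rV (x : 'rV[R]_n.+1) : 'rV[R]_n := \row_j x ord0 (lift ord0 j).

Let measurable_behead_rV : measurable_fun setT behead_rV.
Proof.
apply: measurable_fun_rV => i; under eq_fun do rewrite mxE.
exact: measurable_coord.
Qed.

Lemma measurable_rV_prod (A : set R) (B : set 'rV[R]_n) :
  measurable A -> measurable B ->
  measurable [set x : 'rV[R]_n.+1 | A (x ord0 ord0) /\
                                    B (\row_j x ord0 (lift ord0 j))].
Proof.
move=> mA mB; apply: measurableI.
  rewrite -[X in measurable X]setTI.
  by have := @measurable_coord _ R n.+1 ord0; apply.
by rewrite -[X in measurable X]setTI; exact: measurable_behead_rV.
Qed.

Lemma lebesgue_step_prod (A : set R) (B : set 'rV[R]_n) :
  measurable A -> measurable B ->
  lebesgue_step [set x : 'rV[R]_n.+1 | A (x ord0 ord0) /\ B (\row_j x ord0 (lift ord0 j))] =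
  lebesgue_measure A * m B.
Proof.
move=> mA mB; rewrite -product_measure1E//.
rewrite /lebesgue_step /pushforward; congr (_ \x _).
apply/seteqP; split=> -[a x] /=;
  rewrite /cons_rV/= mxE unlift_none;
  rewrite (_ : \row_j _ = x)//; apply/rowP => j; by rewrite !mxE liftK.
Qed.

Let step_sigma_finite : sigma_finite setT lebesgue_step.
Proof.
have /sigma_finiteP[F [TF ndF Foo]] := sigma_finiteT (@lebesgue_measure R).
have /sigma_finiteP[G [TG ndG Goo]] := sigma_finiteT m.
exists (fun i => [set x : 'rV[R]_n.+1 | F i (x ord0 ord0) /\
                                        G i (\row_j x ord0 (lift ord0 j))]).
  apply/seteqP; split=> // x _.
  have : setT (x ord0 ord0) by [].
  rewrite TF => -[i _ Fi].
  have : setT (\row_j x ord0 (lift ord0 j) : 'rV[R]_n) by [].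
  rewrite TG => -[k _ Gk].
  exists (maxn i k) => //; split.
  - by move: Fi; exact/subsetPset/ndF/leq_maxl.
  - by move: Gk; exact/subsetPset/ndG/leq_maxr.
move=> i; have [? ?] := Foo i; have [? ?] := Goo i.
split; first exact: measurable_rV_prod.
by rewrite lebesgue_step_prod// lte_mul_pinfty// ge0_fin_numE.
Qed.

HB.instance Definition _ := Measure_isSigmaFinite.Build _ _ _
  lebesgue_step step_sigma_finite.

End lebesgue_step.

Fixpoint lebesgue_rV (R : realType) (n : nat) :
    {sigma_finite_measure set 'rV[R]_n -> \bar R} :=
  if n is n'.+1 then lebesgue_step (lebesgue_rV R n') else \d_(0 : 'rV[R]_0).

Lemma lebesgue_rV_box (R : realType) (n : nat) (a b : 'rV[R]_n) :
  (forall i, a ord0 i <= b ord0 i) ->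
  lebesgue_rV R n [set x : 'rV[R]_n | forall i, a ord0 i <= x ord0 i <= b ord0 i] =
  (\prod_i (b ord0 i - a ord0 i))%:E.
Proof.
suff H : (forall i, a ord0 i <= b ord0 i) -> measurable
    [set x : 'rV[R]_n | forall i, a ord0 i <= x ord0 i <= b ord0 i] /\
    lebesgue_rV R n [set x : 'rV[R]_n | forall i, a ord0 i <= x ord0 i <= b ord0 i] =
  (\prod_i (b ord0 i - a ord0 i))%:E by move=> /H[].
elim: n a b => [|n IH] a b ab.
  split; last by rewrite big_ord0 /= diracE mem_set// => -[].
  rewrite (_ : mkset _ = setT)//.
  by apply/seteqP; split=> // x _ [].
pose tl (x : 'rV[R]_n.+1) : 'rV[R]_n := \row_j x ord0 (lift ord0 j).
have [|mB IHab] := IH (tl a) (tl b).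
  by move=> i; rewrite !mxE.
have mA : measurable (`[a ord0 ord0, b ord0 ord0]%classic : set R) by [].
have boxE : [set x : 'rV[R]_n.+1 | forall i, a ord0 i <= x ord0 i <= b ord0 i] =
    [set x : 'rV[R]_n.+1 | `[a ord0 ord0, b ord0 ord0]%classic (x ord0 ord0) /\
      [set y | forall i, tl a ord0 i <= y ord0 i <= tl b ord0 i]
      (\row_j x ord0 (lift ord0 j))].
  apply/seteqP; split=> x /=.
    move=> abx; split; first by rewrite in_itv/=.
    by move=> i; rewrite !mxE.
  move=> [x0 xs] i; have [j ->|->] := unliftP ord0 i.
    by have := xs j; rewrite !mxE.
  by move: x0; rewrite in_itv.
split; first by rewrite boxE; apply: (measurable_rV_prod mA mB).
rewrite [LHS](congr1 (lebesgue_step (lebesgue_rV R n)) boxE).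
rewrite [LHS](lebesgue_step_prod _ mA mB) [X in (_ * X)%E]IHab lebesgue_measure_itv/= lte_fin.
rewrite big_ord_recl; under eq_bigr do rewrite !mxE.
case: ltgtP (ab ord0) => //= -> _; by rewrite subrr mul0e mul0r.
Qed.

Section weights.
Context {R : realType} {n : nat}.
Local Open Scope ereal_scope.

Local Notation Rn := 'rV[R]_n.
Local Notation mu := (lebesgue_rV R n).
Implicit Types (f w : Rn -> R) (v : Rn -> \bar R) (Q E : set Rn).

Definition cube (a : Rn) (l : R) : set Rn :=
  [set x | forall i, (a ord0 i <= x ord0 i <= a ord0 i + l)%R].

Definition is_cube Q := exists a l, (0 < l)%R /\ Q = cube a l.

Definition weight w :=
  [/\ measurable_fun [set: Rn] w, forall x, (0 <= w x)%R &
      forall K : set Rn, compact K -> \int[mu]_(x in K) (w x)%:E < +oo].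

Definition maximal f (x : Rn) : \bar R :=
  ereal_sup [set (mu Q)^-1 * \int[mu]_(y in Q) `|f y|%:E
            | Q in [set Q | is_cube Q /\ Q x]].

Definition Lux_norm (A : R -> R) Q f : \bar R :=
  ereal_inf [set lambda%:E | lambda in
    [set lambda : R | (0 < lambda)%R /\
       (mu Q)^-1 * \int[mu]_(y in Q) (A (`|f y| / lambda)%R)%:E <= 1]].

Definition Orlicz_maximal (A : R -> R) f (x : Rn) : \bar R :=
  ereal_sup [set Lux_norm A Q f | Q in [set Q | is_cube Q /\ Q x]].

Definition maximal_LlogL : (Rn -> R) -> Rn -> \bar R :=
  Orlicz_maximal (fun t => t * ln (1 + t))%R.

(* |E| / |Q| as a real number; used for measurable E contained in a cube Q. *)
Definition rel_size E Q : R := (fine (mu E) / fine (mu Q))%R.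

(* Condition F with the exponent beta made explicit; v is extended real valued
   so that v may be a maximal function. *)
Definition condition_F w v (beta : R) :=
  (0 < beta)%R /\
  exists c1 alpha : R, [/\ (0 < c1)%R, (0 < alpha < 1)%R &
    forall Q E, is_cube Q -> measurable E -> E `<=` Q ->
      mu E <= alpha%:E * mu Q ->
      \int[mu]_(x in E) (w x)%:E <=
      (c1 * rel_size E Q `^ beta)%:E * \int[mu]_(x in Q `\` E) v x].

Definition class_C (q : R) w :=
  exists beta c : R, [/\ (0 < beta)%R, (0 < c)%R &
    forall Q E, is_cube Q -> measurable E -> E `<=` Q ->
      \int[mu]_(x in E) (w x)%:E <=
      (c * rel_size E Q `^ beta)%:E *
      \int[mu]_x (maximal \1_Q x `^ q * (w x)%:E)].

End weights.

Section young.
Context {R : realType}.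
Implicit Types Phi : R -> R.

Definition condition_C Phi (c0 : R) :=
  [/\ {within `[0, +oo[, continuous Phi},
      {in `[0, +oo[ &, {homo Phi : s t / s <= t}},
      Phi 0 = 0 &
      forall t, 0 < t -> Phi (2 * t) <= c0 * Phi t].

Definition young Phi (c0 : R) :=
  [/\ condition_C Phi c0,
      convex_function (`[0, +oo[%classic : set R^o) Phi &
      Phi t @[t --> +oo] --> +oo].

(* The restriction on the parameter s of the splitting property. *)
Definition admissible (c0 beta s : R) :=
  0 < s <= 2^-1 /\
  exists t, 2^-1 < t < 1 - s /\ c0 * (s / (1 - t)) `^ beta < 1.

End young.

Section singular_integrals.
Context {R : realType} {n : nat}.

Local Notation Rn := 'rV[R]_n.
Local Notation mu := (lebesgue_rV R n).
Implicit Types (k : Rn -> Rn -> R) (f g : Rn -> R) (Q : set Rn).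

(* The library norm of row vectors is the sup norm. *)
Definition enorm (x : Rn) : R := Num.sqrt (\sum_i x ord0 i ^+ 2).

(* Standard kernels: size condition and Dini-type regularity in both
   variables, which includes Hoelder regularity (omega t = C * t `^ delta). *)
Definition CZ_kernel k :=
  [/\ measurable_fun [set p : Rn * Rn | p.1 != p.2] (fun p => k p.1 p.2),
      exists C, forall x y, x != y -> `|k x y| <= C / enorm (x - y) ^+ n &
      exists omega : R -> R,
        [/\ forall t, 0 <= t -> 0 <= omega t,
            {in `[0, +oo[ &, {homo omega : s t / s <= t}},
            (\int[lebesgue_measure]_(t in `]0%R, 1%R]) (omega t / t)%:E < +oo)%E &
            forall x x' y, x != y -> 2 * enorm (x - x') <= enorm (x - y) ->
              `|k x y - k x' y| + `|k y x - k y x'| <=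
              omega (enorm (x - x') / enorm (x - y)) / enorm (x - y) ^+ n]].

Definition truncated k f (x : Rn) (e : R) : R :=
  \int[mu]_(y in [set y | e < enorm (x - y)]) (k x y * f y).

Definition pv_exists k f x := cvg (truncated k f x e @[e --> 0^'+]).

Definition pv_integral k f (x : Rn) : R := lim (truncated k f x e @[e --> 0^'+]).

Definition pv_domain k : set (Rn -> R) :=
  [set f | mu.-integrable setT (EFin \o f) /\ {ae mu, forall x, pv_exists k f x}].

Definition weak_type11 k :=
  exists C, 0 < C /\ forall f, pv_domain k f -> forall lambda, 0 < lambda ->
    (mu [set x | (lambda < `|pv_integral k f x|)%R] <=
     (C / lambda)%:E * \int[mu]_x `|f x|%:E)%E.

Definition dense_class k (S : set (Rn -> R)) :=
  S `<=` pv_domain k /\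
  forall g, pv_domain k g -> forall e, 0 < e ->
    exists f, S f /\ (\int[mu]_x `|f x - g x|%:E < e%:E)%E.

Definition splitting_property k (S : set (Rn -> R)) (s : R) :=
  dense_class k S /\
  exists c1 c2, [/\ 0 < c1, 0 < c2 &
    forall Q0 Q, is_cube Q0 -> is_cube Q -> Q `<=` Q0 ->
    exists xQ, Q xQ /\ forall f, S f ->
    exists f1 f2, [/\ f = f1 \+ f2, pv_domain k f1, pv_domain k f2,
      pv_exists k f2 xQ &
      let T := pv_integral k in
      let m := ereal_inf [set maximal f y | y in Q] in
      ((mu [set z | Q z /\ c1%:E * m < `|T f1 z|%:E] < s%:E * mu Q)%E /\
       ('N[mu]_(+oo)[(fun z => (T f2 z - T f2 xQ)%:E) \_ Q] <= c2%:E * m)%E)]].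

End singular_integrals.

(* Main.v *)
Require Import Defs.
From mathcomp Require Import all_boot all_order all_algebra.
From mathcomp Require Import all_classical all_reals all_analysis.
From mathcomp Require Import measurable_realfun ess_sup_inf.
From mathcomp Require Import lra.

Set Implicit Arguments.
Unset Strict Implicit.
Unset Printing Implicit Defensive.

Import Order.TTheory GRing.Theory Num.Def Num.Theory.
Import numFieldNormedType.Exports.

Local Open Scope classical_set_scope.
Local Open Scope ring_scope.

(** On a cube [Q] the function [T f] deviates by more than a multiple of
    [b Q = inf_Q Mf] from a constant [gam Q] only on a set of measure less than
    [s |Q|]: this is what the splitting property says when [gam Q] is the value
    of [T f2] at [x_Q] (lemma [splitting_deviation]). The local argument uses
    nothing but such oscillation bounds for [g = T f].

    Inside a dyadic cube [c], one selects the maximal subcubes that are filled by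
    the deviation set of [c] in proportion more than [1 - t], and iterates. The
    generation [i] covers at most the proportion [(s / (1 - t)) ^ i] of [c]
    ([mu_gunion]); outside of the selected cubes [g] is close to the constant of
    [c], up to a null set ([gdev_selected_null]); and the constant jumps by at
    most a multiple of [b] of the smaller cube when passing to a selected one
    ([gam_close_selected]). The last point compares a cube with its double through
    a chain of slowly growing cubes, which is possible as [s < 1/2].

    At almost every point [Phi |g - gam c|] is thus bounded by [Phi] of a sum of
    jumps over the selected cubes around the point. Doubling splits it at the
    price of a factor [c0] for each generation passed. Condition F bounds the
    weight [w] of a generation, [i] steps further inside a cube, by
    [(s / (1 - t)) ^ (beta i)] times the integral of [V] over the cube outside of
    a later generation ([condF_decay]); these complements have bounded overlap
    ([sum_integral_gaps]), and [Phi (b Q) <= Phi (Mf)] on [Q]. The assumption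
    [c0 (s / (1 - t)) ^ beta < 1] makes the series converge, and
    [local_estimate] bounds the integral of [Phi |g - gam c| w] over [c] by a
    constant times that of [Phi (Mf) V]. The weak-type estimates for [T] and [M]
    force [gam c] to zero on large cubes ([gam_vanishes]), so that the bound is
    global by Fatou's lemma ([exhaustion]).

    It remains to bound the integral of [Phi (Mf) V] by that of [Psi |f| MV]. This
    is the Fefferman-Stein weak-type inequality ([maximal_weak_type]) summed over
    dyadic levels, where the integral condition relating [Phi] and [Psi] enters
    ([maximal_modular]). With [V = v] this is the first inequality. For the
    second one [V = Mw], and [M (Mw)] is at most a multiple of the maximal
    function of [L log L] ([emax_maximal_le_LlogL]): averages of the maximal
    function of [w] over a cube produce a logarithm when the weak-type estimate
    is summed over dyadic levels.

    Grid cubes are half-open and indexed by a level and integer coordinates; a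
    function of the form [T f] is replaced by a measurable function equal to it
    almost everywhere ([pv_integral_measurable_version]). *)

(** * Countable additivity over countable families of sets *)

Section nonneg_integral.
Context d (T : measurableType d) (R : realType).
Variable mu : {measure set T -> \bar R}.
Local Open Scope ereal_scope.

(** The integral of an arbitrary nonnegative function is the supremum of the
    integrals of the simple functions below it. Integrands of unclear
    measurability occur below: principal values, Orlicz maximal functions. *)
Lemma ge0_le_integral_nomeas (D : set T) (f g : T -> \bar R) :
  (forall x, D x -> 0 <= f x) -> (forall x, D x -> f x <= g x) ->
  \int[mu]_(x in D) f x <= \int[mu]_(x in D) g x.
Proof.
move=> f0 fg.
have g0 x : D x -> 0 <= g x by move=> Dx; rewrite (le_trans (f0 _ Dx))// fg.
rewrite !ge0_integralE//; apply: ge_ereal_sup => _ [h hf <-].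
apply: ereal_sup_ubound; exists h => //= x.
rewrite (le_trans (hf x))//.
by rewrite /patch; case: ifPn => // /set_mem; exact: fg.
Qed.

(** The comparison holds everywhere once [g] is raised to infinity on the null
    set, which does not affect its integral as [g] is measurable. *)
Lemma ae_ge0_le_integral_nomeas (f g : T -> \bar R) :
  (forall x, 0 <= f x) -> (forall x, 0 <= g x) -> measurable_fun setT g ->
  {ae mu, forall x, f x <= g x} ->
  \int[mu]_x f x <= \int[mu]_x g x.
Proof.
move=> f0 g0 mg [N [mN N0 subN]].
have mh : measurable_fun setT (fun x => g x + (cst +oo \_ N) x).
  apply: emeasurable_funD => //.
  by apply/(measurable_restrictT _ _).1.
have h0 x : 0 <= g x + (cst +oo \_ N) x.
  by rewrite adde_ge0//; apply: erestrict_ge0 => y _; exact: leey.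
apply: (@le_trans _ _ (\int[mu]_x (g x + (cst +oo \_ N) x))).
  apply: ge0_le_integral_nomeas => // x _.
  rewrite /patch; case: ifPn => [xN|/negP xN].
    by rewrite /= addey ?leey// -ltNye (lt_le_trans _ (g0 x)).
  rewrite adde0 leNgt; apply/negP => gf; apply: xN; apply/mem_set/subN => /=.
  by apply/negP; rewrite -ltNge.
rewrite (ge0_negligible_integral mN)//= (ge0_negligible_integral mN _ mg)//=.
apply: ge0_le_integral_nomeas => x [_ Nx]; first by [].
by rewrite /patch memNset// adde0.
Qed.

End nonneg_integral.

Section countably_additive.
Context d (T : measurableType d) (R : realType).
Local Open Scope ereal_scope.

(** The nonnegative countably additive functionals of measurable sets: what the
    comparison of two measures over a family of dyadic cubes uses, and what is
    available for densities and for restrictions. *)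
Definition countably_additive (m : set T -> \bar R) :=
  [/\ m set0 = 0, forall A, measurable A -> 0 <= m A &
      forall F : (set T)^nat, (forall i, measurable (F i)) -> trivIset setT F ->
        m (\bigcup_i F i) = \sum_(i <oo) m (F i)].

Lemma countably_additive_mu (mu : {measure set T -> \bar R}) :
  countably_additive mu.
Proof.
split=> // F mF tF; rewrite measure_bigcup//.
by apply: eq_eseriesl => i; rewrite in_setT.
Qed.

Lemma countably_additive_restr (m : set T -> \bar R) (E : set T) :
  measurable E -> countably_additive m ->
  countably_additive (fun A => m (A `&` E)).
Proof.
move=> mE [m0 mge madd]; split; first by rewrite set0I.
  by move=> A mA; apply/mge/measurableI.
move=> F mF tF; rewrite setI_bigcupl madd//.
  by move=> i; exact: measurableI.
by apply: trivIset_setIr.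
Qed.

Lemma countably_additive_scale (m : set T -> \bar R) (c : R) : (0 <= c)%R ->
  countably_additive m -> countably_additive (fun A => c%:E * m A).
Proof.
move=> c0 [m0 mge madd]; split; first by rewrite m0 mule0.
  by move=> A mA; rewrite mule_ge0 ?mge.
move=> F mF tF; rewrite madd// nneseriesZl// => i _; exact: mge.
Qed.

Lemma countably_additive_integral (mu : {measure set T -> \bar R})
    (f : T -> \bar R) :
  measurable_fun setT f -> (forall x, 0 <= f x) ->
  countably_additive (fun A => \int[mu]_(x in A) f x).
Proof.
move=> mf f0; split; first by rewrite integral_set0.
  by move=> A mA; apply: integral_ge0.
move=> F mF tF; rewrite ge0_integral_bigcup//.
by apply: measurable_funS mf => //; exact: bigcupT_measurable.
Qed.

End countably_additive.

Section countable_sums.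
Context (I : countType) (R : realType).
Local Open Scope ereal_scope.
Implicit Types (P : set I) (F G : I -> \bar R).

(** Sums over families of grid cubes are series along the numbering of a
    countable type, so that the convergence theorems for series of integrals
    apply to them. *)
Definition csum P F : \bar R :=
  \sum_(i <oo) (if pickle_inv i is Some c then
                  if `[< P c >] then F c else 0 else 0).

Let csum_term_ge0 P F : (forall c, P c -> 0 <= F c) ->
  forall i, 0 <= (if pickle_inv i is Some c then
                  if `[< P c >] then F c else 0 else 0).
Proof.
by move=> F0 i; case: (pickle_inv i) => // c; case: asboolP => // /F0.
Qed.

Lemma csum_ge0 P F : (forall c, P c -> 0 <= F c) -> 0 <= csum P F.
Proof. by move=> F0; apply: nneseries_ge0 => i _ _; apply: csum_term_ge0. Qed.

Lemma csum_ge_term P F c : (forall c, P c -> 0 <= F c) -> P c -> F c <= csum P F.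
Proof.
move=> F0 Pc.
have /= := @nneseries_lim_ge _ _ xpredT 0%N (pickle c).+1
  (fun i _ _ => csum_term_ge0 F0 i).
apply: le_trans.
rewrite big_nat_recr//= pickleK_inv asboolT// leeDr//.
by apply: sume_ge0 => i _; exact: csum_term_ge0.
Qed.

Lemma le_csum P F G : (forall c, P c -> 0 <= F c) ->
  (forall c, P c -> F c <= G c) -> csum P F <= csum P G.
Proof.
move=> F0 FG; apply: lee_nneseries => [i _ _|i _]; first exact: csum_term_ge0.
by case: (pickle_inv i) => // c; case: asboolP => // /FG.
Qed.

Lemma eq_csum P F G : (forall c, P c -> F c = G c) -> csum P F = csum P G.
Proof.
move=> FG; apply: eq_eseriesr => i _.
by case: (pickle_inv i) => // c; case: asboolP => // /FG.
Qed.

Lemma csumZl P F (x : R) : (forall c, P c -> 0 <= F c) ->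
  csum P (fun c => x%:E * F c) = x%:E * csum P F.
Proof.
move=> F0; rewrite /csum -nneseriesZl; last first.
  by move=> i _; apply: csum_term_ge0.
apply: eq_eseriesr => i _; case: (pickle_inv i) => [c|]; last by rewrite mule0.
by case: ifP => //; rewrite mule0.
Qed.

Lemma csumMr P F (E : \bar R) : (forall c, P c -> 0 <= F c) -> 0 <= E ->
  csum P F * E = csum P (fun c => F c * E).
Proof.
move=> F0; case: E => [e|_|//].
  by move=> _; under [RHS]eq_csum do rewrite muleC; rewrite csumZl// muleC.
have [[c [Pc Fc]]|F00] := pselect (exists c, P c /\ 0 < F c).
  rewrite gt0_muley ?(lt_le_trans Fc)//; last exact: csum_ge_term.
  have Fcoo : F c * +oo = +oo by rewrite gt0_muley.
  apply/esym/eqP; rewrite -leye_eq -[X in X <= _]Fcoo.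
  apply: (@csum_ge_term P (fun c => F c * +oo)) => // c' Pc'.
  by rewrite mule_ge0 ?F0.
have {}F00 c : P c -> F c = 0.
  move=> Pc; apply/eqP; rewrite eq_le F0// andbT leNgt.
  by apply/negP => Fc; apply: F00; exists c.
rewrite (@eq_csum P (fun c => F c * +oo) (fun=> 0)); last first.
  by move=> c Pc; rewrite F00// mul0e.
rewrite (eq_csum F00).
suff -> : csum P (fun=> 0 : \bar R) = 0 by rewrite mul0e.
by rewrite /csum eseries0// => i _ _; case: (pickle_inv i) => // c; case: ifP.
Qed.

End countable_sums.

Section countable_families.
Context d (T : measurableType d) (R : realType) (I : countType).
Local Open Scope ereal_scope.
Implicit Types (P : set I) (F : I -> set T).

Definition cfamily P F (i : nat) : set T :=
  if pickle_inv i is Some c then if `[< P c >] then F c else set0 else set0.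

Lemma bigcup_cfamily P F : \bigcup_i cfamily P F i = \bigcup_(c in P) F c.
Proof.
apply/seteqP; split=> [x [i _]|x [c Pc Fx]].
  rewrite /cfamily; case: (pickle_inv i) => [c|//].
  by case: asboolP => // Pc Fcx; exists c.
by exists (pickle c) => //; rewrite /cfamily pickleK_inv asboolT.
Qed.

Lemma measurable_cfamily P F : (forall c, P c -> measurable (F c)) ->
  forall i, measurable (cfamily P F i).
Proof.
move=> mF i; rewrite /cfamily; case: (pickle_inv i) => [c|//].
by case: asboolP => // /mF.
Qed.

Lemma trivIset_cfamily P F : trivIset P F -> trivIset setT (cfamily P F).
Proof.
move=> tF i j _ _ [x []]; rewrite /cfamily.
case Ei: (pickle_inv i) => [c|//]; case: asboolP => // Pc Fcx.
case Ej: (pickle_inv j) => [c'|//]; case: asboolP => // Pc' Fc'x.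
have cc' : c = c' by apply: tF => //; exists x.
by rewrite -[i](@pickle_invK I) -[j](@pickle_invK I) Ei Ej/= cc'.
Qed.

Lemma csum_cfamily (m : set T -> \bar R) P F : m set0 = 0 ->
  csum P (fun c => m (F c)) = \sum_(i <oo) m (cfamily P F i).
Proof.
move=> m0; apply: eq_eseriesr => i _; rewrite /cfamily.
by case: (pickle_inv i) => [c|//]; case: ifP.
Qed.

Lemma measurable_bigcup_countable P F : (forall c, P c -> measurable (F c)) ->
  measurable (\bigcup_(c in P) F c).
Proof.
move=> mF; rewrite -bigcup_cfamily.
by apply: bigcupT_measurable; exact: measurable_cfamily.
Qed.

Lemma countably_additive_bigcup (m : set T -> \bar R) P F :
  countably_additive m -> (forall c, P c -> measurable (F c)) -> trivIset P F ->
  m (\bigcup_(c in P) F c) = csum P (fun c => m (F c)).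
Proof.
move=> [m0 _ madd] mF tF; rewrite -bigcup_cfamily madd ?csum_cfamily//.
- exact: measurable_cfamily.
- exact: trivIset_cfamily.
Qed.

(** The way of comparing two measures from cube to cube: a weight with a measure,
    a measure with its restriction, or the integrals of two functions. *)
Lemma countably_additive_le_bigcup (m1 m2 : set T -> \bar R) P F :
  countably_additive m1 -> countably_additive m2 ->
  (forall c, P c -> measurable (F c)) -> trivIset P F ->
  (forall c, P c -> m1 (F c) <= m2 (F c)) ->
  m1 (\bigcup_(c in P) F c) <= m2 (\bigcup_(c in P) F c).
Proof.
move=> am1 am2 mF tF m12; rewrite !countably_additive_bigcup//.
by apply: le_csum => // c Pc; have [_ + _] := am1; apply; exact: mF.
Qed.

Lemma measure_bigcup_le_csum (mu : {measure set T -> \bar R}) P F :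
  (forall c, P c -> measurable (F c)) ->
  mu (\bigcup_(c in P) F c) <= csum P (fun c => mu (F c)).
Proof.
move=> mF; rewrite csum_cfamily//.
apply: measure_sigma_subadditive.
- exact: measurable_cfamily.
- exact: measurable_bigcup_countable.
- by rewrite bigcup_cfamily.
Qed.

Lemma measurable_csum P (f : I -> T -> \bar R) D :
  (forall c, P c -> measurable_fun D (f c)) ->
  (forall c x, P c -> D x -> 0 <= f c x) ->
  measurable_fun D (fun x => csum P (f^~ x)).
Proof.
move=> mf f0.
apply: ge0_emeasurable_sum => [i x Dx _|i _].
  by case: (pickle_inv i) => // c; case: asboolP => // Pc; exact: f0.
case: (pickle_inv i) => [c|]; last exact: measurable_cst.
by case: asboolP => [Pc|_]; [exact: mf|exact: measurable_cst].
Qed.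

Lemma integral_csum (mu : {measure set T -> \bar R}) P (f : I -> T -> \bar R) D :
  measurable D ->
  (forall c, P c -> measurable_fun D (f c)) ->
  (forall c x, P c -> D x -> 0 <= f c x) ->
  \int[mu]_(x in D) csum P (f^~ x) = csum P (fun c => \int[mu]_(x in D) f c x).
Proof.
move=> mD mf f0; rewrite /csum integral_nneseries//.
- apply: eq_eseriesr => i _; case: (pickle_inv i) => [c|].
    by case: ifP => // _; rewrite integral0.
  by rewrite integral0.
- move=> i; case: (pickle_inv i) => [c|]; last exact: measurable_cst.
  by case: asboolP => [Pc|_]; [exact: mf|exact: measurable_cst].
- move=> i x Dx; case: (pickle_inv i) => [c|//].
  by case: asboolP => // Pc; exact: f0.
Qed.

(** Countable subadditivity of the integral, for overlapping coverings such as
    the triples of disjoint cubes. *)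
Lemma integral_bigcup_le_csum (mu : {measure set T -> \bar R}) P F
    (f : T -> \bar R) :
  measurable_fun setT f -> (forall x, 0 <= f x) ->
  (forall c, P c -> measurable (F c)) ->
  \int[mu]_(x in \bigcup_(c in P) F c) f x <=
  csum P (fun c => \int[mu]_(x in F c) f x).
Proof.
move=> mf f0 mF.
have mr c : P c -> measurable_fun setT (f \_ (F c)).
  move=> Pc; apply/(measurable_restrictT _ _).1; first exact: mF.
  exact: measurable_funS mf.
under eq_csum do rewrite integral_mkcond.
rewrite -(@integral_csum mu P (fun c => f \_ (F c)))//; last first.
  by move=> c x Pc _; exact: erestrict_ge0.
rewrite integral_mkcond; apply: ge0_le_integral_nomeas => x _.
  exact: erestrict_ge0.
rewrite {1}/patch; case: ifPn => [/set_mem[c Pc Fcx]|_]; last first.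
  by apply: csum_ge0 => c Pc; exact: erestrict_ge0.
have := @csum_ge_term I R P (fun c => (f \_ (F c)) x) c.
rewrite {2}/patch mem_set//; apply => // c' Pc'; exact: erestrict_ge0.
Qed.

End countable_families.

(** * Cubes, dyadic grids and dyadically open sets *)

(** Monotonicity holds for arbitrary sets, since the measure of every section
    does and integrals of nonnegative functions are monotone. It is what turns
    the bounds on possibly nonmeasurable level sets into bounds on measurable
    ones. *)
Lemma le_lebesgue_rV (R : realType) (n : nat) (A B : set 'rV[R]_n) :
  A `<=` B -> (lebesgue_rV R n A <= lebesgue_rV R n B)%E.
Proof.
elim: n A B => [|n IH] A B AB.
  rewrite /= !diracE lee_fin ler_nat.
  by case: (boolP (0 \in A)) => // /set_mem/AB/mem_set ->.
change ((\int[lebesgue_measure]_x (lebesgue_rV R n \o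
           xsection (@cons_rV R n @^-1` A)) x <=
         \int[lebesgue_measure]_x (lebesgue_rV R n \o
           xsection (@cons_rV R n @^-1` B)) x)%E).
apply: ge0_le_integral_nomeas => x _ /=; first exact: measure_ge0.
by apply: IH => y; rewrite /xsection /= !inE; exact: AB.
Qed.

Lemma lebesgue_rV_prod (R : realType) (n : nat) (A : 'I_n -> set R)
    (r : 'I_n -> R) :
  (forall i, measurable (A i)) ->
  (forall i, lebesgue_measure (A i) = (r i)%:E) ->
  measurable [set x : 'rV[R]_n | forall i, A i (x ord0 i)] /\
  lebesgue_rV R n [set x : 'rV[R]_n | forall i, A i (x ord0 i)] =
  (\prod_i r i)%:E.
Proof.
elim: n A r => [|n IH] A r mA rA.
  rewrite (_ : mkset _ = setT); last by apply/seteqP; split=> // x _ [].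
  by split; [exact: measurableT|rewrite big_ord0 /= diracT].
have [mB IHr] := IH (fun i => A (lift ord0 i)) (fun i => r (lift ord0 i))
  (fun i => mA _) (fun i => rA _).
have boxE : [set x : 'rV[R]_n.+1 | forall i, A i (x ord0 i)] =
    [set x : 'rV[R]_n.+1 | A ord0 (x ord0 ord0) /\
      [set y : 'rV[R]_n | forall i, A (lift ord0 i) (y ord0 i)]
      (\row_j x ord0 (lift ord0 j))].
  apply/seteqP; split=> x /=.
    by move=> Ax; split=> // i; rewrite mxE.
  move=> [x0 xs] i; have [j ->|->] := unliftP ord0 i => //.
  by have := xs j; rewrite mxE.
split; first by rewrite boxE; apply: (measurable_rV_prod (mA _) mB).
rewrite [LHS](congr1 (lebesgue_step (lebesgue_rV R n)) boxE).
rewrite [LHS](lebesgue_step_prod _ (mA _) mB).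
by rewrite [X in (_ * X)%E]IHr rA big_ord_recl.
Qed.

Lemma real_small_power (R : realType) (x e : R) : 0 < e ->
  exists k, x / 2 ^+ k < e.
Proof.
move=> e0; exists (archi_bound (x / e)).
rewrite ltr_pdivrMr ?exprn_gt0// mulrC -ltr_pdivrMr//.
exact: upper_nthrootP.
Qed.

Section cubes.
Context {R : realType} {n : nat}.
Local Notation Rn := 'rV[R]_n.
Local Notation mu := (lebesgue_rV R n).
Implicit Types (a b : Rn) (l : R).

Definition hcube a l : set Rn :=
  [set x | forall i, a ord0 i <= x ord0 i < a ord0 i + l].

Lemma cubeP a l : 0 <= l -> measurable (cube a l) /\ mu (cube a l) = (l ^+ n)%:E.
Proof.
move=> l0.
have [|i|m E] := @lebesgue_rV_prod R n
  (fun i => `[a ord0 i, a ord0 i + l]%classic) (fun=> l).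
- by [].
- rewrite lebesgue_measure_itv/= lte_fin ltrDl; case: ltP => l1.
    by rewrite -EFinD addrAC subrr add0r.
  by have -> : l = 0 by apply/eqP; rewrite eq_le l1.
rewrite prodr_const card_ord in E.
rewrite (_ : cube a l = [set x | forall i, `[a ord0 i, a ord0 i + l]%classic
  (x ord0 i)])//.
Qed.

Lemma hcubeP a l : 0 <= l -> measurable (hcube a l) /\ mu (hcube a l) = (l ^+ n)%:E.
Proof.
move=> l0.
have [|i|m E] := @lebesgue_rV_prod R n
  (fun i => `[a ord0 i, a ord0 i + l[%classic) (fun=> l).
- by [].
- rewrite lebesgue_measure_itv/= lte_fin ltrDl; case: ltP => l1.
    by rewrite -EFinD addrAC subrr add0r.
  by have -> : l = 0 by apply/eqP; rewrite eq_le l1.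
rewrite prodr_const card_ord in E.
rewrite (_ : hcube a l = [set x | forall i, `[a ord0 i, a ord0 i + l[%classic
  (x ord0 i)])//.
Qed.

Lemma measurable_cube a l : 0 < l -> measurable (cube a l).
Proof. by move=> /ltW/(cubeP a)[]. Qed.

Lemma mu_cube a l : 0 < l -> mu (cube a l) = (l ^+ n)%:E.
Proof. by move=> /ltW/(cubeP a)[]. Qed.

Lemma measurable_is_cube (Q : set Rn) : is_cube Q -> measurable Q.
Proof. by move=> [a [l [l0 ->]]]; exact: measurable_cube. Qed.

Lemma mu_is_cube (Q : set Rn) : is_cube Q -> exists2 r : R, 0 < r & mu Q = r%:E.
Proof.
move=> [a [l [l0 ->]]]; rewrite mu_cube//; exists (l ^+ n) => //.
exact: exprn_gt0.
Qed.

Lemma hcube_cube a l : hcube a l `<=` cube a l.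
Proof. by move=> x h i; have /andP[-> /ltW] := h i. Qed.

Lemma mu_cubeD_hcube a l : 0 < l -> mu (cube a l `\` hcube a l) = 0%E.
Proof.
move=> l0; have [m1 e1] := cubeP a (ltW l0); have [m2 e2] := hcubeP a (ltW l0).
rewrite measureD//; last by rewrite [X in (X < _)%E]e1 ltry.
by rewrite setIidr ?[X in (X - _)%E]e1 ?[X in (_ - X)%E]e2 ?subee//;
  exact: hcube_cube.
Qed.

Lemma is_cube_cube a l : 0 < l -> is_cube (cube a l).
Proof. by move=> l0; exists a, l. Qed.

Lemma compact_cube a l : compact (cube a l).
Proof.
have := @rV_compact R n (fun i => `[a ord0 i, a ord0 i + l]%classic).
rewrite (_ : mkset _ = cube a l); first by apply => i; exact: segment_compact.
by apply/seteqP; split => x /= h i; have := h i; rewrite in_itv.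
Qed.

End cubes.

Section grid.
Context {R : realType} {n : nat}.
Local Notation Rn := 'rV[R]_n.
Local Notation mu := (lebesgue_rV R n).
Variables (o : Rn) (L : R).
Hypothesis L0 : 0 < L.

(** A cube of the grid of origin [o] and top side [L] is named by its level [k]
    and its integer coordinates; at level [k] the side is [L / 2 ^+ k]. Points
    are sorted into cubes by rounding down, so that two points lie in the same
    cube exactly when their indices agree. *)
Definition gside (k : nat) : R := L / 2 ^+ k.

Definition gidx (k : nat) (x : Rn) : 'rV[int]_n :=
  \row_i floor ((x ord0 i - o ord0 i) / gside k).

Definition gcube (c : nat * 'rV[int]_n) : set Rn := [set x | gidx c.1 x = c.2].

Definition gcorner (c : nat * 'rV[int]_n) : Rn :=
  \row_i (o ord0 i + (c.2 ord0 i)%:~R * gside c.1).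

Definition ganc (j : nat) (c : nat * 'rV[int]_n) : nat * 'rV[int]_n :=
  (j, gidx j (gcorner c)).

Lemma gside_gt0 k : 0 < gside k.
Proof. by rewrite divr_gt0// exprn_gt0. Qed.

Lemma gsideD j m : gside j = 2 ^+ m * gside (j + m).
Proof.
rewrite /gside exprD invfM mulrCA [X in _ = _ * X]mulrCA mulfV ?mulr1// expf_neq0.
Qed.

Lemma gcubeE c : gcube c = hcube (gcorner c) (gside c.1).
Proof.
have s0 := gside_gt0 c.1.
apply/seteqP; split => x /=.
  move=> xc i; rewrite !mxE.
  have := floor_itv ((x ord0 i - o ord0 i) / gside c.1).
  move/rowP: xc => /(_ i); rewrite mxE => ->.
  rewrite ler_pdivlMr// ltr_pdivrMr// intrD mulrDl mul1r.
  by rewrite lerBrDl ltrBlDl addrA.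
move=> h; apply/rowP => i; rewrite mxE.
apply: floor_def; have := h i; rewrite !mxE.
by rewrite ler_pdivlMr// ltr_pdivrMr// intrD mulrDl mul1r lerBrDl ltrBlDl addrA.
Qed.

Lemma mem_gcube k x : gcube (k, gidx k x) x. Proof. by []. Qed.

Lemma gcube_corner c : gcube c (gcorner c).
Proof. by rewrite gcubeE => i; rewrite lexx ltrDl gside_gt0. Qed.

Lemma measurable_gcube c : measurable (gcube c).
Proof. by rewrite gcubeE; have [] := hcubeP (gcorner c) (ltW (gside_gt0 c.1)). Qed.

Lemma mu_gcube c : mu (gcube c) = (gside c.1 ^+ n)%:E.
Proof. by rewrite gcubeE; have [] := hcubeP (gcorner c) (ltW (gside_gt0 c.1)). Qed.

(** The half-open grid cubes are disjoint, whereas averages, condition F and the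
    oscillation bounds are about closed cubes. *)
Definition gclosure c : set Rn := cube (gcorner c) (gside c.1).

Lemma is_cube_gclosure c : is_cube (gclosure c).
Proof. exact/is_cube_cube/gside_gt0. Qed.

Lemma gcube_closure c : gcube c `<=` gclosure c.
Proof. by rewrite gcubeE; exact: hcube_cube. Qed.

Lemma mu_gclosure c : mu (gclosure c) = (gside c.1 ^+ n)%:E.
Proof. exact/mu_cube/gside_gt0. Qed.

Lemma gclosureD_null c : mu (gclosure c `\` gcube c) = 0%E.
Proof. by rewrite gcubeE; exact/mu_cubeD_hcube/gside_gt0. Qed.

Lemma gidx_le j k x y : (j <= k)%N -> gidx k x = gidx k y -> gidx j x = gidx j y.
Proof.
move=> jk; have s0 := gside_gt0 k => /rowP E; apply/rowP => i; move: (E i).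
rewrite !mxE -(subnKC jk) (gsideD j (k - j)) subnKC//.
move: (x ord0 i - _) (y ord0 i - _) => u v uv.
set N : int := 2 ^+ (k - j).
have NE : 2 ^+ (k - j) = N%:~R :> R by rewrite rmorphXn.
have N0 : 0 < N%:~R :> R by rewrite -NE exprn_gt0.
apply: floor_def; have := floor_itv (v / (2 ^+ (k - j) * gside k)).
rewrite NE; set z := floor _ => /andP[z1 z2].
have conv w : (z%:~R <= w / (N%:~R * gside k) < (z + 1)%:~R) =
    ((z * N <= floor (w / gside k)) && (floor (w / gside k) < (z + 1) * N)).
  rewrite floor_ge_int floor_lt_int !intrM ler_pdivlMr ?ltr_pdivrMr ?mulr_gt0//.
  by rewrite (ler_pdivlMr _ _ s0) -!(mulrA _ N%:~R (gside k)).
by rewrite conv uv -conv z1 z2.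
Qed.

Lemma gcube_sub c c' x : (c.1 <= c'.1)%N -> gcube c x -> gcube c' x ->
  gcube c' `<=` gcube c.
Proof.
move=> cc' cx c'x y c'y; rewrite /gcube /= -cx; apply: (gidx_le cc').
by rewrite c'y c'x.
Qed.

Lemma ganc_sub j c : (j <= c.1)%N -> gcube c `<=` gcube (ganc j c).
Proof.
move=> jc; apply: (@gcube_sub (ganc j c) c (gcorner c)) => //.
exact: gcube_corner.
Qed.

Lemma ganc_eq c x : gcube c x -> c = (c.1, gidx c.1 x).
Proof. by case: c => k z /= cx; rewrite -[z]cx. Qed.

Lemma gancE j c x : (j <= c.1)%N -> gcube c x -> ganc j c = (j, gidx j x).
Proof. by move=> jc cx; rewrite (ganc_eq (ganc_sub jc cx)). Qed.

Lemma gcube_dist c x y i : gcube c x -> gcube c y ->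
  `|x ord0 i - y ord0 i| < gside c.1.
Proof.
rewrite gcubeE => /(_ i)/andP[x1 x2] /(_ i)/andP[y1 y2].
by rewrite ltr_distlC; apply/andP; split; lra.
Qed.

Definition gmaximal (P : set (nat * 'rV[int]_n)) : set (nat * 'rV[int]_n) :=
  [set c | P c /\ forall j, (j < c.1)%N -> ~ P (ganc j c)].

Lemma gmaximal_trivIset P : trivIset (gmaximal P) gcube.
Proof.
move=> c c' [Pc mc] [Pc' mc'] [x [cx c'x]].
rewrite (ganc_eq cx) (ganc_eq c'x).
suff -> : c.1 = c'.1 by [].
case: (ltngtP c.1 c'.1) => // lt.
  by case: (mc' _ lt); rewrite (gancE (ltnW lt) c'x) -(ganc_eq cx).
by case: (mc _ lt); rewrite (gancE (ltnW lt) cx) -(ganc_eq c'x).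
Qed.

(** Levels are natural numbers, so among the ancestors of a cube having a
    property there is a largest one. *)
Lemma gmaximal_cover (P : set (nat * 'rV[int]_n)) c : P c ->
  exists c', [/\ gmaximal P c', (c'.1 <= c.1)%N & gcube c `<=` gcube c'].
Proof.
move=> Pc; have ex : exists j, (j <= c.1)%N && `[< P (ganc j c) >].
  exists c.1; rewrite leqnn; apply/asboolP.
  by rewrite (gancE (leqnn _) (gcube_corner c)) -(ganc_eq (gcube_corner c)).
case: (ex_minnP ex) => j /andP[jc /asboolP Pj] jmin.
exists (ganc j c); split => //; last exact: ganc_sub.
split => // i ij Pi.
have := jmin i; rewrite (leq_trans (ltnW ij) jc)/= leqNgt ij => /(_ _)/negP.
apply=> //; apply/asboolP; move: Pi.
have cx := gcube_corner c.
rewrite (gancE (leq_trans (ltnW ij) jc) cx).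
by rewrite (gancE (c := ganc j c) (ltnW ij) (ganc_sub jc cx)).
Qed.

Lemma bigcup_gmaximal P :
  \bigcup_(c in gmaximal P) gcube c = \bigcup_(c in P) gcube c.
Proof.
apply/seteqP; split => x [c Pc cx]; first by case: Pc => Pc _; exists c.
by have [c' [Pc' _ sub]] := gmaximal_cover Pc; exists c' => //; exact: sub.
Qed.

(** A set that contains a grid cube around each of its points. Every open set
    is such a union of cubes; contrary to open sets, these are disjoint unions
    of cubes of the grid, namely of the maximal ones. *)
Definition gopen (U : set Rn) :=
  forall x, U x -> exists k, gcube (k, gidx k x) `<=` U.

Lemma gopenE U : gopen U ->
  U = \bigcup_(c in gmaximal [set c | gcube c `<=` U]) gcube c.
Proof.
move=> oU; rewrite bigcup_gmaximal; apply/seteqP; split => [x Ux|x [c /= cU cx]].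
  by have [k kU] := oU _ Ux; exists (k, gidx k x).
exact: cU.
Qed.

Lemma measurable_gopen U : gopen U -> measurable U.
Proof.
move=> oU; rewrite (gopenE oU); apply: measurable_bigcup_countable => c _.
exact: measurable_gcube.
Qed.

Lemma gopen_gcube c : gopen (gcube c).
Proof. by move=> x cx; exists c.1; rewrite -(ganc_eq cx). Qed.

Lemma gopenT : gopen setT.
Proof. by move=> x _; exists 0%N. Qed.

Lemma gopenI U V : gopen U -> gopen V -> gopen (U `&` V).
Proof.
move=> oU oV x [Ux Vx]; have [j jU] := oU _ Ux; have [k kV] := oV _ Vx.
exists (maxn j k) => y xy; split.
  by apply: jU; apply: (gidx_le (leq_maxl j k)); rewrite xy.
by apply: kV; apply: (gidx_le (leq_maxr j k)); rewrite xy.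
Qed.

Lemma gopen_bigcup (I : Type) (D : set I) (U : I -> set Rn) :
  (forall i, D i -> gopen (U i)) -> gopen (\bigcup_(i in D) U i).
Proof.
move=> oU x [i Di Ux]; have [k kU] := oU _ Di _ Ux.
by exists k => y /kU Uy; exists i.
Qed.

Lemma gopen_bigcap_ltn N (U : nat -> set Rn) :
  (forall i, gopen (U i)) -> gopen (\bigcap_(i < N) U i).
Proof.
move=> oU; elim: N => [|N IH]; first by rewrite bigcap_mkord big_ord0; exact: gopenT.
rewrite bigcap_mkord big_ord_recr/= -bigcap_mkord; exact: gopenI.
Qed.

(** Points closer than a positive distance share a cube of high level. *)
Lemma gopen_nbhs (U : set Rn) :
  (forall x, U x -> exists2 e : R, 0 < e &
    forall y : Rn, (forall i, `|y ord0 i - x ord0 i| < e) -> U y) -> gopen U.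
Proof.
move=> h x /h[e e0 eU]; have [k ke] := real_small_power L e0.
exists k => y xy; apply: eU => i; apply: lt_trans ke.
exact: (gcube_dist i xy (mem_gcube k x)).
Qed.

End grid.

(** * Outer regularity and a density lemma *)

Lemma measure_cap_empty d (T : measurableType d) (R : realType)
    (m : {measure set T -> \bar R}) (F : (set T)^nat) (e : R) :
  (m (F 0%N) < +oo)%E -> (forall i, measurable (F i)) ->
  {homo F : i j / (i <= j)%N >-> (j <= i)%O} -> \bigcap_i F i = set0 ->
  0 < e -> exists N, (m (F N) <= e%:E)%E.
Proof.
move=> Ffin mF dF F0 e0.
have := nonincreasing_cvg_mu Ffin mF; rewrite F0 measure0 => /(_ measurable0 dF) cv.
have : nbhs 0%E [set x : \bar R | (x < e%:E)%E].
  apply: open_nbhs_nbhs; split; first exact: open_ereal_lt_ereal.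
  by rewrite /= lte_fin.
by move=> /cv[N _ hN]; exists N; apply/ltW/hN => /=.
Qed.

Lemma measurable_coord_preimage (R : realType) n (i : 'I_n) (B : set R) :
  measurable B -> measurable [set x : 'rV[R]_n | B (x ord0 i)].
Proof.
move=> mB; have := @measurable_coord _ R n i measurableT _ mB.
by rewrite setTI.
Qed.

Section regularity.
Context {R : realType} {n : nat}.
Local Notation Rn := 'rV[R]_n.
Local Notation mu := (lebesgue_rV R n).
Variables (o : Rn) (L : R).
Hypothesis L0 : 0 < L.
Local Notation gopen := (gopen o L).
Local Notation gcube := (gcube o L).
Variable K : set Rn.
Hypothesis mK : measurable K.
Hypothesis Kfin : (mu K < +oo)%E.

(** Sets squeezed inside [K] between grid-open sets from outside and from
    inside; the approximation is stated symmetrically in the set and its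
    complement, which makes these sets visibly a sigma-algebra. *)
Definition squeezed (A : set Rn) := measurable A /\
  forall e : R, 0 < e -> exists U V, [/\ gopen U, gopen V, A `<=` U, ~` A `<=` V &
    (mu (U `&` V `&` K) <= e%:E)%E].

Lemma squeezedC A : squeezed A -> squeezed (~` A).
Proof.
move=> [mA h]; split; first exact: measurableC.
move=> e e0; have [U [V [oU oV AU AV UV]]] := h e e0.
by exists V, U; split=> //; rewrite ?setCK// (setIC V).
Qed.

Lemma squeezed_set0 : squeezed set0.
Proof.
split=> // e e0; exists set0, setT; split => //.
- exact: gopenT.
- by rewrite !set0I measure0 lee_fin ltW.
Qed.

(** From outside, the union of the coverings; from inside, the intersection of
    finitely many of them, the rest of the union having small measure. *)
Lemma squeezed_bigcup (A : nat -> set Rn) :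
  (forall i, squeezed (A i)) -> squeezed (\bigcup_i A i).
Proof.
move=> sA; have mA i : measurable (A i) by have [] := sA i.
split; first exact: bigcupT_measurable.
move=> e e0.
have e20 : 0 < e / 2 by rewrite divr_gt0.
have ei i : 0 < e / 2 / (2 ^ i.+1)%:R :> R.
  by rewrite divr_gt0// ltr0n expn_gt0.
have [U hU] : exists U : nat -> set Rn, forall i, exists V,
    [/\ gopen (U i), gopen V, A i `<=` U i, ~` A i `<=` V &
    (mu (U i `&` V `&` K) <= (e / 2 / (2 ^ i.+1)%:R)%:E)%E].
  have [f hf] := choice (fun i => (sA i).2 _ (ei i)).
  by exists f => i; have [V hV] := hf i; exists V.
have [V hV] := choice hU.
pose B N := (\bigcup_i A i `\` \bigcup_(i < N) A i) `&` K.
have mB N : measurable (B N).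
  apply: measurableI => //; apply: measurableD; first exact: bigcupT_measurable.
  by rewrite bigcup_mkord; apply: bigsetU_measurable.
have B0 : \bigcap_N B N = set0.
  apply/seteqP; split => // x BNx; have [[[i _ Aix] _] _] := BNx 0%N I.
  by have [[_ +] _] := BNx i.+1 I; apply; exists i => /=.
have [N BN] : exists N, (mu (B N) <= (e / 2)%:E)%E.
  apply: measure_cap_empty => //.
  - by rewrite (le_lt_trans _ Kfin)// le_measure ?inE// => x [].
  - move=> i j ij; apply/subsetPset => x [[Ax nA] Kx]; split=> //; split=> //.
    by apply: contra_not nA => -[k /= ki Akx]; exists k => //=; exact: leq_trans ij.
exists (\bigcup_i U i), (\bigcap_(i < N) V i); split.
- by apply: gopen_bigcup => i _; have [] := hV i.
- by apply: gopen_bigcap_ltn => // i; have [] := hV i.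
- by move=> x [i _ Aix]; exists i => //; have [_ _ + _ _] := hV i; apply.
- move=> x nAx i _; have [_ _ _ + _] := hV i; apply => Ax.
  by apply: nAx; exists i.
have mUV i : measurable (U i `&` V i `&` K).
  apply: measurableI => //; have [oU oV _ _ _] := hV i.
  by apply: measurableI; [exact: measurable_gopen oU|exact: measurable_gopen oV].
apply: (@le_trans _ _ (mu (\bigcup_i (U i `&` V i `&` K)) + mu (B N))%E); last first.
  rewrite [in leRHS](splitr e) EFinD leeD//.
  apply: (@le_trans _ _ (\sum_(i <oo) mu (U i `&` V i `&` K))%E).
    apply: measure_sigma_subadditive => //; exact: bigcupT_measurable.
  have := @epsilon_trick R (fun=> 0%E) (e / 2) xpredT (fun=> lexx _) (ltW e20).
  rewrite [X in (_ <= X + _)%E]eseries0// add0e; apply: le_trans.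
  apply: lee_nneseries => // i _; rewrite add0e.
  by have [_ _ _ _] := hV i.
apply: le_trans (measureU2 _ _ _) => //; last exact: bigcupT_measurable.
rewrite le_measure ?inE//.
- apply: measurableI => //; apply: measurableI.
    apply: (@measurable_gopen _ _ o L) => //; apply: gopen_bigcup => i _.
    by have [] := hV i.
  apply: (@measurable_gopen _ _ o L) => //; apply: gopen_bigcap_ltn => // i.
  by have [] := hV i.
- by apply: measurableU => //; exact: bigcupT_measurable.
move=> x [[[i _ Uix] VNx] Kx].
have [Vix|nVix] := pselect (V i x); first by left; exists i.
have Aix : A i x.
  by apply: contrapT => nA; apply: nVix; have [_ _ _ + _] := hV i; apply.
have [[j jN Ajx]|nA] := pselect ((\bigcup_(i < N) A i) x); last first.
  by right; split=> //; split=> //; exists i.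
left; exists j => //; split=> //; split; last exact: VNx.
by have [_ _ + _ _] := hV j; apply.
Qed.

(** Half-spaces [x_i < r] are grid-open; their complements are approximated by
    the half-spaces [x_i > r - 1/m]. *)
Lemma squeezed_coord (i : 'I_n) (B : set R) : measurable B ->
  squeezed [set x : Rn | B (x ord0 i)].
Proof.
pose H := [set B : set R | squeezed [set x : Rn | B (x ord0 i)]].
suff : measurable `<=` H by apply.
have -> : (measurable : set (set R)) = (RGenInftyO.G (R:=R)).-sigma.-measurable.
  exact: RGenInftyO.measurableE.
apply: smallest_sub; first split.
- exact: squeezed_set0.
- by move=> A /squeezedC sA; rewrite setTD.
- by move=> A sA; apply: squeezed_bigcup.
move=> _ [r ->]; rewrite /H /=; split.
  exact: (@measurable_coord_preimage R n i `]-oo, r[%classic).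
move=> e e0.
pose S m : set Rn := [set x : Rn | r - m.+1%:R^-1 < x ord0 i < r] `&` K.
have mS m : measurable (S m).
  apply: measurableI => //.
  rewrite (_ : mkset _ = [set x : Rn | `]r - m.+1%:R^-1, r[%classic (x ord0 i)]).
    exact: (@measurable_coord_preimage R n i `]r - m.+1%:R^-1, r[%classic).
  by apply/seteqP; split => x /=; rewrite in_itv.
have [m Sm] : exists m, (mu (S m) <= e%:E)%E.
  have S0 : \bigcap_m S m = set0.
    apply/seteqP; split => // x Sx.
    have [/andP[_ xr] _] := Sx 0%N I.
    have d0 : 0 < r - x ord0 i by rewrite subr_gt0.
    have [/andP[+ _] _] := Sx (truncn (r - x ord0 i)^-1) I.
    apply/negP; rewrite -leNgt lerBrDr addrC -lerBrDr.
    rewrite invf_ple ?posrE//; exact/ltW/truncnS_gt.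
  apply: measure_cap_empty => //.
  - by rewrite (le_lt_trans _ Kfin)// le_measure ?inE// => x [].
  - move=> p q pq; apply/subsetPset => x [/andP[x1 x2] Kx]; split=> //=.
    rewrite x2 andbT (le_lt_trans _ x1)// lerD2l lerN2 lef_pV2 ?posrE//.
    by rewrite ler_nat.
exists [set x : Rn | x ord0 i < r], [set x : Rn | r - m.+1%:R^-1 < x ord0 i]; split.
- apply: gopen_nbhs => // x /= xr; exists (r - x ord0 i); first by rewrite subr_gt0.
  by move=> y /(_ i); rewrite ltr_norml => /andP[_]; rewrite ltrD2r.
- apply: gopen_nbhs => // x /= xr; exists (x ord0 i - (r - m.+1%:R^-1)).
    by rewrite subr_gt0.
  by move=> y /(_ i); rewrite ltr_norml => /andP[+ _]; rewrite opprB ltrD2r.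
- by move=> x /=; rewrite in_itv.
- move=> x /=; rewrite in_itv/= => /negP; rewrite -leNgt; apply: lt_le_trans.
  by rewrite ltrBlDr ltrDl invr_gt0.
- rewrite (_ : _ `&` _ `&` _ = S m)//.
  by apply/seteqP; split => x; rewrite /S/= => -[]; [move=> [-> ->]|move=> /andP[-> ->]].
Qed.

Lemma squeezed_measurable A : measurable A -> squeezed A.
Proof.
suff h : measurable `<=` squeezed by exact: h.
apply: smallest_sub; first split.
- exact: squeezed_set0.
- by move=> B /squeezedC; rewrite setTD.
- exact: squeezed_bigcup.
rewrite -bigcup_seq => _ [i _ [B mB <-]].
by rewrite setTI; exact: squeezed_coord.
Qed.

(** A set covered by a grid-open set of nearly the same measure cannot fill
    less than a fixed proportion of each cube: the cubes of such a covering
    would show its measure to be a proportion of itself. This is the dyadic form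
    of the Lebesgue density theorem. *)
Lemma density_null (E : set Rn) (r : R) : 0 <= r < 1 ->
  measurable E -> E `<=` K -> gopen K ->
  (forall c, (mu (E `&` gcube c) <= r%:E * mu (gcube c))%E) -> mu E = 0%E.
Proof.
move=> /andP[r0 r1] mE EK oK dE.
have Efin : (mu E < +oo)%E by rewrite (le_lt_trans _ Kfin)// le_measure ?inE.
have key e : 0 < e -> ((1 - r)%:E * mu E <= e%:E)%E.
  move=> e0; have [_ /(_ _ e0)[U [V [oU oV EU EV UV]]]] := squeezed_measurable mE.
  pose W := U `&` K.
  have oW : gopen W by exact: gopenI.
  have mW : measurable W by exact: measurable_gopen oW.
  have WE : W = E `|` (W `\` E).
    by rewrite setDUK// => x Ex; split; [exact: EU|exact: EK].
  have Wle : (mu W <= mu E + e%:E)%E.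
    rewrite [in leLHS]WE; apply: le_trans (measureU2 _ _ _) _ => //.
      exact: measurableD.
    rewrite leeD2l//; apply: le_trans UV; rewrite le_measure ?inE//.
    - exact: measurableD.
    - apply: measurableI => //; apply: measurableI.
        exact: measurable_gopen oU.
      exact: measurable_gopen oV.
    by move=> x [[Ux Kx] nEx]; split=> //; split=> //; exact: EV.
  have : (mu E <= r%:E * mu W)%E.
    have -> : E = W `&` E by rewrite setIC WE setIUr setIid setUidl// => x [].
    have := @countably_additive_le_bigcup _ Rn R _ (fun A => mu (A `&` E))
      (fun A => r%:E * mu A)%E (gmaximal o L [set c | gcube c `<=` W]) gcube.
    rewrite -gopenE//; apply.
    - exact/countably_additive_restr/countably_additive_mu.
    - exact/countably_additive_scale/countably_additive_mu.
    - by move=> c _; exact: measurable_gcube.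
    - exact: gmaximal_trivIset.
    - by move=> c _; rewrite setIC.
  move=> Er; have : (mu E <= r%:E * (mu E + e%:E))%E.
    by rewrite (le_trans Er)// lee_wpmul2l.
  rewrite -[mu E]fineK ?ge0_fin_numE// -!EFinD -!EFinM !lee_fin => h.
  rewrite mulrBl mul1r lerBlDr; apply: le_trans h _.
  by rewrite mulrDr addrC lerD2r ler_piMl// ltW.
apply/eqP; rewrite eq_le measure_ge0 andbT.
have r10 : 0 < 1 - r by rewrite subr_gt0.
apply/lee_addgt0Pr => e e0; rewrite add0e.
have := key _ (mulr_gt0 r10 e0); rewrite EFinM lee_pmul2l// lte_fin//.
Qed.

End regularity.

(** * The maximal operator and its weighted weak-type estimate *)

Section maximal_operator.
Context {R : realType} {n : nat}.
Local Notation Rn := 'rV[R]_n.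
Local Notation mu := (lebesgue_rV R n).
Local Open Scope ereal_scope.

(** The maximal operator on nonnegative extended real functions, so that it can
    be iterated. *)
Definition emax (V : Rn -> \bar R) (x : Rn) : \bar R :=
  ereal_sup [set (mu Q)^-1 * \int[mu]_(y in Q) V y
            | Q in [set Q | is_cube Q /\ Q x]].

Lemma maximalE (f : Rn -> R) x : maximal f x = emax (fun y => `|f y|%:E) x.
Proof. by []. Qed.

Lemma le_average (Q : set Rn) (V : Rn -> \bar R) (c : \bar R) : is_cube Q ->
  ((mu Q)^-1 * \int[mu]_(y in Q) V y <= c) = (\int[mu]_(y in Q) V y <= mu Q * c).
Proof.
by move=> /mu_is_cube[r r0 ->]; rewrite inver gt_eqF// lee_pdivrMl.
Qed.

Lemma integral_le_emax (Q : set Rn) (V : Rn -> \bar R) x : is_cube Q -> Q x ->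
  \int[mu]_(y in Q) V y <= mu Q * emax V x.
Proof.
by move=> cQ Qx; rewrite -le_average//; apply: ereal_sup_ubound; exists Q.
Qed.

Lemma emax_ge0 (V : Rn -> \bar R) x : (forall y, 0 <= V y) -> 0 <= emax V x.
Proof.
move=> V0; have cQ : is_cube (cube x 1) by exact: is_cube_cube.
have xQ : cube x 1 x by move=> i; rewrite lexx lerDl ler01.
have := integral_le_emax V cQ xQ; have [r r0 ->] := mu_is_cube cQ.
rewrite -lee_pdivrMl//; apply: le_trans.
by rewrite mule_ge0 ?lee_fin ?invr_ge0 ?(ltW r0)// integral_ge0.
Qed.

Lemma emax_cst1 x : emax (cst 1) x <= 1.
Proof.
apply: ge_ereal_sup => _ [Q [cQ Qx] <-].
by rewrite le_average// integral_cst ?mule1 ?mul1e//; exact: measurable_is_cube.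
Qed.

(** Lower semicontinuity: a cube over which the average is large may be
    enlarged a little. *)
Lemma emax_gt_gopen (V : Rn -> \bar R) (o : Rn) (L r : R) : (0 < L)%R ->
  measurable_fun setT V -> (forall y, 0 <= V y) ->
  gopen o L [set x | r%:E < emax V x].
Proof.
move=> L0 mV V0; apply: gopen_nbhs => // x /= /ereal_sup_gt[_ [Q [[a [l [l0 ->]]] Qx] <-]].
rewrite mu_cube// inver gt_eqF ?exprn_gt0// lte_pdivlMl ?exprn_gt0// => rI.
set I := \int[mu]_(y in _) V y in rI.
have [e e0 eI] : exists2 e : R, (0 < e)%R & ((l + e *+ 2) ^+ n)%:E * r%:E < I.
  have I0 : 0 <= I by exact: integral_ge0.
  case: I I0 rI => [I|_ _|//]; last by exists 1%R => //; rewrite ltry.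
  rewrite lee_fin -EFinM !lte_fin => I0 rI.
  pose F := fun e : R => ((l + e *+ 2) ^+ n * r)%R.
  have cF : {for 0%R, continuous F}.
    apply: continuousM; last exact: cst_continuous.
    apply: (@continuous_comp _ _ _ (fun e : R => l + e *+ 2)%R (fun y => y ^+ n)%R);
      last exact: exprn_continuous.
    apply: continuousD; first exact: cst_continuous.
    exact: natmul_continuous.
  have F0 : (F 0 < I)%R by rewrite /F mul0rn addr0.
  have : nbhs (F 0%R) [set y | (y < I)%R].
    by apply: open_nbhs_nbhs; split => //; exact: open_lt.
  move=> /cF/nbhs_ballP[d /= d0 dF]; exists (d / 2)%R; first by rewrite divr_gt0.
  rewrite -EFinM lte_fin; apply: dF.
  rewrite /ball /= sub0r normrN gtr0_norm ?divr_gt0//.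
  by rewrite ltr_pdivrMr// ltr_pMr// ltr1n.
exists e => // y xy; pose a' : Rn := (\row_i (a ord0 i - e))%R.
have l'0 : (0 < l + e *+ 2)%R by rewrite addr_gt0// pmulrn_rgt0.
have Q'y : cube a' (l + e *+ 2) y.
  move=> i; rewrite mxE; have := Qx i; have := xy i.
  rewrite ltr_distlC mulr2n => /andP[h1 h2] /andP[h3 h4].
  by apply/andP; split; lra.
have QQ' : cube a l `<=` cube a' (l + e *+ 2).
  move=> z Qz i; rewrite mxE; have := Qz i; rewrite mulr2n => /andP[h3 h4].
  by apply/andP; split; lra.
apply: (@lt_le_trans _ _ ((mu (cube a' (l + e *+ 2)))^-1 *
    \int[mu]_(y in cube a' (l + e *+ 2)) V y)).
  rewrite mu_cube// inver gt_eqF ?exprn_gt0// lte_pdivlMl ?exprn_gt0//.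
  apply: (lt_le_trans eI); apply: ge0_subset_integral => //.
  - exact: measurable_cube.
  - exact: measurable_cube.
  - exact: measurable_funTS.
by apply: ereal_sup_ubound; exists (cube a' (l + e *+ 2)) => //; split => //;
  exact: is_cube_cube.
Qed.

Lemma measurable_emax (V : Rn -> \bar R) : measurable_fun setT V ->
  (forall y, 0 <= V y) -> measurable_fun setT (emax V).
Proof.
move=> mV V0; apply: (measurability _ (ErealGenOInfty.measurableE R)).
move=> _ [_ [r ->] <-]; rewrite setTI.
rewrite (_ : _ @^-1` _ = [set x | r%:E < emax V x]).
  apply: (@measurable_gopen _ _ 0%R 1%R) => //; exact: emax_gt_gopen.
by apply/seteqP; split => x /=; rewrite in_itv/= andbT.
Qed.

Lemma measurable_maximal (f : Rn -> R) : measurable_fun setT f ->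
  measurable_fun setT (maximal f).
Proof.
move=> mf; apply: measurable_emax => //.
by apply/measurable_EFinP; exact: measurableT_comp.
Qed.

Lemma maximal_ge0 (f : Rn -> R) x : 0 <= maximal f x.
Proof. by rewrite maximalE emax_ge0. Qed.

(** The rest of [f] contributes at most [lam] to averages, hence is irrelevant to
    averages above [2 * lam]. *)
Definition cutoff (lam : R) (f : Rn -> R) (x : Rn) : R :=
  if (lam < `|f x|)%R then `|f x|%R else 0%R.

Lemma cutoff_ge0 lam f x : (0 <= cutoff lam f x)%R.
Proof. by rewrite /cutoff; case: ifP. Qed.

Lemma le_cutoff lam f x : (cutoff lam f x <= `|f x|)%R.
Proof. by rewrite /cutoff; case: ifP. Qed.

Lemma measurable_cutoff lam f : measurable_fun setT f ->
  measurable_fun setT (cutoff lam f).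
Proof.
move=> mf; have mn : measurable_fun setT (fun x => `|f x|%R).
  exact: measurableT_comp.
by apply: measurable_fun_ifT => //; exact: measurable_fun_ltr.
Qed.

End maximal_operator.

Section weak_type.
Context {R : realType} {n : nat}.
Hypothesis n_gt0 : (0 < n)%N.
Local Notation Rn := 'rV[R]_n.
Local Notation mu := (lebesgue_rV R n).
Local Open Scope ereal_scope.

(** The cube of three times the side with the same centre. *)
Definition gtriple (o : Rn) (L : R) (c : nat * 'rV[int]_n) : set Rn :=
  cube (\row_i (gcorner o L c ord0 i - gside L c.1))%R (3 * gside L c.1)%R.

Lemma gcube_triple o L c : (0 < L)%R -> gcube o L c `<=` gtriple o L c.
Proof.
move=> L0 x; have s0 := gside_gt0 L0 c.1; rewrite gcubeE// => cx i.
by have /andP[h1 h2] := cx i; rewrite mxE; apply/andP; split; lra.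
Qed.

(** A cube where the average of [g] is large meets a grid cube of comparable
    side where the average is still large: at most [5 ^ n] volumes of the cube
    are filled by the grid cubes of comparable side meeting it. *)
Lemma dyadic_average_gt (L l lam : R) (b : Rn) (g : Rn -> \bar R) :
  (0 < L)%R -> (0 < l < L)%R -> (0 <= lam)%R ->
  measurable_fun setT g -> (forall x, 0 <= g x) ->
  (5 ^+ n * lam * l ^+ n)%:E < \int[mu]_(y in cube b l) g y ->
  exists c y, [/\ gcube 0%R L c y, cube b l y, (l <= gside L c.1)%R &
    lam%:E * mu (gcube 0%R L c) < \int[mu]_(y in gcube 0%R L c) g y].
Proof.
move=> L0 /andP[l0 lL] lam0 mg g0 gl.
have [k lk kl] : exists2 k, (l <= gside L k)%R & (gside L k < 2 * l)%R.
  have exm : exists m, (gside L m < l)%R by exact: real_small_power.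
  case: (ex_minnP exm) => -[|k] mk kmin.
    by move: mk; rewrite /gside expr0 divr1 ltNge (ltW lL).
  exists k.
    by rewrite leNgt; apply/negP => /kmin; rewrite ltnn.
  by rewrite (gsideD L k 1) addn1 expr1 ltr_pM2l.
have d0 := gside_gt0 L0 k; set d := gside L k in lk kl d0.
pose P : set (nat * 'rV[int]_n) :=
  [set c | c.1 = k /\ exists2 y, gcube 0%R L c y & cube b l y].
have [[c [[ck [y cy by_]]] gc]|none] := pselect (exists c, P c /\
    lam%:E * mu (gcube 0%R L c) < \int[mu]_(y in gcube 0%R L c) g y).
  by exists c, y; split=> //; rewrite ck.
exfalso; move: gl; apply/negP; rewrite -leNgt.
have tP : trivIset P (gcube 0%R L).
  move=> c c' [ck _] [ck' _] [x [cx c'x]].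
  by rewrite (ganc_eq cx) (ganc_eq c'x) ck ck'.
have l'0 : (0 < l + d + d)%R by rewrite !addr_gt0.
pose b' : Rn := (\row_i (b ord0 i - d))%R.
have subP : \bigcup_(c in P) gcube 0%R L c `<=` cube b' (l + d + d)%R.
  move=> x [c [ck [y cy by_]] cx] i; rewrite mxE.
  have := gcube_dist L0 i cx cy; rewrite ck ltr_distlC => /andP[h1 h2].
  by have /andP[h3 h4] := by_ i; apply/andP; split; rewrite -/d in h1 h2; lra.
have subQ : cube b l `<=` \bigcup_(c in P) gcube 0%R L c.
  by move=> y by_; exists (k, gidx 0%R L k y) => //; split => //; exists y.
have mP : measurable (\bigcup_(c in P) gcube 0%R L c).
  by apply: measurable_bigcup_countable => c _; exact: measurable_gcube.
apply: (@le_trans _ _ (\int[mu]_(y in \bigcup_(c in P) gcube 0%R L c) g y)).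
  apply: ge0_subset_integral => //; first exact: measurable_cube.
  exact: measurable_funTS.
apply: (@le_trans _ _ (lam%:E * mu (\bigcup_(c in P) gcube 0%R L c))).
  apply: (@countably_additive_le_bigcup _ _ _ _
    (fun A => \int[mu]_(y in A) g y) (fun A => lam%:E * mu A)) => //.
  - exact: countably_additive_integral.
  - exact/countably_additive_scale/countably_additive_mu.
  - by move=> c _; exact: measurable_gcube.
  by move=> c Pc; rewrite leNgt; apply/negP => gc; apply: none; exists c.
apply: (@le_trans _ _ (lam%:E * mu (cube b' (l + d + d)%R))).
  by rewrite lee_wpmul2l// le_measure ?inE//; exact: measurable_cube.
rewrite mu_cube// -EFinM lee_fin [leRHS]mulrAC -exprMn [leRHS]mulrC.
by rewrite ler_wpM2l// lerXn2r ?nnegrE ?mulr_ge0//; lra.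
Qed.

(** The Fefferman-Stein inequality: the part of [f] below [lam] contributes at
    most [lam] to averages, so the level set is covered by the triples of the
    maximal grid cubes with large average of the rest, and on each of those the
    weight of the triple is an average dominated by [emax V]. *)
Lemma maximal_weak_type (V : Rn -> \bar R) (f : Rn -> R) (lam : R) :
  measurable_fun setT V -> (forall x, 0 <= V x) ->
  measurable_fun setT f -> \int[mu]_x `|f x|%:E < +oo -> (0 < lam)%R ->
  \int[mu]_(x in [set x | (2 * 5 ^+ n * lam)%:E < maximal f x]) V x <=
  (3 ^+ n / lam)%:E * \int[mu]_x ((cutoff lam f x)%:E * emax V x).
Proof.
move=> mV V0 mf f1 lam0.
have mg : measurable_fun setT (EFin \o cutoff lam f).
  by apply/measurable_EFinP; exact: measurable_cutoff.
have g0 x : 0 <= (cutoff lam f x)%:E by rewrite lee_fin cutoff_ge0.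
have I0 : 0 <= \int[mu]_x (cutoff lam f x)%:E by exact: integral_ge0.
have Ioo : \int[mu]_x (cutoff lam f x)%:E < +oo.
  apply: le_lt_trans f1; apply: ge0_le_integral_nomeas => // x _.
  by rewrite lee_fin le_cutoff.
have [I IE] : exists I : R, \int[mu]_x (cutoff lam f x)%:E = I%:E.
  by exists (fine (\int[mu]_x (cutoff lam f x)%:E)); rewrite fineK// ge0_fin_numE.
rewrite IE lee_fin in I0.
pose L := (1 + I / lam)%R.
have IL0 : (0 <= I / lam)%R by rewrite divr_ge0// ltW.
have L1 : (1 <= L)%R by rewrite lerDl.
have L0 : (0 < L)%R by rewrite (lt_le_trans _ L1).
have IL : (I < lam * L ^+ n)%R.
  apply: (@lt_le_trans _ _ (lam * L)%R).
    by rewrite mulrDr mulr1 mulrCA mulfV ?gt_eqF// mulr1 ltrDr.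
  by rewrite ler_wpM2l ?(ltW lam0)// ler_eXnr.
pose P : set (nat * 'rV[int]_n) := [set c | lam%:E * mu (gcube 0%R L c) <
  \int[mu]_(y in gcube 0%R L c) (cutoff lam f y)%:E].
have cover : [set x | (2 * 5 ^+ n * lam)%:E < maximal f x] `<=`
    \bigcup_(c in gmaximal 0%R L P) gtriple 0%R L c.
  move=> x /= /ereal_sup_gt[_ [Q [[b [l [l0 ->]]] Qx] <-]].
  have ln0 : (0 < l ^+ n)%R by exact: exprn_gt0.
  have cQ : is_cube (cube b l) by exact: is_cube_cube.
  have mQ := measurable_is_cube cQ.
  rewrite mu_cube// inver gt_eqF// lte_pdivlMl// => h.
  have fle : \int[mu]_(y in cube b l) `|f y|%:E <=
      \int[mu]_(y in cube b l) (cutoff lam f y)%:E + lam%:E * (l ^+ n)%:E.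
    rewrite -(mu_cube b l0) -integral_cst// -ge0_integralD//.
    - apply: ge0_le_integral_nomeas => // y _.
      rewrite -EFinD lee_fin /cutoff; case: ltP => [_|fl]; last by rewrite add0r.
      by rewrite lerDl ltW.
    - exact: measurable_funTS.
    - by move=> y _; rewrite lee_fin ltW.
  have gl : (5 ^+ n * lam * l ^+ n)%:E <
      \int[mu]_(y in cube b l) (cutoff lam f y)%:E.
    have := lt_le_trans h fle; rewrite -!EFinM -lteBlDr//; apply: le_lt_trans.
    rewrite lee_fin; have : (1 <= 5 ^+ n :> R)%R by rewrite exprn_ege1// ler1n.
    rewrite -(ler_pM2r (mulr_gt0 lam0 ln0)) mul1r; lra.
  have lL : (l < L)%R.
    rewrite -(@ltr_pXn2r _ n n_gt0) ?nnegrE ?(ltW l0) ?(ltW L0)//.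
    rewrite -(ltr_pM2l lam0); apply: le_lt_trans IL.
    rewrite -lee_fin -IE; apply: le_trans (le_trans (ltW gl) _).
      rewrite lee_fin -mulrA ler_peMl ?mulr_ge0 ?(ltW lam0) ?(ltW ln0)//.
      by rewrite exprn_ege1// ler1n.
    by apply: ge0_subset_integral => //; exact: mg.
  have l0L : (0 < l < L)%R by rewrite l0.
  have [c [y [cy by_ lc Pc]]] := dyadic_average_gt L0 l0L (ltW lam0) mg g0 gl.
  have [c' [mc' c'c sub]] := gmaximal_cover 0%R L0 (P := P) Pc.
  exists c' => //.
  have lc' : (l <= gside L c'.1)%R.
    apply: (le_trans lc); rewrite -(subnKC c'c) [leRHS](gsideD L c'.1 (c.1 - c'.1)).
    rewrite subnKC// ler_peMl ?(ltW (gside_gt0 _ _))//.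
    by rewrite exprn_ege1// ler1n.
  have := sub _ cy; rewrite gcubeE// => c'y i; rewrite mxE.
  have /andP[h1 h2] := c'y i; have /andP[h3 h4] := Qx i.
  by have /andP[h5 h6] := by_ i; apply/andP; split; lra.
have mtri c : measurable (gtriple 0%R L c).
  by apply: measurable_cube; rewrite mulr_gt0// gside_gt0.
have mcov : measurable (\bigcup_(c in gmaximal 0%R L P) gtriple 0%R L c).
  exact: measurable_bigcup_countable.
have mgV : measurable_fun setT (fun x => (cutoff lam f x)%:E * emax V x).
  by apply: emeasurable_funM => //; exact: measurable_emax.
have gV0 x : 0 <= (cutoff lam f x)%:E * emax V x.
  by rewrite mule_ge0// emax_ge0.
have c0 : (0 <= 3 ^+ n / lam)%R by rewrite divr_ge0 ?exprn_ge0// ltW.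
apply: (@le_trans _ _
    (\int[mu]_(x in \bigcup_(c in gmaximal 0%R L P) gtriple 0%R L c) V x)).
  apply: ge0_subset_integral => //.
    apply: (@measurable_gopen _ _ 0%R 1%R) => //; apply: emax_gt_gopen => //.
    by apply/measurable_EFinP; exact: measurableT_comp.
  exact: measurable_funTS.
apply: (le_trans (integral_bigcup_le_csum _ _ _ _)) => //.
apply: (@le_trans _ _ (csum (gmaximal 0%R L P) (fun c => (3 ^+ n / lam)%:E *
    \int[mu]_(x in gcube 0%R L c) ((cutoff lam f x)%:E * emax V x)))); last first.
  rewrite csumZl; last by move=> c _; exact: integral_ge0.
  rewrite lee_wpmul2l// -(@countably_additive_bigcup _ _ _ _
    (fun A => \int[mu]_(x in A) ((cutoff lam f x)%:E * emax V x))).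
  - apply: ge0_subset_integral => //; apply: measurable_bigcup_countable => c _.
    exact: measurable_gcube.
  - exact: countably_additive_integral.
  - by move=> c _; exact: measurable_gcube.
  - exact: gmaximal_trivIset.
apply: le_csum => c [Pc _]; first exact: integral_ge0.
have m0 : (0 < gside L c.1 ^+ n)%R by rewrite exprn_gt0// gside_gt0.
rewrite /P/= mu_gcube// in Pc.
set X := \int[mu]_(x in gtriple _ _ _) _.
set Y := \int[mu]_(x in gcube _ _ _) _.
have X0 : 0 <= X by exact: integral_ge0.
have XY : (lam * gside L c.1 ^+ n)%:E * X <= (3 ^+ n * gside L c.1 ^+ n)%:E * Y.
  apply: (@le_trans _ _
      ((\int[mu]_(y in gcube 0%R L c) (cutoff lam f y)%:E) * X)).
    by rewrite lee_wpmul2r// EFinM ltW.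
  rewrite -ge0_integralZr//; [|exact: measurable_gcube|exact: measurable_funTS].
  rewrite /Y -ge0_integralZl_EFin//; last 3 first.
  - exact: measurable_gcube.
  - exact: measurable_funTS.
  - by rewrite mulr_ge0 ?exprn_ge0// ltW// gside_gt0.
  apply: ge0_le_integral_nomeas => y cy; first by rewrite mule_ge0.
  rewrite muleCA lee_wpmul2l//.
  have s30 : (0 < 3 * gside L c.1)%R by rewrite mulr_gt0// gside_gt0.
  rewrite -exprMn -(mu_cube (\row_i (gcorner 0%R L c ord0 i - gside L c.1))%R s30).
  apply: integral_le_emax; first exact: is_cube_cube.
  exact: gcube_triple.
have k0 : (0 < lam * gside L c.1 ^+ n)%R by rewrite mulr_gt0.
rewrite -(@lee_pmul2l _ (lam * gside L c.1 ^+ n)%:E)//.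
apply: (le_trans XY); rewrite muleA -EFinM.
rewrite (_ : (_ * _ * (_ / _) = 3 ^+ n * gside L c.1 ^+ n)%R)//.
by rewrite mulrC -mulrA mulKf ?gt_eqF.
Qed.

(** The weak-type (1,1) estimate: averages of the weight one are at most one. *)
Lemma maximal_weak_type1 (f : Rn -> R) (lam : R) :
  measurable_fun setT f -> \int[mu]_x `|f x|%:E < +oo -> (0 < lam)%R ->
  mu [set x | (2 * 5 ^+ n * lam)%:E < maximal f x] <=
  (3 ^+ n / lam)%:E * \int[mu]_x (cutoff lam f x)%:E.
Proof.
move=> mf f1 lam0.
have := maximal_weak_type (V := cst 1%E) (measurable_cst _) (fun=> lee01) mf f1 lam0.
rewrite integral_cst; last first.
  apply: (@measurable_gopen _ _ 0%R 1%R) => //; apply: emax_gt_gopen => //.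
  by apply/measurable_EFinP; exact: measurableT_comp.
rewrite mul1e => h; apply: (le_trans h).
rewrite lee_wpmul2l//; first by rewrite lee_fin divr_ge0 ?exprn_ge0// ltW.
apply: ge0_le_integral_nomeas => y _.
  by rewrite mule_ge0 ?emax_ge0// lee_fin cutoff_ge0.
by rewrite -[leRHS]mule1 lee_wpmul2l ?lee_fin ?cutoff_ge0// emax_cst1.
Qed.

End weak_type.

(** * Doubling functions and the modular inequality for the maximal operator *)

Section condition_C_theory.
Context {R : realType}.
Variables (Phi : R -> R) (c0 : R).
Hypothesis PhiC : condition_C Phi c0.

Lemma condC_homo s t : 0 <= s -> s <= t -> Phi s <= Phi t.
Proof.
case: PhiC => _ h _ _ s0 st; apply: h => //; rewrite in_itv/= andbT//.
exact: le_trans st.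
Qed.

Lemma condC_ge0 t : 0 <= t -> 0 <= Phi t.
Proof.
by move=> t0; have [_ _ P0 _] := PhiC; rewrite -P0; exact: condC_homo.
Qed.

Lemma condC_double t : 0 <= t -> Phi (2 * t) <= c0 * Phi t.
Proof.
have [_ _ P0 h] := PhiC; rewrite le_eqVlt => /predU1P[<-|]; last exact: h.
by rewrite mulr0 P0 mulr0.
Qed.

Lemma condC_pow m t : 0 <= c0 -> 0 <= t -> Phi (2 ^+ m * t) <= c0 ^+ m * Phi t.
Proof.
move=> c00 t0; elim: m => [|m IH]; first by rewrite !expr0 !mul1r.
rewrite !exprS -!mulrA; apply: le_trans (condC_double _) _.
  by rewrite mulr_ge0// exprn_ge0.
by rewrite ler_wpM2l.
Qed.

Lemma condC_scale (K : R) : 0 <= c0 ->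
  exists2 C, 0 < C & forall t, 0 <= t -> Phi (`|K| * t) <= C * Phi t.
Proof.
move=> c00; pose m := archi_bound `|K|.
exists (c0 ^+ m + 1); first by rewrite ltr_wpDl// exprn_ge0.
move=> t t0; apply: (@le_trans _ _ (Phi (2 ^+ m * t))).
  by apply: condC_homo; rewrite ?mulr_ge0// ler_wpM2r// ltW// upper_nthrootP.
apply: (le_trans (condC_pow _ _ _)) => //.
by rewrite ler_wpM2r ?condC_ge0// lerDl.
Qed.

Lemma condC_add s t : 0 <= c0 -> 0 <= s -> 0 <= t ->
  Phi (s + t) <= c0 * Phi s + c0 * Phi t.
Proof.
move=> c00 s0 t0; wlog st : s t s0 t0 / s <= t => [h|].
  have [st|/ltW ts] := leP s t; first exact: h.
  by rewrite addrC [leRHS]addrC; exact: h.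
apply: (@le_trans _ _ (Phi (2 * t))).
  by apply: condC_homo; rewrite ?addr_ge0//; lra.
apply: (le_trans (condC_double t0)).
by rewrite lerDr mulr_ge0// condC_ge0.
Qed.

Lemma measurable_condC : measurable_fun (`[0%R, +oo[%classic : set R) Phi.
Proof.
by case: PhiC => cP _ _ _; exact: subspace_continuous_measurable_fun.
Qed.

Lemma measurable_condC_norm d (T : measurableType d) (f : T -> R) :
  measurable_fun setT f -> measurable_fun setT (fun x => Phi `|f x|).
Proof.
move=> mf; apply: (@measurable_comp _ _ _ _ _ _ (`[0%R, +oo[%classic : set R)) => //.
- by move=> _ [x _ <-]; rewrite /= in_itv/= normr_ge0.
- exact: measurable_condC.
- exact: measurableT_comp.
Qed.

End condition_C_theory.

(** [Phi t <= Phi (2 * t) <= c0 * Phi t] at any point where [Phi] is positive. *)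
Lemma young_const_ge1 (R : realType) (Phi : R -> R) c0 : young Phi c0 -> 1 <= c0.
Proof.
move=> [PhiC _ Phioo].
have [t t0 Pt] : exists2 t, 0 < t & 0 < Phi t.
  have /= := (cvgryPgt _).1 Phioo 0; move=> [M [Mr hM]].
  exists (Num.max M 0 + 1); first by rewrite ltr_wpDl// le_max lexx orbT.
  by apply: hM; rewrite ltr_pwDr// le_max lexx.
rewrite -(ler_pM2r Pt) mul1r; apply: le_trans (condC_double PhiC (ltW t0)).
by apply: (condC_homo PhiC); lra.
Qed.

Section dyadic_powers.
Context {R : realType}.
Implicit Types (t : R) (j : int).

Lemma pow2z_gt0 j : 0 < 2 ^ j :> R. Proof. exact: exprz_gt0. Qed.

Lemma pow2zS j : 2 ^ (j + 1) = 2 * 2 ^ j :> R.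
Proof. by rewrite expfzDr// expr1z mulrC. Qed.

Lemma pow2z_le j k : (2 ^ j <= 2 ^ k :> R) = (j <= k).
Proof. by rewrite ler_eXz2l// ltr1n. Qed.

Lemma dyadic_scale t : 0 < t -> exists j, 2 ^ j < t <= 2 ^ (j + 1).
Proof.
move=> t0; pose N := maxn (archi_bound t) (archi_bound t^-1).
have tN : t <= 2 ^+ N by rewrite ltW// upper_nthrootP// leq_maxl.
have Nt : 2 ^ (- N%:Z) < t.
  rewrite -exprz_inv -exprnP exprVn invf_plt ?posrE ?exprn_gt0//.
  by rewrite upper_nthrootP// leq_maxr.
have ex : exists m : nat, t <= 2 ^ (m%:Z - N%:Z).
  by exists (N + N)%N; rewrite PoszD addrK.
case: (ex_minnP ex) => -[|m] tm mmin.
  by move: tm; rewrite sub0r leNgt Nt.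
exists (m%:Z - N%:Z); apply/andP; split.
  by rewrite ltNge; apply/negP => /mmin; rewrite ltnn.
by rewrite addrAC -PoszD addn1.
Qed.

End dyadic_powers.

Section modular_inequality.
Context {R : realType} {n : nat}.
Hypothesis n_gt0 : (0 < n)%N.
Local Notation Rn := 'rV[R]_n.
Local Notation mu := (lebesgue_rV R n).
Variables (Phi Psi : R -> R) (c0 d0 c : R).
Hypothesis PhiC : condition_C Phi c0.
Hypothesis PsiC : condition_C Psi d0.
Hypothesis c00 : 0 <= c0.
Hypothesis PhiPsi : forall tau : R, 0 < tau ->
  (\int[lebesgue_measure]_(sigma in `]0%R, tau[)
        (Phi sigma / sigma ^+ 2)%:E <= (c * (Psi tau / tau))%:E)%E.

(** Monotonicity of [Phi] on each dyadic interval bounds the sum by four times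
    the integral up to [2 * t]. *)
Lemma dyadic_sum_le (t : R) : 0 < t ->
  (csum [set j : int | (2 : R) ^ j < t]%R (fun j => (Phi (2 ^ j) / 2 ^ j)%:E) <=
   (4 * (c * (Psi (2 * t) / (2 * t))))%:E)%E.
Proof.
move=> t0.
pose phi := (fun s : R => (Phi s / s ^+ 2)%:E) \_ `]0%R, +oo[%classic.
have phi0 s : (0 <= phi s)%E.
  apply: erestrict_ge0 => u; rewrite /= in_itv/= andbT => u0.
  by rewrite lee_fin divr_ge0 ?exprn_ge0 ?(condC_ge0 PhiC)// ltW.
have mphi : measurable_fun setT phi.
  apply/(measurable_restrictT _ _).1 => //; apply/measurable_EFinP.
  apply: measurable_funM.
    apply: measurable_funS (measurable_condC PhiC) => //.
    by move=> s; rewrite /= !in_itv/= !andbT => /ltW.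
  have E : {in `]0%R, +oo[%classic, (fun s : R => s^-1 ^+ 2) =1 (fun s => (s ^+ 2)^-1)}.
    by move=> s _ /=; rewrite exprVn.
  apply: (eq_measurable_fun _ E).
  apply: measurable_funX.
  apply: open_continuous_measurable_fun; first exact: interval_open.
  by move=> s; rewrite inE/= in_itv/= andbT => s0; apply: inv_continuous; rewrite gt_eqF.
pose F (j : int) : set R := `[2 ^ j, 2 ^ (j + 1)[%classic.
have mF j : measurable (F j) by exact: measurable_itv.
have lF j : lebesgue_measure (F j) = (2 ^ j)%:E.
  rewrite /F lebesgue_measure_itv/= lte_fin pow2zS ltr_pMl ?pow2z_gt0// ltr1n.
  by rewrite -EFinD; congr (_%:E); lra.
have phiF j : (4%:E * \int[lebesgue_measure]_(s in F j) phi s >=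
    (Phi (2 ^ j) / 2 ^ j)%:E)%E.
  have p0 := @pow2z_gt0 R j.
  rewrite -lee_pdivrMl//; apply: (@le_trans _ _
     (\int[lebesgue_measure]_(s in F j) (cst (Phi (2 ^ j) / (2 * 2 ^ j) ^+ 2)%:E s))%E).
    rewrite integral_cst; last exact: mF.
    rewrite [X in (_ <= _ * X)%E]lF -!EFinM lee_fin.
    have -> : (2 * 2 ^ j) ^+ 2 = 4 * 2 ^ j * 2 ^ j :> R by lra.
    by rewrite !invfM -!mulrA mulVf ?gt_eqF// mulr1 mulrCA lexx.
  apply: ge0_le_integral_nomeas => s; rewrite /F /= in_itv/= => /andP[s1 s2].
    by rewrite lee_fin divr_ge0 ?exprn_ge0 ?(condC_ge0 PhiC) ?mulr_ge0 ?(ltW p0).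
  rewrite /phi patchT; last by rewrite inE /= in_itv/= andbT (lt_le_trans p0).
  have s0 : 0 < s by exact: lt_le_trans s1.
  rewrite lee_fin ler_pM ?invr_ge0 ?exprn_ge0 ?(condC_ge0 PhiC) ?mulr_ge0 ?(ltW p0)//.
    exact: (condC_homo PhiC (ltW p0)).
  rewrite lef_pV2 ?posrE ?exprn_gt0 ?mulr_gt0//.
  by rewrite lerXn2r ?nnegrE ?(ltW s0)// ?mulr_ge0 ?(ltW p0)// -pow2zS ltW.
apply: (@le_trans _ _ (csum [set j : int | (2 : R) ^ j < t]%R
    (fun j => 4%:E * \int[lebesgue_measure]_(s in F j) phi s))%E).
  apply: le_csum => // j _; rewrite lee_fin divr_ge0 ?(condC_ge0 PhiC)//;
    exact/ltW/pow2z_gt0.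
rewrite csumZl; last by move=> j _; exact: integral_ge0.
rewrite EFinM lee_wpmul2l//.
apply: le_trans (PhiPsi (mulr_gt0 (ltr0n _ 2) t0)).
rewrite -(@countably_additive_bigcup _ _ _ _
    (fun A => \int[lebesgue_measure]_(s in A) phi s)%E) //; last 3 first.
- exact: countably_additive_integral.
- by move=> j _; exact: mF.
- move=> i j _ _ [s []]; rewrite /F /= !in_itv/= => /andP[i1 i2] /andP[j1 j2].
  have := le_lt_trans i1 j2; have := le_lt_trans j1 i2.
  rewrite !ltNge !pow2z_le -!ltNge => ji ij; apply/eqP.
  by rewrite eq_le -!ltzD1 ij ji.
apply: (@le_trans _ _ (\int[lebesgue_measure]_(s in `]0%R, (2 * t)%R[) phi s)%E).
  apply: ge0_subset_integral => //.
  - by apply: measurable_bigcup_countable => j _; exact: mF.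
  - exact: measurable_funTS.
  - move=> s [j /= jt]; rewrite /F /= !in_itv/= => /andP[j1 j2].
    rewrite (lt_le_trans (pow2z_gt0 j) j1)/= (lt_trans j2)//.
    by rewrite pow2zS ltr_pM2l.
apply: ge0_le_integral_nomeas => // s; rewrite /= in_itv/= => /andP[s0 _].
by rewrite /phi patchT// inE /= in_itv/= s0.
Qed.

Definition maximal_gt (f : Rn -> R) (r : R) : set Rn :=
  [set x : Rn | (r%:E < maximal f x)%E].

(** An upper bound for [Phi] at the maximal function, built from the levels
    [2 * 5 ^ n * 2 ^ j] of the weak-type inequality. A sum of indicators is
    measurable and makes sense where the maximal function is infinite. *)
Definition maximal_layers (f : Rn -> R) (x : Rn) : \bar R :=
  csum setT (fun j : int => (Phi (2 * 5 ^+ n * 2 ^ (j + 1)))%:E *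
    (\1_(maximal_gt f (2 * 5 ^+ n * 2 ^ j)) x)%:E)%E.

Let B_gt0 : 0 < 2 * 5 ^+ n :> R.
Proof. by rewrite mulr_gt0// exprn_gt0. Qed.

Let level_ge0 (j : int) : 0 <= Phi (2 * 5 ^+ n * 2 ^ j).
Proof. by rewrite (condC_ge0 PhiC)// mulr_ge0 ?(ltW B_gt0)// ltW// pow2z_gt0. Qed.

Let layer_ge0 f x (j : int) : (0 <= (Phi (2 * 5 ^+ n * 2 ^ (j + 1)))%:E *
    (\1_(maximal_gt f (2 * 5 ^+ n * 2 ^ j)) x)%:E)%E.
Proof. by rewrite mule_ge0 ?lee_fin ?level_ge0. Qed.

Lemma maximal_layers_ge0 f x : (0 <= maximal_layers f x)%E.
Proof. by apply: csum_ge0 => j _; exact: layer_ge0. Qed.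

Let measurable_level f (r : R) : measurable_fun setT f ->
  measurable (maximal_gt f r).
Proof.
move=> mf; apply: (@measurable_gopen _ _ 0 1) => //; apply: emax_gt_gopen => //.
by apply/measurable_EFinP; exact: measurableT_comp.
Qed.

Let measurable_layer f (j : int) : measurable_fun setT f ->
  measurable_fun setT (fun x => (Phi (2 * 5 ^+ n * 2 ^ (j + 1)))%:E *
    (\1_(maximal_gt f (2 * 5 ^+ n * 2 ^ j)) x)%:E)%E.
Proof.
move=> mf; apply: measurable_funeM; apply/measurable_EFinP.
by apply: measurable_indic; exact: measurable_level.
Qed.

Lemma measurable_maximal_layers f : measurable_fun setT f ->
  measurable_fun setT (maximal_layers f).
Proof.
move=> mf; apply: measurable_csum => [j _|j x _ _]; first exact: measurable_layer.
exact: layer_ge0.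
Qed.

Lemma maximal_layers_ge f x (b : R) : 0 <= b -> (b%:E <= maximal f x)%E ->
  ((Phi b)%:E <= maximal_layers f x)%E.
Proof.
rewrite le_eqVlt => /predU1P[<- _|b0 bM].
  by have [_ _ -> _] := PhiC; exact: maximal_layers_ge0.
have /dyadic_scale[j /andP[]] : 0 < b / (2 * 5 ^+ n) by rewrite divr_gt0.
rewrite ltr_pdivlMr// ler_pdivrMr// mulrC [X in _ <= X -> _]mulrC => jb bj.
have := @csum_ge_term _ R setT (fun j : int => (Phi (2 * 5 ^+ n * 2 ^ (j + 1)))%:E *
    (\1_(maximal_gt f (2 * 5 ^+ n * 2 ^ j)) x)%:E)%E j
    (fun j _ => layer_ge0 f x j) I.
apply: le_trans; rewrite indicE mem_set; last first.
  by apply: lt_le_trans bM; rewrite lte_fin.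
by rewrite mule1 lee_fin (condC_homo PhiC)// ltW.
Qed.

(** What the layers charge to a point where [|f|] equals [t]: the weak-type
    inequality at level [2 ^ j] sees it only if [2 ^ j < t], and the sum over
    these levels is the one controlled by [Psi]. *)
Let layers_cutoff_le : 0 < c -> 0 <= d0 -> exists2 C, 0 < C & forall t : R, 0 <= t ->
  (csum setT (fun j : int => (Phi (2 * 5 ^+ n * 2 ^ (j + 1)) * (3 ^+ n / 2 ^ j) *
     (if 2 ^ j < t then t else 0))%:E) <= (C * Psi t)%:E)%E.
Proof.
move=> c_gt0 d00.
have [K K0 hK] := condC_scale PhiC (2 * 5 ^+ n * 2) c00.
pose C := K * 3 ^+ n * (2 * c * d0).
have C0 : 0 <= C by rewrite !mulr_ge0 ?exprn_ge0// ltW.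
exists (C + 1); first by rewrite ltr_wpDl.
move=> t; rewrite le_eqVlt => /predU1P[<-|t0].
  have [_ _ -> _] := PsiC; rewrite mulr0 /csum eseries0// => i _ _.
  case: (pickle_inv i) => // j; rewrite asboolT// ltNge ltW ?pow2z_gt0//=.
  by rewrite mulr0.
have Psi0 : 0 <= Psi t by rewrite (condC_ge0 PsiC)// ltW.
apply: (@le_trans _ _ ((K * 3 ^+ n * t)%:E *
   csum [set j : int | (2 : R) ^ j < t]%R (fun j => (Phi (2 ^ j) / 2 ^ j)%:E))%E).
  rewrite -csumZl; last first.
    move=> j _; rewrite lee_fin divr_ge0 ?(condC_ge0 PhiC)//; exact/ltW/pow2z_gt0.
  rewrite /csum; apply: lee_nneseries => i _.
    move=> _; case: (pickle_inv i) => // j; rewrite asboolT// lee_fin.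
    rewrite !mulr_ge0 ?invr_ge0 ?exprn_ge0 ?level_ge0 ?(ltW (pow2z_gt0 _))//.
    by case: ifP => // _; rewrite ltW.
  case: (pickle_inv i) => // j; rewrite asboolT//.
  have p0 := @pow2z_gt0 R j.
  case: asboolP => /= jt; last by case: ifP => // _; rewrite mulr0.
  rewrite jt -EFinM lee_fin.
  have := hK (2 ^ j) (ltW p0); rewrite ger0_norm; last by rewrite mulr_ge0// ltW.
  rewrite -(mulrA (2 * 5 ^+ n)) -pow2zS => h.
  apply: (@le_trans _ _ (K * Phi (2 ^ j) * (3 ^+ n / 2 ^ j) * t)).
    rewrite ler_wpM2r ?(ltW t0)// ler_wpM2r//.
    by rewrite divr_ge0 ?exprn_ge0// ltW.
  by rewrite le_eqVlt; apply/orP; left; apply/eqP; lra.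
apply: (@le_trans _ _ ((K * 3 ^+ n * t)%:E *
    (4 * (c * (Psi (2 * t) / (2 * t))))%:E)%E).
  rewrite lee_wpmul2l ?dyadic_sum_le// lee_fin.
  by rewrite !mulr_ge0 ?exprn_ge0// ltW.
rewrite -EFinM lee_fin; apply: (@le_trans _ _ (C * Psi t)); last first.
  by rewrite ler_wpM2r// lerDl.
apply: (@le_trans _ _ (K * 3 ^+ n * (2 * c) * Psi (2 * t))).
  rewrite le_eqVlt; apply/orP; left; apply/eqP.
  have e : t * t^-1 = 1 by rewrite divff// gt_eqF.
  transitivity (K * 3 ^+ n * (2 * c) * Psi (2 * t) * (t / t)).
    by rewrite invfM; lra.
  by rewrite e mulr1.
rewrite /C -!mulrA ler_wpM2l ?(ltW K0)// ler_wpM2l ?exprn_ge0//.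
rewrite ler_wpM2l// ler_wpM2l ?(ltW c_gt0)//.
by apply: (condC_double PsiC); rewrite ltW.
Qed.

(** Integrating the layers, each level set is estimated by the weak-type
    inequality; the sum over the levels is then taken first. *)
Lemma maximal_modular : 0 < c -> 0 <= d0 -> exists2 C, 0 < C &
  forall (V : Rn -> \bar R) (f : Rn -> R),
    measurable_fun setT V -> (forall x, 0 <= V x)%E ->
    measurable_fun setT f -> (\int[mu]_x `|f x|%:E < +oo)%E ->
    (\int[mu]_x (maximal_layers f x * V x) <=
     C%:E * \int[mu]_x ((Psi `|f x|)%:E * emax V x))%E.
Proof.
move=> c_gt0 d00; have [C C0 hC] := layers_cutoff_le c_gt0 d00.
exists C => // V f mV V0 mf f1.
have mE : measurable_fun setT (emax V) by exact: measurable_emax.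
have E0 x : (0 <= emax V x)%E by exact: emax_ge0.
have Psi0 x : 0 <= Psi `|f x| by rewrite (condC_ge0 PsiC).
have mPsi : measurable_fun setT (fun x => (Psi `|f x|)%:E).
  by apply/measurable_EFinP; exact: (measurable_condC_norm PsiC).
have l30 (j : int) : 0 <= (3 ^+ n / 2 ^ j) :> R.
  by rewrite divr_ge0 ?exprn_ge0// ltW// pow2z_gt0.
have mcut (j : int) : measurable_fun setT
    (fun x => (cutoff (2 ^ j) f x)%:E * emax V x)%E.
  apply: emeasurable_funM => //; apply/measurable_EFinP.
  exact: measurable_cutoff.
have cut0 (j : int) x : (0 <= (cutoff (2 ^ j) f x)%:E * emax V x)%E.
  by rewrite mule_ge0// lee_fin cutoff_ge0.
pose G (j : int) x := ((Phi (2 * 5 ^+ n * 2 ^ (j + 1)) * (3 ^+ n / 2 ^ j) *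
     cutoff (2 ^ j) f x)%:E * emax V x)%E.
have G0' (j : int) x : 0 <= Phi (2 * 5 ^+ n * 2 ^ (j + 1)) * (3 ^+ n / 2 ^ j) *
     cutoff (2 ^ j) f x.
  by rewrite mulr_ge0 ?cutoff_ge0// mulr_ge0 ?level_ge0 ?l30.
have G0 j x : (0 <= G j x)%E.
  by rewrite mule_ge0// lee_fin G0'.
have GE j : G j = (fun x => (Phi (2 * 5 ^+ n * 2 ^ (j + 1)) * (3 ^+ n / 2 ^ j))%:E *
    ((cutoff (2 ^ j) f x)%:E * emax V x))%E.
  by apply/funext => x; rewrite /G EFinM muleA.
have mG j : measurable_fun setT (G j) by rewrite GE; exact: measurable_funeM.
rewrite -ge0_integralZl_EFin ?(ltW C0)//; last 2 first.
- by move=> x _; rewrite mule_ge0 ?lee_fin.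
- exact: emeasurable_funM.
apply: (@le_trans _ _ (\int[mu]_x csum setT (G^~ x))%E); last first.
  apply: ge0_le_integral_nomeas => x _; first by apply: csum_ge0.
  rewrite muleA -EFinM /G -csumMr//; last first.
    by move=> j _; rewrite lee_fin G0'.
  by rewrite lee_wpmul2r//; exact: hC.
rewrite integral_csum//.
apply: (@le_trans _ _ (\int[mu]_x csum setT (fun j : int =>
    (Phi (2 * 5 ^+ n * 2 ^ (j + 1)))%:E *
    ((\1_(maximal_gt f (2 * 5 ^+ n * 2 ^ j)) x)%:E * V x)))%E).
  apply: ge0_le_integral_nomeas => x _.
    by rewrite mule_ge0// maximal_layers_ge0.
  rewrite csumMr//; apply: le_csum => j _; first by rewrite mule_ge0.
  by rewrite muleA.
have mind j : measurable_fun setT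
    (fun x => (\1_(maximal_gt f (2 * 5 ^+ n * 2 ^ j)) x)%:E * V x)%E.
  apply: emeasurable_funM => //; apply/measurable_EFinP.
  by apply: measurable_indic; exact: measurable_level.
rewrite integral_csum//; last 2 first.
- by move=> j _; exact: measurable_funeM.
- by move=> j x _ _; rewrite !mule_ge0 ?lee_fin ?level_ge0.
apply: le_csum => j _.
  by apply: integral_ge0 => x _; rewrite !mule_ge0 ?lee_fin ?level_ge0.
rewrite ge0_integralZl_EFin ?level_ge0//; last by move=> x _; rewrite mule_ge0.
rewrite GE ge0_integralZl_EFin//; last by rewrite mulr_ge0 ?level_ge0 ?l30.
rewrite EFinM -muleA lee_wpmul2l ?lee_fin ?level_ge0//.
apply: le_trans (maximal_weak_type n_gt0 mV V0 mf f1 (pow2z_gt0 j)).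
rewrite [leRHS]integral_mkcond; apply: ge0_le_integral_nomeas => x _.
  by rewrite mule_ge0.
by rewrite patchE indicE; case: ifPn => _; rewrite ?mul1e ?mul0e.
Qed.

End modular_inequality.

(** * Local mean oscillation and the generations of selected cubes *)

Section oscillation.
Context {R : realType} {n : nat}.
Local Notation Rn := 'rV[R]_n.
Local Notation mu := (lebesgue_rV R n).
Variables (g : Rn -> R) (gam b : set Rn -> R) (kap s t : R).
Hypothesis mg : measurable_fun setT g.
Hypothesis kap0 : 0 <= kap.
Hypothesis b_anti : forall Q Q', is_cube Q -> is_cube Q' -> Q `<=` Q' -> b Q' <= b Q.
Hypothesis s0 : 0 < s.
Hypothesis s_lt : s < 2^-1.
Hypothesis t_gt : 2^-1 < t.
Hypothesis t_lt : t < 1 - s.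

(** [gam Q] plays the part of a median of [g] on [Q], and [kap * b Q] that of its
    oscillation. *)
Definition deviation (Q A : set Rn) : set Rn :=
  [set z : Rn | A z /\ kap * b Q < `|g z - gam Q|].

Hypothesis osc : forall Q, is_cube Q -> (mu (deviation Q Q) < s%:E * mu Q)%E.

Lemma measurable_deviation (Q A : set Rn) :
  measurable A -> measurable (deviation Q A).
Proof.
move=> mA; rewrite (_ : deviation Q A =
    A `&` (fun z => `|g z - gam Q|) @^-1` `]kap * b Q, +oo[); last first.
  by apply/seteqP; split => z /=; rewrite in_itv/= andbT.
have : measurable_fun setT (fun z => `|g z - gam Q|).
  by apply: measurableT_comp => //; exact: measurable_funB.
by move=> /(measurable_funS measurableT (@subsetT _ A)); exact.
Qed.

(** Two constants are comparable as soon as the two exceptional sets do not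
    exhaust some common set. *)
Lemma gam_close (Q1 Q2 A A1 A2 : set Rn) :
  measurable A -> measurable A1 -> measurable A2 ->
  A `&` deviation Q1 setT `<=` A1 -> A `&` deviation Q2 setT `<=` A2 ->
  (mu A1 + mu A2 < mu A)%E ->
  `|gam Q1 - gam Q2| <= kap * b Q1 + kap * b Q2.
Proof.
move=> mA mA1 mA2 sub1 sub2 lt12.
have [z [Az n1 n2]] : exists z, [/\ A z, ~ deviation Q1 setT z & ~ deviation Q2 setT z].
  apply: contrapT => h; move: lt12; apply/negP; rewrite -leNgt.
  apply: le_trans (measureU2 _ mA1 mA2); rewrite le_measure ?inE//.
    exact: measurableU.
  move=> z Az; apply: contrapT => nU; apply: h; exists z; split=> // dz; apply: nU.
    by left; apply: sub1.
  by right; apply: sub2.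
have h1 : `|g z - gam Q1| <= kap * b Q1.
  by rewrite leNgt; apply/negP => h; apply: n1.
have h2 : `|g z - gam Q2| <= kap * b Q2.
  by rewrite leNgt; apply/negP => h; apply: n2.
rewrite (_ : gam Q1 - gam Q2 = (g z - gam Q2) - (g z - gam Q1)); last by lra.
by apply: (le_trans (ler_normB _ _)); rewrite addrC lerD.
Qed.

Lemma gam_close_cubes Q1 Q2 : is_cube Q1 -> is_cube Q2 -> Q1 `<=` Q2 ->
  (s%:E * mu Q1 + s%:E * mu Q2 <= mu Q1)%E ->
  `|gam Q1 - gam Q2| <= 2 * (kap * b Q1).
Proof.
move=> c1 c2 Q12 h.
have m1 := measurable_is_cube c1; have m2 := measurable_is_cube c2.
apply: (@le_trans _ _ (kap * b Q1 + kap * b Q2)); last first.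
  by rewrite mulr2n mulrDl mul1r lerD2l ler_wpM2l// b_anti.
apply: (@gam_close Q1 Q2 Q1 (deviation Q1 Q1) (deviation Q2 Q2)) => //.
- exact: measurable_deviation.
- exact: measurable_deviation.
- by move=> z [Q1z [_ dz]].
- by move=> z [Q1z [_ dz]]; split => //; exact: Q12.
apply: lt_le_trans h; apply: lteD; exact: osc.
Qed.

Variable J : nat.
Hypothesis J0 : (0 < J)%N.
Hypothesis hJ : s * (1 + (1 + J%:R^-1) ^+ n) <= 1.

(** A cube is connected to its double through cubes growing so slowly that the
    exceptional sets of two successive ones, filling a proportion [s < 1/2] of
    each, leave a common point. *)
Lemma gam_close_double (a a' : Rn) (l : R) : 0 < l ->
  cube a l `<=` cube a' (2 * l) ->
  `|gam (cube a l) - gam (cube a' (2 * l))| <= J%:R * (2 * (kap * b (cube a l))).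
Proof.
move=> l0 sub.
have Jr : 0 < J%:R :> R by rewrite ltr0n.
have aa i : a' ord0 i <= a ord0 i /\ a ord0 i <= a' ord0 i + l.
  have ina : cube a l a by move=> j; rewrite lexx lerDl ltW.
  have inb : cube a l (\row_j (a ord0 j + l)).
    by move=> j; rewrite mxE lexx lerDl ltW.
  have /andP[h1 _] := sub _ ina i; have /andP[_] := sub _ inb i.
  by rewrite mxE => h2; split=> //; lra.
pose u (i : nat) : R := i%:R / J%:R.
pose Q (i : nat) := cube (\row_j (a ord0 j + u i * (a' ord0 j - a ord0 j)))
  (l * (1 + u i)).
have u0 i : 0 <= u i by rewrite divr_ge0.
have uS i : u i.+1 = u i + J%:R^-1 by rewrite /u -natr1 mulrDl mul1r.
have Ji0 : 0 < J%:R^-1 :> R by rewrite invr_gt0.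
have l'0 i : 0 < l * (1 + u i) by rewrite mulr_gt0// ltr_wpDr.
have cQ i : is_cube (Q i) by exact: is_cube_cube.
have QS i : Q i `<=` Q i.+1.
  move=> x Qx j; have := Qx j; rewrite !mxE uS => /andP[h1 h2].
  have [h3 h4] := aa j.
  have h5 : 0 <= J%:R^-1 * (a ord0 j - a' ord0 j).
    by rewrite mulr_ge0 ?(ltW Ji0)// subr_ge0.
  have h6 : 0 <= J%:R^-1 * (a' ord0 j + l - a ord0 j).
    by rewrite mulr_ge0 ?(ltW Ji0)// subr_ge0.
  by apply/andP; split; lra.
have Q0 : Q 0%N = cube a l.
  rewrite /Q /u mul0r addr0 mulr1; congr cube.
  by apply/rowP => j; rewrite mxE mul0r addr0.
have QJ : Q J = cube a' (2 * l).
  rewrite /Q /u divff ?gt_eqF// (_ : l * (1 + 1) = 2 * l); last by lra.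
  by congr cube; apply/rowP => j; rewrite mxE; lra.
have Q0i i : Q 0%N `<=` Q i.
  by elim: i => // i IH; apply: subset_trans IH (QS i).
have step i : `|gam (Q i) - gam (Q i.+1)| <= 2 * (kap * b (cube a l)).
  apply: (@le_trans _ _ (2 * (kap * b (Q i)))); last first.
    by rewrite ler_wpM2l// ler_wpM2l// -Q0 b_anti.
  apply: gam_close_cubes => //.
  rewrite !mu_cube// -!EFinM -EFinD lee_fin -mulrDr.
  apply: (@le_trans _ _ (s * (1 + (1 + J%:R^-1) ^+ n) * (l * (1 + u i)) ^+ n)).
    rewrite -mulrA ler_wpM2l ?(ltW s0)// mulrDl mul1r lerD2l -exprMn.
    rewrite lerXn2r ?nnegrE ?(ltW (l'0 _))//.
      by rewrite mulr_ge0 ?addr_ge0 ?(ltW Ji0) ?(ltW (l'0 _)).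
    rewrite uS mulrCA ler_wpM2l ?(ltW l0)//.
    by have : 0 <= J%:R^-1 * u i by [rewrite mulr_ge0// ltW|]; lra.
  by rewrite ler_piMl// exprn_ge0// ltW.
rewrite -QJ -Q0.
suff : forall i, `|gam (Q 0%N) - gam (Q i)| <= i%:R * (2 * (kap * b (cube a l))).
  by rewrite Q0; exact.
elim=> [|i IH]; first by rewrite subrr normr0 mul0r.
rewrite (_ : _ - _ = (gam (Q 0%N) - gam (Q i)) + (gam (Q i) - gam (Q i.+1))).
  apply: (le_trans (ler_normD _ _)).
  by rewrite -natr1 mulrDl mul1r lerD.
by rewrite addrA subrK.
Qed.

Variables (o : Rn) (L : R).
Hypothesis L0 : 0 < L.
Local Notation gcube := (gcube o L).
Local Notation gclosure := (gclosure o L).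
Local Notation ganc := (ganc o L).

Let t1 : 0 < 1 - t. Proof. by move: s0 t_lt; lra. Qed.

Let st1 : s <= 1 - t. Proof. by move: s0 t_lt; lra. Qed.

Let ts1 : s + (1 - t) <= 1. Proof. by move: s_lt t_gt; lra. Qed.

Definition gdev c := deviation (gclosure c) (gcube c).

Lemma measurable_gdev c : measurable (gdev c).
Proof. by apply: measurable_deviation; exact: measurable_gcube. Qed.

Lemma gdev_sub c : gdev c `<=` gcube c. Proof. by move=> z []. Qed.

Lemma mu_gdev c : (mu (gdev c) < s%:E * mu (gcube c))%E.
Proof.
have := osc (is_cube_gclosure o L0 c); rewrite mu_gclosure// -(mu_gcube o)//.
apply: le_lt_trans; rewrite le_measure ?inE//.
- exact: measurable_gdev.
- apply: measurable_deviation; apply: measurable_is_cube.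
  exact: is_cube_gclosure.
- by move=> z [cz dz]; split => //; exact: gcube_closure.
Qed.

(** The stopping cubes of a Calderon-Zygmund decomposition, at height [1 - t], of
    the deviation set of [c]. *)
Definition gselected (c : nat * 'rV[int]_n) : set (nat * 'rV[int]_n) :=
  gmaximal o L [set c' | [/\ (c.1 < c'.1)%N, gcube c' `<=` gcube c &
    ((1 - t)%:E * mu (gcube c') < mu (gdev c `&` gcube c'))%E]].

Lemma gselected_sub c c' : gselected c c' -> gcube c' `<=` gcube c.
Proof. by move=> [[]]. Qed.

Lemma gclosure_sub c c' : gcube c' `<=` gcube c -> gclosure c' `<=` gclosure c.
Proof.
move=> sub x c'x i; have /andP[h1 h2] := c'x i.
have := sub _ (gcube_corner o L0 c'); rewrite gcubeE// => /(_ i)/andP[h3 h4].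
have s0' := gside_gt0 L0 c'.1.
rewrite (le_trans h3 h1)/= (le_trans h2)// leNgt; apply/negP => h.
pose y : Rn := \row_j (if j == i then gcorner o L c ord0 i + gside L c.1
                       else gcorner o L c' ord0 j).
have : gcube c' y.
  rewrite gcubeE// => j; rewrite [y ord0 j]mxE; case: eqP => [->|_].
    by rewrite (ltW h4).
  by rewrite lexx ltrDl.
by move=> /sub; rewrite gcubeE// => /(_ i); rewrite [y ord0 i]mxE eqxx ltxx andbF.
Qed.

(** The parent [p] of a selected cube [c'] is [c] or fails the selection, so the
    deviation set of [c] fills at most [1 - t] of it and that of [p] less than
    [s < t]: the constants of [p] and [c] are close. Those of [c'] and [p] are
    close since [p] is a cube of twice the side containing [c']. *)
Lemma gam_close_selected c c' : gselected c c' ->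
  `|gam (gclosure c') - gam (gclosure c)| <=
  ((2 * J + 2)%:R * kap) * b (gclosure c').
Proof.
move=> [[lt_c sub big] maxc].
pose p := ganc c'.1.-1 c'.
have k'0 : (0 < c'.1)%N by apply: leq_ltn_trans lt_c.
have p1 : p.1.+1 = c'.1 by rewrite /= prednK.
have subp : gcube c' `<=` gcube p by apply: ganc_sub => //; exact: leq_pred.
have cc' := gcube_corner o L0 c'.
have lp : (c.1 <= p.1)%N by rewrite -ltnS p1.
have pc : gcube p `<=` gcube c.
  by apply: (gcube_sub L0 lp (sub _ cc') (subp _ cc')).
have small : (mu (gdev c `&` gcube p) <= (1 - t)%:E * mu (gcube p))%E.
  move: lp; rewrite leq_eqVlt => /orP[/eqP e|lp].
    have -> : p = c.
      by rewrite (ganc_eq (subp _ cc')) (ganc_eq (sub _ cc')) e.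
    rewrite setIidl//; last exact: gdev_sub.
    apply: (le_trans (ltW (mu_gdev c))).
    by rewrite lee_wpmul2r// lee_fin.
  rewrite leNgt; apply/negP => h; apply: (maxc p.1).
    by rewrite -p1.
  by rewrite (_ : ganc p.1 c' = p).
have h1 : `|gam (gclosure p) - gam (gclosure c)| <= 2 * (kap * b (gclosure c')).
  have cub d : is_cube (gclosure d) by exact: is_cube_gclosure.
  apply: (@le_trans _ _ (kap * b (gclosure p) + kap * b (gclosure c))); last first.
    by rewrite mulr2n mulrDl mul1r lerD// ler_wpM2l// b_anti//; exact: gclosure_sub.
  apply: (@gam_close _ _ (gcube p) (gdev p) (gdev c `&` gcube p)).
  - exact: measurable_gcube.
  - exact: measurable_gdev.
  - by apply: measurableI; [exact: measurable_gdev|exact: measurable_gcube].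
  - by move=> z [pz [_ dz]].
  - by move=> z [pz [_ dz]]; split => //; split => //; exact: pc.
  apply: (@lt_le_trans _ _ (s%:E * mu (gcube p) + (1 - t)%:E * mu (gcube p))%E).
    rewrite addeC [ltRHS]addeC; apply: lee_ltD => //; last exact: mu_gdev.
    rewrite ge0_fin_numE// (le_lt_trans small)// mu_gcube// -EFinM ltry//.
  rewrite mu_gcube// -!EFinM -EFinD lee_fin -mulrDl ler_piMl//.
  by rewrite exprn_ge0// ltW// gside_gt0.
have h2 : `|gam (gclosure c') - gam (gclosure p)| <=
    J%:R * (2 * (kap * b (gclosure c'))).
  have E : gclosure p = cube (gcorner o L p) (2 * gside L c'.1).
    by rewrite /gclosure -p1 (gsideD L p.1 1) addn1 expr1.
  rewrite E; apply: gam_close_double; first exact: gside_gt0.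
  by rewrite -E; exact: gclosure_sub.
rewrite (_ : _ - _ = (gam (gclosure c') - gam (gclosure p)) +
  (gam (gclosure p) - gam (gclosure c))); last by rewrite addrA subrK.
apply: (le_trans (ler_normD _ _)); apply: (le_trans (lerD h2 h1)).
by rewrite natrD natrM; lra.
Qed.

Definition gselected_union c := \bigcup_(c' in gselected c) gcube c'.

Lemma measurable_gselected_union c : measurable (gselected_union c).
Proof.
by apply: measurable_bigcup_countable => c' _; exact: measurable_gcube.
Qed.

(** The selected cubes are disjoint, and the deviation set, of measure less than
    [s * mu c], fills more than [1 - t] of each. *)
Lemma mu_gselected_union c :
  (mu (gselected_union c) <= (s / (1 - t))%:E * mu (gcube c))%E.
Proof.
have : ((1 - t)%:E * mu (gselected_union c) <= s%:E * mu (gcube c))%E.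
  apply: le_trans (ltW (mu_gdev c)).
  apply: (@le_trans _ _ (mu (gselected_union c `&` gdev c))); last first.
    rewrite le_measure ?inE//; last exact: measurable_gdev.
    by apply: measurableI; [exact: measurable_gselected_union|exact: measurable_gdev].
  apply: (@countably_additive_le_bigcup _ _ _ _ (fun A => (1 - t)%:E * mu A)%E
    (fun A => mu (A `&` gdev c))).
  - by apply: countably_additive_scale; [exact: ltW|exact: countably_additive_mu].
  - by apply: countably_additive_restr; [exact: measurable_gdev|exact: countably_additive_mu].
  - by move=> c' _; exact: measurable_gcube.
  - exact: gmaximal_trivIset.
  - by move=> c' [[_ _ +] _]; rewrite setIC => /ltW.
rewrite mu_gcube// -!EFinM => h.
by rewrite mulrAC mulrC EFinM -lee_pdivrMl ?invr_gt0// invrK.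
Qed.

(** A cube meeting the deviation set outside of the selected cubes is not
    contained in any of them, hence is filled in proportion at most [1 - t]:
    there are no density points. *)
Lemma gdev_selected_null c : mu (gdev c `\` gselected_union c) = 0%E.
Proof.
have r01 : 0 <= 1 - t < 1 by rewrite (ltW t1)/=; move: t_gt; lra.
apply: (@density_null _ _ o L L0 (gcube c) _ _ _ (1 - t)) => //.
- exact: measurable_gcube.
- by rewrite mu_gcube// ltry.
- by apply: measurableD; [exact: measurable_gdev|exact: measurable_gselected_union].
- by move=> z [/gdev_sub].
- exact: gopen_gcube.
move=> d.
have mEd : measurable (gdev c `&` gcube d).
  by apply: measurableI; [exact: measurable_gdev|exact: measurable_gcube].
have mE'd : measurable ((gdev c `\` gselected_union c) `&` gcube d).
  apply: measurableI; last exact: measurable_gcube.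
  by apply: measurableD; [exact: measurable_gdev|exact: measurable_gselected_union].
have le1 : (mu ((gdev c `\` gselected_union c) `&` gcube d) <=
    mu (gdev c `&` gcube d))%E.
  by rewrite le_measure ?inE// => z [[]].
have [[y [[Ey nU] dy]]|none] := pselect (exists y, ((gdev c `\` gselected_union c)
    `&` gcube d) y); last first.
  rewrite (_ : _ `&` _ = set0); last by apply/seteqP; split => // y hy; apply: none; exists y.
  by rewrite measure0 mule_ge0// lee_fin ltW.
have cy := gdev_sub Ey.
apply: (le_trans le1).
have [dc|cd] := leqP d.1 c.1.
  have sub := gcube_sub L0 dc dy cy.
  apply: (@le_trans _ _ (mu (gdev c))).
    by rewrite le_measure ?inE//; exact: measurable_gdev.
  apply: (le_trans (ltW (mu_gdev c))).
  apply: (@le_trans _ _ ((1 - t)%:E * mu (gcube c))%E).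
    by rewrite lee_wpmul2r// lee_fin.
  rewrite lee_wpmul2l ?lee_fin ?(ltW t1)// le_measure ?inE//; exact: measurable_gcube.
have sub := gcube_sub L0 (ltnW cd) cy dy.
rewrite leNgt; apply/negP => h; apply: nU.
rewrite /gselected_union /gselected bigcup_gmaximal//.
by exists d.
Qed.

Fixpoint generation (c : nat * 'rV[int]_n) (i : nat) : set (nat * 'rV[int]_n) :=
  if i is i'.+1 then \bigcup_(c' in generation c i') gselected c' else [set c].

Definition gunion c i := \bigcup_(c' in generation c i) gcube c'.

Lemma generation_sub c i c' : generation c i c' -> gcube c' `<=` gcube c.
Proof.
elim: i c' => [|i IH] c' /=; first by move=> ->.
by move=> [d /IH dc] /gselected_sub; move=> h; exact: subset_trans dc.
Qed.

Lemma generation_trivIset c i : trivIset (generation c i) gcube.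
Proof.
elim: i => [|i IH]; first exact: trivIset1.
move=> d d' [e ge de] [e' ge' de'] [x [dx d'x]].
have ee' : e = e'.
  by apply: IH => //; exists x; split; [exact: (gselected_sub de)|exact: (gselected_sub de')].
rewrite -ee' in de'.
by apply: (gmaximal_trivIset L0 de de'); exists x.
Qed.

Lemma generationD c p i : generation c (p + i) =
  \bigcup_(d in generation c p) generation d i.
Proof.
elim: i => [|i IH].
  rewrite addn0; apply/seteqP; split => [d gd|d [e ge ->]//].
  by exists d.
rewrite addnS /= IH; apply/seteqP; split => d.
  by move=> [e [f gf fe] ed]; exists f => //; exists e.
by move=> [f gf [e fe ed]]; exists e => //; exists f.
Qed.

Lemma measurable_gunion c i : measurable (gunion c i).
Proof.
by apply: measurable_bigcup_countable => c' _; exact: measurable_gcube.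
Qed.

Lemma gunion0 c : gunion c 0 = gcube c.
Proof. by rewrite /gunion /= bigcup_set1. Qed.

Lemma gunion_sub c i : gunion c i `<=` gcube c.
Proof. by move=> x [d /generation_sub]; exact. Qed.

(** Generations are self-similar: inside a cube of the generation [p], the later
    ones are the generations of this cube. *)
Lemma gunionI c p i d : generation c p d ->
  gcube d `&` gunion c (p + i) = gunion d i.
Proof.
move=> gd; apply/seteqP; split => x.
  rewrite /gunion generationD => -[dx [e [d' gd' d'e] ex]].
  suff -> : d = d' by exists e.
  apply: (generation_trivIset gd gd'); exists x; split=> //.
  exact: (generation_sub d'e).
move=> [e de ex]; split; first exact: (generation_sub de).
by exists e => //; rewrite generationD; exists d.
Qed.

Lemma gunionS_sub c i : gunion c i.+1 `<=` gunion c i.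
Proof.
by move=> x [d [e ge ed] dx]; exists e => //; exact: (gselected_sub ed).
Qed.

Lemma gunion_anti c i j : (i <= j)%N -> gunion c j `<=` gunion c i.
Proof.
move=> /subnKC <-; elim: (j - i)%N => [|k IH]; first by rewrite addn0.
by rewrite addnS; exact: subset_trans (@gunionS_sub c (i + k)) IH.
Qed.

Lemma mu_gunion c i :
  (mu (gunion c i) <= ((s / (1 - t)) ^+ i)%:E * mu (gcube c))%E.
Proof.
have th0 : 0 <= s / (1 - t) by rewrite divr_ge0// ltW.
elim: i => [|i IH]; first by rewrite expr0 mul1e gunion0.
rewrite exprS EFinM -muleA.
apply: (@le_trans _ _ ((s / (1 - t))%:E * mu (gunion c i))%E); last first.
  by rewrite lee_wpmul2l.
have -> : gunion c i.+1 = gunion c i `&` gunion c i.+1.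
  by rewrite setIidr//; exact: gunionS_sub.
apply: (@countably_additive_le_bigcup _ _ _ _
  (fun A => mu (A `&` gunion c i.+1)) (fun A => (s / (1 - t))%:E * mu A)%E).
- by apply: countably_additive_restr; [exact: measurable_gunion|exact: countably_additive_mu].
- by apply: countably_additive_scale => //; exact: countably_additive_mu.
- by move=> d _; exact: measurable_gcube.
- exact: generation_trivIset.
move=> d gd; have := gunionI 1 gd; rewrite addn1 => ->.
by apply: le_trans (mu_gselected_union d); rewrite /gunion /= bigcup_set1.
Qed.

End oscillation.

(** * Condition F on grid cubes and summation over the generations *)

Section condition_F_cubes.
Context {R : realType} {n : nat}.
Hypothesis n_gt0 : (0 < n)%N.
Local Notation Rn := 'rV[R]_n.
Local Notation mu := (lebesgue_rV R n).
Variables (w : Rn -> R) (V : Rn -> \bar R) (beta c1 alpha : R).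
Hypothesis mw : measurable_fun setT w.
Hypothesis w0 : forall x, 0 <= w x.
Hypothesis mV : measurable_fun setT V.
Hypothesis V0 : forall x, (0 <= V x)%E.
Hypothesis beta0 : 0 < beta.
Hypothesis c10 : 0 < c1.
Hypothesis alpha01 : 0 < alpha < 1.
Hypothesis hF : forall Q E, is_cube Q -> measurable E -> E `<=` Q ->
  (mu E <= alpha%:E * mu Q)%E ->
  (\int[mu]_(x in E) (w x)%:E <=
   (c1 * rel_size E Q `^ beta)%:E * \int[mu]_(x in Q `\` E) V x)%E.
Variables (o : Rn) (L : R).
Hypothesis L0 : 0 < L.
Local Notation gcube := (gcube o L).

Let alpha0 : 0 < alpha. Proof. by case/andP: alpha01. Qed.

Let mwE : measurable_fun setT (fun x => (w x)%:E).
Proof. exact/measurable_EFinP. Qed.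

Let wE0 x : (0 <= (w x)%:E)%E. Proof. by rewrite lee_fin. Qed.

(** Condition F passes to half-open cubes, since closing them adds a null set. *)
Lemma condF_gcube c (A : set Rn) rho : measurable A -> A `<=` gcube c ->
  0 <= rho <= alpha -> (mu A <= rho%:E * mu (gcube c))%E ->
  (\int[mu]_(x in A) (w x)%:E <=
   (c1 * rho `^ beta)%:E * \int[mu]_(x in gcube c `\` A) V x)%E.
Proof.
move=> mA Ac /andP[r0 ra] hA.
have cQ := is_cube_gclosure o L0 c; have mQ := measurable_is_cube cQ.
have sn0 : 0 < gside L c.1 ^+ n by rewrite exprn_gt0// gside_gt0.
have muE : mu (gclosure o L c) = mu (gcube c).
  by rewrite mu_gclosure// mu_gcube.
have AQ : A `<=` gclosure o L c by apply: subset_trans Ac _; exact: gcube_closure.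
have fA : (mu A < +oo)%E by rewrite (le_lt_trans hA)// mu_gcube// -EFinM ltry.
apply: (le_trans (hF cQ mA AQ _)).
  by rewrite muE (le_trans hA)// lee_wpmul2r// lee_fin.
have -> : (\int[mu]_(x in gclosure o L c `\` A) V x =
    \int[mu]_(x in gcube c `\` A) V x)%E.
  rewrite (@ge0_negligible_integral _ _ _ mu (gclosure o L c `\` A)
    (gclosure o L c `\` gcube c) V).
  - congr (integral _ _ _); apply/seteqP; split => x.
      move=> [[Qx nA] nQ]; split=> //; apply: contrapT => ncx.
      by apply: nQ; split.
    move=> [cx nA]; split; last by move=> [].
    by split=> //; exact: gcube_closure.
  - by apply: measurableD => //; exact: measurable_gcube.
  - exact: measurableD.
  - exact: measurable_funTS.
  - by [].
  - exact: gclosureD_null.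
rewrite lee_wpmul2r//; first exact: integral_ge0.
rewrite lee_fin ler_wpM2l ?(ltW c10)//.
have rs0 : 0 <= rel_size A (gclosure o L c) by rewrite divr_ge0// fine_ge0.
rewrite ge0_ler_powR ?nnegrE ?(ltW beta0)//.
rewrite /rel_size muE mu_gcube//= ler_pdivrMr// -lee_fin EFinM.
by rewrite fineK ?ge0_fin_numE// -(mu_gcube o).
Qed.

(** A cube is cut into pieces so small that each of them can be joined to [A]
    without violating the smallness required by condition F. *)
Lemma condF_whole c (A : set Rn) m : measurable A -> A `<=` gcube c ->
  (mu A <= (alpha / 2)%:E * mu (gcube c))%E -> (2 ^+ m)^-1 <= alpha / 2 ->
  (\int[mu]_(x in gcube c) (w x)%:E <=
   (c1 * alpha `^ beta * 2 ^+ (m * n))%:E * \int[mu]_(x in gcube c `\` A) V x)%E.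
Proof.
move=> mA Ac hA hm.
set X := (\int[mu]_(x in gcube c `\` A) V x)%E.
have X0 : (0 <= X)%E by exact: integral_ge0.
have k0 : 0 < c1 * alpha `^ beta by rewrite mulr_gt0// powR_gt0.
have kk0 : 0 < c1 * alpha `^ beta * 2 ^+ (m * n) by rewrite mulr_gt0// exprn_gt0.
have [->|Xoo] := eqVneq X +oo%E; first by rewrite gt0_muley ?leey// lte_fin.
have XE : X = (fine X)%:E by rewrite fineK// ge0_fin_numE// lt_neqAle Xoo leey.
have fX0 : 0 <= fine X by rewrite fine_ge0.
have sn0 : 0 < gside L c.1 ^+ n by rewrite exprn_gt0// gside_gt0.
pose P := [set d : nat * 'rV[int]_n | d.1 = (c.1 + m)%N /\ gcube d `<=` gcube c].
have PE : \bigcup_(d in P) gcube d = gcube c.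
  apply/seteqP; split => [x [d [_ dc] dx]|x cx]; first exact: dc.
  exists ((c.1 + m)%N, gidx o L (c.1 + m) x) => //; split=> //.
  by apply: (@gcube_sub _ _ o L L0 c _ x) => //=; exact: leq_addr.
have PT : trivIset P gcube.
  move=> d d' [e _] [e' _] [x [dx d'x]].
  by rewrite (ganc_eq dx) (ganc_eq d'x) e e'.
have muP d : P d -> mu (gcube d) = ((2 ^+ (m * n))^-1%:E * mu (gcube c))%E.
  move=> [e _]; have sE : gside L c.1 ^+ n = 2 ^+ (m * n) * gside L (c.1 + m) ^+ n.
    by rewrite [in LHS](gsideD L c.1 m) [LHS]exprMn exprM.
  by rewrite !mu_gcube// e sE -EFinM mulKf// expf_neq0.
have dX d : P d -> (\int[mu]_(x in gcube d) (w x)%:E <=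
    (c1 * alpha `^ beta * fine X * 2 ^+ (m * n) / gside L c.1 ^+ n)%:E * mu (gcube d))%E.
  move=> Pd; have [_ dc] := Pd.
  have mdA : measurable (gcube d `|` A).
    by apply: measurableU => //; exact: measurable_gcube.
  have dAc : gcube d `|` A `<=` gcube c by move=> x [/dc|/Ac].
  apply: (@le_trans _ _ (\int[mu]_(x in gcube d `|` A) (w x)%:E)%E).
    apply: ge0_subset_integral => //; first exact: measurable_gcube.
    exact: measurable_funTS.
  have a01 : 0 <= alpha <= alpha by rewrite lexx ltW.
  apply: (le_trans (condF_gcube mdA dAc a01 _)).
    apply: (le_trans (measureU2 _ (measurable_gcube o L0 d) mA)).
    rewrite [in leRHS](splitr alpha) EFinD ge0_muleDl ?lee_fin ?divr_ge0 ?(ltW alpha0)//.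
    apply: leeD => //; rewrite [leLHS](muP d Pd); apply: lee_wpmul2r => //; rewrite lee_fin.
    apply: le_trans hm; rewrite lef_pV2 ?posrE ?exprn_gt0//.
    by rewrite ler_eXn2l ?ltr1n// leq_pmulr.
  apply: (@le_trans _ _ ((c1 * alpha `^ beta)%:E * X)%E).
    rewrite lee_wpmul2l ?lee_fin ?(ltW k0)//; apply: ge0_subset_integral => //.
    - by apply: measurableD => //; exact: measurable_gcube.
    - by apply: measurableD => //; exact: measurable_gcube.
    - exact: measurable_funTS.
    - by move=> x [cx nU]; split=> // Ax; apply: nU; right.
  rewrite (muP d Pd) mu_gcube// XE -!EFinM lee_fin.
  rewrite [leRHS](_ : _ = c1 * alpha `^ beta * fine X * (2 ^+ (m * n) / 2 ^+ (m * n)) *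
    (gside L c.1 ^+ n / gside L c.1 ^+ n)); last by lra.
  by rewrite !divff ?gt_eqF ?exprn_gt0 ?gside_gt0// !mulr1.
rewrite -PE.
apply: le_trans (@countably_additive_le_bigcup _ _ _ _
  (fun A => \int[mu]_(x in A) (w x)%:E)%E
  (fun A => (c1 * alpha `^ beta * fine X * 2 ^+ (m * n) / gside L c.1 ^+ n)%:E * mu A)%E
  P gcube _ _ _ _ _) _ => //.
- exact: countably_additive_integral.
- apply: countably_additive_scale; last exact: countably_additive_mu.
  by rewrite divr_ge0 ?(ltW sn0)// mulr_ge0 ?exprn_ge0// mulr_ge0 ?(ltW k0).
- by move=> d _; exact: measurable_gcube.
rewrite PE mu_gcube// XE -!EFinM lee_fin divfK ?gt_eqF//.
by rewrite mulrAC.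
Qed.

(** The weight decays geometrically along sets of geometrically small measure;
    the first few of them, too large for condition F, are handled by
    [condF_whole]. *)
Lemma condF_decay c (U : nat -> set Rn) theta N m :
  (forall i, measurable (U i)) -> (forall i, U i `<=` gcube c) ->
  (forall i j, (i <= j)%N -> U j `<=` U i) ->
  0 < theta -> (forall i, mu (U i) <= (theta ^+ i)%:E * mu (gcube c))%E ->
  theta ^+ N <= alpha / 2 -> (2 ^+ m)^-1 <= alpha / 2 ->
  forall i, (\int[mu]_(x in U i) (w x)%:E <=
    (c1 * (1 + 2 ^+ (m * n)) * (theta `^ beta) ^+ i)%:E *
    \int[mu]_(x in gcube c `\` U (i + N)%N) V x)%E.
Proof.
move=> mU Uc Uanti th0 hU hN hm i.
have powE : (theta ^+ i) `^ beta = (theta `^ beta) ^+ i.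
  by rewrite -(powR_mulrn i (ltW th0)) -powRrM mulrC powRrM powR_mulrn// powR_ge0.
have qi0 : 0 <= (theta `^ beta) ^+ i by rewrite exprn_ge0// powR_ge0.
have VD k l : (k <= l)%N -> (\int[mu]_(x in gcube c `\` U k) V x <=
    \int[mu]_(x in gcube c `\` U l) V x)%E.
  move=> kl; apply: ge0_subset_integral => //.
  - by apply: measurableD => //; exact: measurable_gcube.
  - by apply: measurableD => //; exact: measurable_gcube.
  - exact: measurable_funTS.
  - by move=> x [cx nU]; split=> // /(Uanti _ _ kl).
have VD0 k : (0 <= \int[mu]_(x in gcube c `\` U k) V x)%E by exact: integral_ge0.
have [small|large] := leP (theta ^+ i) alpha.
  apply: (le_trans (condF_gcube (mU i) (Uc i) _ (hU i))).
    by rewrite small exprn_ge0// ltW.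
  apply: lee_pmul => //; last by apply: VD; exact: leq_addr.
    by rewrite lee_fin mulr_ge0 ?powR_ge0// ltW.
  by rewrite lee_fin powE ler_wpM2r// ler_peMr ?(ltW c10)// lerDl exprn_ge0.
apply: (@le_trans _ _ (\int[mu]_(x in gcube c) (w x)%:E)%E).
  apply: ge0_subset_integral => //; first exact: measurable_gcube.
  exact: measurable_funTS.
apply: (le_trans (condF_whole (mU N) (Uc N) _ hm)).
  by apply: (le_trans (hU N)); rewrite lee_wpmul2r// lee_fin.
apply: lee_pmul => //; last by apply: VD; exact: leq_addl.
  by rewrite lee_fin !mulr_ge0 ?powR_ge0 ?exprn_ge0// ltW.
rewrite lee_fin -!mulrA ler_wpM2l ?(ltW c10)// mulrC.
apply: ler_pM; rewrite ?exprn_ge0 ?powR_ge0//; first by rewrite lerDr.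
rewrite -powE ge0_ler_powR ?nnegrE ?(ltW beta0) ?(ltW alpha0) ?(ltW large)//.
by rewrite exprn_ge0// ltW.
Qed.

End condition_F_cubes.

(** The factor [i + 1] comes from the overlap of the gaps between generations at
    distance [i]. *)
Lemma arithmetic_geometric_sum (R : realType) (r : R) m : 0 <= r < 1 ->
  \sum_(0 <= i < m) i.+1%:R * r ^+ i <= ((1 - r)^-1) ^+ 2.
Proof.
move=> /andP[r0 r1]; have r10 : 0 < 1 - r by rewrite subr_gt0.
pose A k := \sum_(0 <= i < k) i.+1%:R * r ^+ i.
pose S k := \sum_(0 <= i < k) r ^+ i.
have hS k : (1 - r) * S k = 1 - r ^+ k.
  elim: k => [|k IH]; first by rewrite /S big_nil mulr0 expr0 subrr.
  by rewrite /S big_nat_recr//= -/(S k) mulrDr IH exprS; lra.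
have hA k : (1 - r) * A k = S k - k%:R * r ^+ k.
  elim: k => [|k IH]; first by rewrite /A /S !big_nil mulr0 mul0r subrr.
  rewrite /A /S !big_nat_recr//= -/(A k) -/(S k) mulrDr IH exprS -natr1; lra.
have pk k : 0 <= r ^+ k by rewrite exprn_ge0.
have S1 : S m <= (1 - r)^-1.
  by rewrite -(ler_pM2l r10) hS mulfV ?gt_eqF// lerBlDr lerDl.
rewrite -/(A m) expr2 -(ler_pM2l r10) hA mulVKf ?gt_eqF//.
by rewrite (le_trans _ S1)// lerBlDr lerDl mulr_ge0.
Qed.

Section telescoping.
Context d (T : measurableType d) (R : realType).
Variables (m : {measure set T -> \bar R}) (h : T -> \bar R).
Hypothesis mh : measurable_fun setT h.
Hypothesis h0 : forall x, (0 <= h x)%E.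
Local Open Scope ereal_scope.

(** The gaps [U p \ U (p + M)] overlap at most [M] times. *)
Lemma sum_integral_gaps (U : nat -> set T) M : (forall i, measurable (U i)) ->
  (forall i j, (i <= j)%N -> U j `<=` U i) ->
  \sum_(p <oo) \int[m]_(x in U p `\` U (p + M)%N) h x <=
  M%:R%:E * \int[m]_(x in U 0%N) h x.
Proof.
move=> mU Uanti; elim: M => [|M IH].
  rewrite mul0e eseries0// => p _ _.
  by rewrite addn0 setDv integral_set0.
have mD p q : measurable (U p `\` U q) by exact: measurableD.
have -> : \sum_(p <oo) \int[m]_(x in U p `\` U (p + M.+1)%N) h x =
    \sum_(p <oo) (\int[m]_(x in U p `\` U (p + M)%N) h x +
      \int[m]_(x in U (p + M)%N `\` U (p + M).+1) h x).
  apply: eq_eseriesr => p _; rewrite -ge0_integral_setU//.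
  - congr (integral _ _ _); rewrite addnS; apply/seteqP; split => x.
      move=> [px nx]; have [q|q] := pselect (U (p + M)%N x); first by right.
      by left.
    move=> [[px nx]|[px nx]]; split=> //.
      by move=> /(Uanti _ _ (leqnSn _)).
    exact: (Uanti _ _ (leq_addr M p)).
  - exact: measurable_funTS.
  - by rewrite disj_set2E; apply/eqP/seteqP; split => // x [[_ +] [+ _]].
rewrite nneseriesD; last 2 first.
- by move=> p _ _; exact: integral_ge0.
- by move=> p _ _; exact: integral_ge0.
rewrite -natr1 EFinD ge0_muleDl ?lee_fin// mul1e.
apply: leeD => //.
rewrite -(@ge0_integral_bigcup _ _ _ m
  (fun p => U (p + M)%N `\` U (p + M).+1) h)//; last 2 first.
- exact: measurable_funTS.
- move=> i j _ _ [x [[i1 i2] [j1 j2]]]; apply/eqP; rewrite eqn_leq.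
  apply/andP; split; rewrite leqNgt; apply/negP => lt.
    by apply: j2; apply: (Uanti _ _ _ _ i1); rewrite ltn_add2r.
  by apply: i2; apply: (Uanti _ _ _ _ j1); rewrite ltn_add2r.
apply: ge0_subset_integral => //.
- exact: bigcupT_measurable.
- exact: measurable_funTS.
- by move=> x [p _ [px _]]; exact: (Uanti _ _ (leq0n _)) px.
Qed.

End telescoping.

(** * The local estimate *)

Section local_estimate.
Context {R : realType} {n : nat}.
Hypothesis n_gt0 : (0 < n)%N.
Local Notation Rn := 'rV[R]_n.
Local Notation mu := (lebesgue_rV R n).
Variables (Phi : R -> R) (c0 : R).
Hypothesis PhiC : condition_C Phi c0.
Hypothesis c0_ge1 : 1 <= c0.
Variables (w : Rn -> R) (V : Rn -> \bar R) (beta c1 alpha : R).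
Hypothesis mw : measurable_fun setT w.
Hypothesis w0 : forall x, 0 <= w x.
Hypothesis mV : measurable_fun setT V.
Hypothesis V0 : forall x, (0 <= V x)%E.
Hypothesis beta0 : 0 < beta.
Hypothesis c10 : 0 < c1.
Hypothesis alpha01 : 0 < alpha < 1.
Hypothesis hF : forall Q E, is_cube Q -> measurable E -> E `<=` Q ->
  (mu E <= alpha%:E * mu Q)%E ->
  (\int[mu]_(x in E) (w x)%:E <=
   (c1 * rel_size E Q `^ beta)%:E * \int[mu]_(x in Q `\` E) V x)%E.
Variables (s t kap : R).
Hypothesis s0 : 0 < s.
Hypothesis s_lt : s < 2^-1.
Hypothesis t_gt : 2^-1 < t.
Hypothesis t_lt : t < 1 - s.
Hypothesis kap0 : 0 <= kap.
Hypothesis contr : c0 * (s / (1 - t)) `^ beta < 1.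
Variables (J N m : nat) (Ck : R).
Hypothesis J0 : (0 < J)%N.
Hypothesis hJ : s * (1 + (1 + J%:R^-1) ^+ n) <= 1.
Hypothesis hN : (s / (1 - t)) ^+ N <= alpha / 2.
Hypothesis hm : (2 ^+ m)^-1 <= alpha / 2.
Hypothesis Ck0 : 0 < Ck.
Hypothesis hCk : forall u, 0 <= u -> Phi ((2 * J + 2)%:R * kap * u) <= Ck * Phi u.

Definition local_const : R := 2 * c0 * c0 * (c1 * (1 + 2 ^+ (m * n))) * Ck *
  N.+1%:R * ((1 - c0 * (s / (1 - t)) `^ beta)^-1) ^+ 2.

Variables (g : Rn -> R) (gam b : set Rn -> R) (H : Rn -> \bar R).
Hypothesis mg : measurable_fun setT g.
Hypothesis b0 : forall Q, is_cube Q -> 0 <= b Q.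
Hypothesis b_anti : forall Q Q', is_cube Q -> is_cube Q' -> Q `<=` Q' -> b Q' <= b Q.
Hypothesis osc : forall Q, is_cube Q -> (mu (deviation g gam b kap Q Q) < s%:E * mu Q)%E.
Hypothesis mH : measurable_fun setT H.
Hypothesis H0 : forall x, (0 <= H x)%E.
Hypothesis hH : forall Q x, is_cube Q -> Q x -> ((Phi (b Q))%:E <= H x)%E.
Variables (o : Rn) (L : R).
Hypothesis L0 : 0 < L.
Variable c : nat * 'rV[int]_n.
Local Notation gcube := (gcube o L).
Local Notation gclosure := (gclosure o L).
Local Notation gen := (generation g gam b kap t o L).
Local Notation gun := (gunion g gam b kap t o L).
Local Notation kap2 := ((2 * J + 2)%:R * kap).

Let c00 : 0 <= c0. Proof. exact: le_trans ler01 c0_ge1. Qed.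

Let t1 : 0 < 1 - t. Proof. by move: s0 t_lt; lra. Qed.

Let bcl0 d : 0 <= b (gclosure d).
Proof. exact/b0/is_cube_gclosure. Qed.

Let kap20 : 0 <= kap2. Proof. exact: mulr_ge0. Qed.

Let phi d := Phi (kap2 * b (gclosure d)).

Let phi0 d : 0 <= phi d.
Proof. by apply: (condC_ge0 PhiC); rewrite mulr_ge0. Qed.

Let ind (A : set Rn) x : \bar R := (\1_A x : R)%:E.

Let ind0 A x : (0 <= ind A x)%E. Proof. by rewrite lee_fin. Qed.

(** The generation [p] has at most one cube around a point, so this sum is a
    function constant on each of its cubes; it bounds [Phi] of the jump of the
    constants from the generation before. *)
Let Z p x := csum (gen c p) (fun d => (phi d)%:E * ind (gcube d) x)%E.

Let Z_ge p d x : gen c p d -> gcube d x -> ((phi d)%:E <= Z p x)%E.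
Proof.
move=> gd dx; have := @csum_ge_term _ R (gen c p)
  (fun d => (phi d)%:E * ind (gcube d) x)%E d.
rewrite {2}/ind indicE mem_set// mule1; apply => // e _.
by rewrite mule_ge0// lee_fin.
Qed.

Let Z0 p x : (0 <= Z p x)%E.
Proof. by apply: csum_ge0 => d _; rewrite mule_ge0// lee_fin. Qed.

(** Moving from a cube to a selected one changes the constant by a controlled
    amount; [Phi] of the sum of these amounts is split by doubling, the price
    being one factor [c0] for each generation passed. *)
Let gam_path k d x : gen c k d -> gcube d x ->
  ((Phi `|gam (gclosure d) - gam (gclosure c)|)%:E <=
   \sum_(i < k) (c0 ^+ i.+1)%:E * Z (k - i) x)%E.
Proof.
elim: k d => [|k IH] d /=.
  move=> -> _; rewrite big_ord0 subrr normr0.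
  by have [_ _ -> _] := PhiC.
move=> [e ge ed] dx.
have ex : gcube e x by exact: (gselected_sub ed).
have step : `|gam (gclosure d) - gam (gclosure e)| <= kap2 * b (gclosure d).
  exact: (gam_close_selected mg kap0 b_anti s0 s_lt t_gt t_lt osc J0 hJ L0 ed).
rewrite big_ord_recl /= expr1 subn0.
apply: (@le_trans _ _ (c0 * phi d +
    c0 * Phi `|gam (gclosure e) - gam (gclosure c)|)%:E).
  rewrite lee_fin; apply: le_trans (condC_add PhiC c00 _ _) => //.
    apply: (condC_homo PhiC) => //.
    rewrite (_ : _ - _ = (gam (gclosure d) - gam (gclosure e)) +
      (gam (gclosure e) - gam (gclosure c))); last by rewrite addrA subrK.
    by apply: (le_trans (ler_normD _ _)); rewrite lerD2r.
  exact: mulr_ge0.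
rewrite EFinD; apply: leeD.
  rewrite EFinM lee_wpmul2l ?lee_fin//; apply: Z_ge dx.
  by exists e.
apply: (@le_trans _ _ (c0%:E * \sum_(i < k) (c0 ^+ i.+1)%:E * Z (k - i) x)%E).
  by rewrite EFinM lee_wpmul2l ?lee_fin//; exact: IH.
rewrite ge0_sume_distrr; last by move=> i _; rewrite mule_ge0// lee_fin exprn_ge0.
apply: lee_sum => i _.
by rewrite muleA -EFinM -exprS /bump /= add1n subSS.
Qed.

(** Off this null set, a point lies in finitely many selected cubes and does not
    deviate on the last of them. *)
Let bad : set Rn := (\bigcap_k gun c k) `|`
  \bigcup_(d in setT) (gdev g gam b kap o L d `\` gselected_union g gam b kap t o L d).

Let measurable_bad : measurable bad.
Proof.
apply: measurableU.
  by apply: bigcap_measurable => // k _; exact: measurable_gunion.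
apply: measurable_bigcup_countable => d _; apply: measurableD.
  exact: measurable_gdev.
exact: measurable_gselected_union.
Qed.

Let theta_lt1 : s / (1 - t) < 1.
Proof. by rewrite ltr_pdivrMr// mul1r; move: s_lt t_lt; lra. Qed.

Let theta_gt0 : 0 < s / (1 - t).
Proof. by rewrite divr_gt0. Qed.

Let mu_bad : mu bad = 0%E.
Proof.
apply/eqP; rewrite eq_le measure_ge0 andbT.
have m1 : measurable (\bigcap_k gun c k).
  by apply: bigcap_measurable => // k _; exact: measurable_gunion.
have m2 (d : nat * 'rV[int]_n) : [set: nat * 'rV[int]_n] d ->
    measurable (gdev g gam b kap o L d `\` gselected_union g gam b kap t o L d).
  move=> _; apply: measurableD; first exact: measurable_gdev.
  exact: measurable_gselected_union.
apply: le_trans (measureU2 _ m1 (measurable_bigcup_countable m2)) _.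
rewrite -[leRHS]adde0; apply: leeD; last first.
  apply: le_trans (measure_bigcup_le_csum _ m2) _.
  rewrite /csum eseries0// => i _ _; case: (pickle_inv i) => // d.
  case: ifP => // _; exact: (gdev_selected_null mg s0 t_gt t_lt osc o L0 d).
have hk k : (mu (\bigcap_k gun c k) <=
    ((s / (1 - t)) ^+ k * gside L c.1 ^+ n)%:E)%E.
  rewrite EFinM -(mu_gcube o L0).
  apply: le_trans (mu_gunion mg s0 t_lt osc o L0 c k).
  by rewrite le_measure ?inE//; [exact: measurable_gunion|move=> x; apply].
apply/lee_addgt0Pr => e e0; rewrite add0e.
have sn0 : 0 < gside L c.1 ^+ n by rewrite exprn_gt0// gside_gt0.
have : (fun k => (s / (1 - t)) ^+ k) @ \oo --> 0.
  by apply: cvg_expr; rewrite ger0_norm// ltW.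
move=> /cvgrPdist_lt /(_ _ (divr_gt0 e0 sn0)) [k _ /(_ k (leqnn k))] /=.
rewrite sub0r normrN ger0_norm ?exprn_ge0 ?(ltW theta_gt0)// ltr_pdivlMr// => he.
by apply: (le_trans (hk k)); rewrite lee_fin ltW.
Qed.

(** Down to the last selected cube around the point the constants are followed,
    and on it [g] is close to its constant. *)
Let pointwise x : gcube c x -> ~ bad x -> exists k, gun c k x /\
  ((Phi `|g x - gam (gclosure c)|)%:E <=
   (2 * c0)%:E * \sum_(i < k.+1) (c0 ^+ i.+1)%:E * Z (k - i) x)%E.
Proof.
move=> cx nb.
have [K nK] : exists k, ~ gun c k x.
  apply: contrapT => h; apply: nb; left => k _.
  by apply: contrapT => nk; apply: h; exists k.
have ex : exists k, `[< ~ gun c k x >] by exists K; apply/asboolP.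
case: (ex_minnP ex) => -[|k] /asboolP nk kmin.
  by move: nk; rewrite gunion0.
have gk : gun c k x.
  apply: contrapT => nk'; have /kmin : `[< ~ gun c k x >] by apply/asboolP.
  by rewrite ltnn.
exists k; split => //.
have [d gd dx] := gk.
have nsel : ~ gselected_union g gam b kap t o L d x.
  by move=> [e de ex']; apply: nk; exists e => //; exists d.
have ndev : ~ gdev g gam b kap o L d x.
  by move=> dev; apply: nb; right; exists d.
have gle : `|g x - gam (gclosure d)| <= kap2 * b (gclosure d).
  apply: (@le_trans _ _ (kap * b (gclosure d))).
    by rewrite leNgt; apply/negP => h; apply: ndev.
  rewrite ler_wpM2r// ler_peMl// ler1n.
  by rewrite addn2.
have SZ : (c0%:E * Z k x <= \sum_(i < k.+1) (c0 ^+ i.+1)%:E * Z (k - i) x)%E.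
  rewrite big_ord_recl /= expr1 subn0 leeDl//.
  by apply: sume_ge0 => i _; rewrite mule_ge0// lee_fin exprn_ge0.
have Sk : (\sum_(i < k) (c0 ^+ i.+1)%:E * Z (k - i) x <=
    \sum_(i < k.+1) (c0 ^+ i.+1)%:E * Z (k - i) x)%E.
  by rewrite big_ord_recr /= leeDl// mule_ge0// lee_fin exprn_ge0.
apply: (@le_trans _ _ (c0 * phi d +
    c0 * Phi `|gam (gclosure d) - gam (gclosure c)|)%:E).
  rewrite lee_fin; apply: le_trans (condC_add PhiC c00 _ _) => //.
    apply: (condC_homo PhiC) => //.
    rewrite (_ : _ - _ = (g x - gam (gclosure d)) +
      (gam (gclosure d) - gam (gclosure c))); last by rewrite addrA subrK.
    by apply: (le_trans (ler_normD _ _)); rewrite lerD2r.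
  exact: mulr_ge0.
have c02 : (0 <= c0%:E)%E by rewrite lee_fin.
set S := (\sum_(i < k.+1) _)%E in SZ Sk *.
have S0 : (0 <= S)%E.
  by apply: sume_ge0 => i _; rewrite mule_ge0// lee_fin exprn_ge0.
rewrite EFinD mulr2n mulrDl mul1r [in leRHS]EFinD ge0_muleDl//; apply: leeD.
  apply: (@le_trans _ _ (c0%:E * Z k x)%E).
    by rewrite EFinM lee_wpmul2l//; exact: Z_ge gd dx.
  apply: (le_trans SZ); rewrite -[leLHS]mul1e lee_wpmul2r//.
rewrite EFinM lee_wpmul2l//; apply: le_trans Sk; exact: gam_path gd dx.
Qed.

(** The contribution of the generation [p] to the points that lie in the
    generation [p + i], which is where it comes with the factor [c0 ^ i]. *)
Let T i p x := csum (gen c p) (fun d => (phi d)%:E * (ind (gun d i) x * (w x)%:E))%E.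

Let T_term0 i x d : (0 <= (phi d)%:E * (ind (gun d i) x * (w x)%:E))%E.
Proof. by rewrite !mule_ge0// lee_fin. Qed.

Let T0 i p x : (0 <= T i p x)%E.
Proof. by apply: csum_ge0 => d _. Qed.

Let ZT i p x : gun c (p + i) x -> (Z p x * (w x)%:E <= T i p x)%E.
Proof.
move=> px; rewrite csumMr; last 2 first.
- by move=> d _; rewrite mule_ge0// lee_fin.
- by rewrite lee_fin.
apply: le_csum => d gd; first by rewrite !mule_ge0// lee_fin.
rewrite -muleA; apply: lee_wpmul2l; first by rewrite lee_fin.
apply: lee_wpmul2r; first by rewrite lee_fin.
rewrite /ind !indicE lee_fin.
case: (boolP (x \in gcube d)) => [/set_mem dx|_]; last by [].
by rewrite mem_set// -(gunionI L0 i gd); split.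
Qed.

Let mind A : measurable A -> measurable_fun setT (ind A).
Proof. by move=> mA; apply/measurable_EFinP; exact: measurable_indic. Qed.

Let mT_term i d : measurable_fun setT
  (fun x => ((phi d)%:E * (ind (gun d i) x * (w x)%:E))%E).
Proof.
apply: measurable_funeM; apply: emeasurable_funM.
  by apply: mind; exact: measurable_gunion.
exact/measurable_EFinP.
Qed.

Let mT i p : measurable_fun setT (T i p).
Proof. by apply: measurable_csum => // d x _ _. Qed.

Let sumT i x := (\sum_(p <oo) T i p x)%E.

Let sumT0 i x : (0 <= sumT i x)%E. Proof. exact: nneseries_ge0. Qed.

Let msumT i : measurable_fun setT (sumT i).
Proof. exact: ge0_emeasurable_sum. Qed.

Let coef i := 2 * c0 * c0 ^+ i.+1.

Let coef0 i : 0 <= coef i.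
Proof. by rewrite !mulr_ge0// exprn_ge0. Qed.

Let total x := (\sum_(i <oo) (coef i)%:E * sumT i x)%E.

Let total_term0 i x : (0 <= (coef i)%:E * sumT i x)%E.
Proof. by rewrite mule_ge0// lee_fin. Qed.

Let mtotal_term i : measurable_fun setT (fun x => ((coef i)%:E * sumT i x)%E).
Proof. exact: measurable_funeM. Qed.

Let pointwise_total x : gcube c x -> ~ bad x ->
  ((Phi `|g x - gam (gclosure c)| * w x)%:E <= total x)%E.
Proof.
move=> cx nb; have [k [gk hk]] := pointwise cx nb.
rewrite EFinM.
apply: (@le_trans _ _ (((2 * c0)%:E * \sum_(i < k.+1) (c0 ^+ i.+1)%:E * Z (k - i) x)
    * (w x)%:E)%E).
  by rewrite lee_wpmul2r// lee_fin.
apply: (@le_trans _ _ (\sum_(0 <= i < k.+1) (coef i)%:E * sumT i x)%E); last first.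
  by apply: nneseries_lim_ge => i _ _.
rewrite big_mkord -muleA ge0_sume_distrl; last first.
  by move=> i _; rewrite mule_ge0// lee_fin exprn_ge0.
rewrite ge0_sume_distrr; last first.
  by move=> i _; rewrite !mule_ge0// lee_fin// exprn_ge0.
apply: lee_sum => i _.
rewrite -muleA muleA -EFinM -/(coef i) lee_wpmul2l ?lee_fin//.
have ik : (i <= k)%N by rewrite -ltnS.
apply: (@le_trans _ _ (T i (k - i) x)).
  by apply: ZT; rewrite subnK.
have := @nneseries_lim_ge _ (T i ^~ x) xpredT 0%N (k - i).+1 (fun p _ _ => T0 i p x).
apply: le_trans; rewrite big_nat_recr//= leeDr//.
by apply: sume_ge0.
Qed.

Let mHV : measurable_fun setT (fun x => (H x * V x)%E).
Proof. exact: emeasurable_funM. Qed.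

Let HV0 x : (0 <= H x * V x)%E. Proof. exact: mule_ge0. Qed.

Let q := (s / (1 - t)) `^ beta.

(** On each cube of the generation [p] the weight of the generation [p + i] is
    dominated, by condition F, by the integral of [V] over the part of the cube
    outside of the generation [p + i + N], and [Phi (b Q) <= H] on the cube. *)
Let integral_T i p : (\int[mu]_x T i p x <=
  (c1 * (1 + 2 ^+ (m * n)) * q ^+ i * Ck)%:E *
  \int[mu]_(x in gun c p `\` gun c (p + (i + N))%N) (H x * V x))%E.
Proof.
have C0 : 0 <= c1 * (1 + 2 ^+ (m * n)) * q ^+ i.
  by rewrite !mulr_ge0 ?(ltW c10)// ?addr_ge0 ?exprn_ge0 ?powR_ge0.
have mgun d k : measurable (gun d k) by exact: measurable_gunion.
have mgc d : measurable (gcube d) by exact: measurable_gcube.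
rewrite /T integral_csum//.
apply: (@le_trans _ _ (csum (gen c p) (fun d =>
  (c1 * (1 + 2 ^+ (m * n)) * q ^+ i * Ck)%:E *
  \int[mu]_(x in gcube d `&` ~` gun c (p + (i + N))%N) (H x * V x))%E)).
  apply: le_csum => d gd; first exact: integral_ge0.
  rewrite ge0_integralZl_EFin//; last 2 first.
  - by move=> x _; rewrite mule_ge0// lee_fin.
  - apply: emeasurable_funM; last exact/measurable_EFinP.
    exact: mind.
  have -> : (\int[mu]_x (ind (gun d i) x * (w x)%:E) =
      \int[mu]_(x in gun d i) (w x)%:E)%E.
    rewrite [RHS]integral_mkcond; apply: eq_integral => x _.
    by rewrite patchE /ind indicE; case: ifPn; rewrite ?mul1e ?mul0e.
  have dec := condF_decay n_gt0 mw w0 mV V0 beta0 c10 alpha01 hF L0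
    (fun k => mgun d k) (fun k => @gunion_sub _ _ g gam b kap t o L d k)
    (fun k l kl => @gunion_anti _ _ g gam b kap t o L d k l kl)
    theta_gt0 (fun k => mu_gunion mg s0 t_lt osc o L0 d k) hN hm i.
  apply: (@le_trans _ _ ((phi d)%:E * ((c1 * (1 + 2 ^+ (m * n)) * q ^+ i)%:E *
      \int[mu]_(x in gcube d `\` gun d (i + N)%N) V x))%E).
    by rewrite lee_wpmul2l ?lee_fin.
  rewrite muleCA [in leRHS]EFinM -muleA lee_wpmul2l ?lee_fin//.
  rewrite -!ge0_integralZl_EFin//; last 5 first.
  - by apply: measurableI => //; exact: measurableC.
  - exact: measurable_funTS.
  - exact: ltW.
  - exact: measurableD.
  - exact: measurable_funTS.
  have -> : gcube d `\` gun d (i + N)%N = gcube d `&` ~` gun c (p + (i + N))%N.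
    rewrite -(gunionI L0 (i + N) gd); apply/seteqP; split => x [dx nU]; split=> //.
      by move=> Ux; apply: nU.
    by move=> [_ Ux]; apply: nU.
  apply: ge0_le_integral_nomeas => x [dx _]; first by rewrite mule_ge0// lee_fin.
  rewrite muleA lee_wpmul2r//.
  apply: (@le_trans _ _ (Ck%:E * (Phi (b (gclosure d)))%:E)%E).
    by rewrite -EFinM lee_fin hCk.
  rewrite lee_wpmul2l ?lee_fin ?(ltW Ck0)//; apply: hH.
    exact: is_cube_gclosure.
  exact: gcube_closure.
rewrite csumZl; last by move=> d _; exact: integral_ge0.
rewrite lee_wpmul2l//; first by rewrite lee_fin mulr_ge0// ltW.
have ca : countably_additive (fun A => \int[mu]_(x in A `&` ~` gun c (p + (i + N))%N)
    (H x * V x))%E.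
  apply: (@countably_additive_restr _ _ _ (fun A => \int[mu]_(x in A) (H x * V x))%E).
    exact: measurableC.
  exact: countably_additive_integral.
rewrite -(countably_additive_bigcup ca)//; exact: generation_trivIset.
Qed.

(** Summing over [p] costs a factor [i + N], the overlap of the gaps between
    generations; summing over [i] is possible as the loss [c0 ^ i] of the
    doubling is compensated by the decay [(s / (1 - t)) ^ (beta i)] of the
    weight. *)
Lemma local_estimate :
  (\int[mu]_(x in gcube c) (Phi `|g x - gam (gclosure c)| * w x)%:E <=
   local_const%:E * \int[mu]_(x in gcube c) (H x * V x))%E.
Proof.
have mgc : measurable (gcube c) by exact: measurable_gcube.
have mF : measurable_fun setT (fun x => (Phi `|g x - gam (gclosure c)| * w x)%:E).
  apply/measurable_EFinP; apply: measurable_funM => //.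
  by apply: (measurable_condC_norm PhiC); exact: measurable_funB.
have F0 x : (0 <= (Phi `|g x - gam (gclosure c)| * w x)%:E)%E.
  by rewrite lee_fin mulr_ge0// (condC_ge0 PhiC).
have mtotal : measurable_fun setT total by exact: ge0_emeasurable_sum.
have total0 x : (0 <= total x)%E by exact: nneseries_ge0.
rewrite (@ge0_negligible_integral _ _ _ mu (gcube c) bad)//; last by apply: measurable_funS mF.
apply: (@le_trans _ _ (\int[mu]_x total x)%E).
  apply: (@le_trans _ _ (\int[mu]_(x in gcube c `\` bad) total x)%E).
    by apply: ge0_le_integral_nomeas => x // [cx nb]; exact: pointwise_total.
  by apply: ge0_subset_integral => //; exact: measurableD.
rewrite integral_nneseries//.
set X := (\int[mu]_(x in gcube c) (H x * V x))%E.
have X0 : (0 <= X)%E by exact: integral_ge0.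
set r := c0 * q.
have r0 : 0 <= r by rewrite mulr_ge0// powR_ge0.
have r1 : r < 1 by exact: contr.
pose C := 2 * c0 * c0 * (c1 * (1 + 2 ^+ (m * n))) * Ck.
have C0 : 0 < C.
  have c0p : 0 < c0 by exact: lt_le_trans c0_ge1.
  by rewrite !mulr_gt0// ltr_pwDl// exprn_ge0.
have constE : local_const = C * N.+1%:R * ((1 - r)^-1) ^+ 2 by [].
have const0 : 0 < local_const.
  rewrite constE; apply: mulr_gt0; last by rewrite exprn_gt0// invr_gt0 subr_gt0.
  by apply: mulr_gt0.
have term i : (\int[mu]_x ((coef i)%:E * sumT i x) <=
    (C * N.+1%:R * (i.+1%:R * r ^+ i))%:E * X)%E.
  rewrite ge0_integralZl_EFin// integral_nneseries//.
  pose D := c1 * (1 + 2 ^+ (m * n)) * q ^+ i * Ck.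
  have D0 : 0 <= D.
    by rewrite !mulr_ge0 ?(ltW c10) ?(ltW Ck0)// ?addr_ge0 ?exprn_ge0 ?powR_ge0.
  have gaps := @sum_integral_gaps _ _ R mu _ mHV HV0 (gun c) (i + N)
    (fun k => measurable_gunion g gam b kap t o L0 c k)
    (fun k l kl => @gunion_anti _ _ g gam b kap t o L c k l kl).
  rewrite gunion0 -/X in gaps.
  apply: (@le_trans _ _ ((coef i)%:E * (D%:E * ((i + N)%:R%:E * X)))%E).
    rewrite lee_wpmul2l ?lee_fin//.
    apply: le_trans (lee_wpmul2l _ gaps); last by rewrite lee_fin.
    rewrite -nneseriesZl; last by move=> p _; exact: integral_ge0.
    apply: lee_nneseries => p _; first by move=> _; exact: integral_ge0.
    exact: integral_T.
  rewrite !muleA -!EFinM lee_wpmul2r// lee_fin.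
  have iN : (i + N)%:R <= N.+1%:R * i.+1%:R :> R.
    by rewrite -natrM ler_nat mulSn mulnS addSn leqW// addnA leq_addr.
  apply: (@le_trans _ _ (coef i * D * (N.+1%:R * i.+1%:R))).
    by rewrite ler_wpM2l// mulr_ge0.
  by rewrite /coef /D /C /r exprMn exprS; lra.
have [->|Xoo] := eqVneq X +oo%E; first by rewrite gt0_muley ?leey// lte_fin.
have XE : X = (fine X)%:E by rewrite fineK// ge0_fin_numE// lt_neqAle Xoo leey.
apply: lime_le.
  by apply: is_cvg_nneseries => i _ _; exact: integral_ge0.
apply: nearW => k.
apply: (@le_trans _ _ (\sum_(0 <= i < k) (C * N.+1%:R * (i.+1%:R * r ^+ i))%:E * X)%E).
  by apply: lee_sum.
rewrite XE; under eq_bigr do rewrite -EFinM.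
rewrite sumEFin -EFinM lee_fin -mulr_suml ler_wpM2r ?fine_ge0//.
rewrite -mulr_sumr constE; apply: ler_wpM2l.
  by apply: mulr_ge0 => //; exact: ltW.
by apply: arithmetic_geometric_sum; rewrite r0.
Qed.

End local_estimate.

(** * The iterated maximal operator and the maximal operator of L log L *)

Section LlogL.
Context {R : realType} {n : nat}.
Hypothesis n_gt0 : (0 < n)%N.
Local Notation Rn := 'rV[R]_n.
Local Notation mu := (lebesgue_rV R n).

Local Notation tlog := (fun t : R => t * ln (1 + t)).

Lemma tlog_ge0 (u : R) : 0 <= u -> 0 <= u * ln (1 + u).
Proof. by move=> u0; rewrite mulr_ge0// ln_ge0// lerDl. Qed.

Lemma le_tlog (u : R) : 0 <= u -> u <= expR 1 + u * ln (1 + u).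
Proof.
move=> u0; have [ue|/ltW eu] := leP u (expR 1).
  by rewrite (le_trans ue)// lerDl tlog_ge0.
apply: (@le_trans _ _ (u * ln (1 + u))); last by rewrite lerDr expR_ge0.
rewrite ler_peMr//; rewrite -[leLHS](@expRK R) ler_ln ?posrE ?expR_gt0//.
  by rewrite (le_trans eu)// lerDr.
by rewrite ltr_wpDr.
Qed.

(** If [2 ^ m < u], then [2 ^ (m + 1) <= 2 * u <= (1 + u) ^ 2]. *)
Lemma sum_dyadic_le_ln (u : R) m : 0 <= u ->
  \sum_(0 <= j < m) (if 2 ^+ j < u then 1 else 0) * ln 2 <= 2 * ln (1 + u).
Proof.
move=> u0; elim: m => [|m IH]; first by rewrite big_nil mulr_ge0// ln_ge0// lerDl.
have l2 : 0 <= ln 2 :> R by rewrite ln_ge0// ler1n.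
rewrite big_nat_recr//=; case: ifPn => mu; last by rewrite mul0r addr0.
apply: (@le_trans _ _ (m.+1%:R * ln 2)).
  rewrite mul1r -[m.+1%:R]natr1 mulrDl mul1r lerD2r//.
  apply: (@le_trans _ _ (\sum_(0 <= j < m) ln 2)).
    apply: ler_sum => j _; case: ifP => _; first by rewrite mul1r.
    by rewrite mul0r.
  by rewrite sumr_const_nat subn0 mulr_natl.
have u1 : 0 < 1 + u by rewrite ltr_wpDr.
have up : 0 < u by rewrite (lt_trans _ mu)// exprn_gt0.
rewrite mulr_natl -lnXn// mulr_natl -lnXn// ler_ln ?posrE ?exprn_gt0//.
rewrite exprS; apply: (@le_trans _ _ (2 * u)).
  by rewrite ler_wpM2l// ltW.
by have := sqr_ge0 u; rewrite !expr2; lra.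
Qed.

Variable w : Rn -> R.
Hypothesis w_weight : weight w.

Let mw : measurable_fun setT w. Proof. by case: w_weight. Qed.

Let w0 x : 0 <= w x. Proof. by case: w_weight. Qed.

Let mtlog (lambda : R) : measurable_fun setT
  (fun y => (`|w y| / lambda * ln (1 + `|w y| / lambda))%:E).
Proof.
have m1 : measurable_fun setT (fun y => `|w y| / lambda).
  by apply: measurable_funM => //; exact: measurableT_comp.
apply/measurable_EFinP; apply: measurable_funM => //.
apply: measurableT_comp; first exact: measurable_ln.
exact: measurable_funD.
Qed.

Lemma Lux_normP (Q : set Rn) (lambda : R) : is_cube Q ->
  ((mu Q)^-1 * \int[mu]_(y in Q) (`|w y| / lambda * ln (1 + `|w y| / lambda))%:E
     <= 1)%E =
  (\int[mu]_(y in Q) (`|w y| / lambda * ln (1 + `|w y| / lambda))%:E <= mu Q)%E.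
Proof. by move=> cQ; rewrite le_average// mule1. Qed.

Lemma le_Lux_norm (Q : set Rn) (k : R) (x : \bar R) : is_cube Q -> 0 < k ->
  (forall lambda : R, 0 < lambda ->
    (\int[mu]_(y in Q) (`|w y| / lambda * ln (1 + `|w y| / lambda))%:E <= mu Q)%E ->
    (x <= (k * lambda)%:E)%E) ->
  (x <= k%:E * Lux_norm tlog Q w)%E.
Proof.
move=> cQ k0 h; rewrite -lee_pdivrMl//.
apply: le_ereal_inf_tmp => _ [lambda [l0 hl] <-].
rewrite lee_pdivrMl// -EFinM; apply: h => //.
by rewrite -Lux_normP.
Qed.

Lemma integral_le_LlogL (Q : set Rn) (lambda : R) : is_cube Q -> 0 < lambda ->
  (\int[mu]_(y in Q) (`|w y| / lambda * ln (1 + `|w y| / lambda))%:E <= mu Q)%E ->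
  (\int[mu]_(y in Q) `|w y|%:E <= ((expR 1 + 1) * lambda)%:E * mu Q)%E.
Proof.
move=> cQ l0 hl; have mQ := measurable_is_cube cQ.
apply: (@le_trans _ _ (\int[mu]_(y in Q) (lambda%:E * ((expR 1)%:E +
   (`|w y| / lambda * ln (1 + `|w y| / lambda))%:E)))%E).
  apply: ge0_le_integral_nomeas => // y _.
  rewrite -EFinD -EFinM lee_fin.
  rewrite -[leLHS](@divfK _ lambda) ?gt_eqF// mulrC ler_wpM2l ?(ltW l0)//.
  by rewrite le_tlog// divr_ge0// ltW.
have e0 : 0 <= expR 1 :> R by exact: expR_ge0.
rewrite ge0_integralZl_EFin ?(ltW l0)//; last 2 first.
- by move=> y _; rewrite adde_ge0// lee_fin// tlog_ge0// divr_ge0// ltW.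
- by apply: emeasurable_funD => //; exact: measurable_funTS.
rewrite ge0_integralD//; last 2 first.
- by move=> y _; rewrite lee_fin tlog_ge0// divr_ge0// ltW.
- exact: measurable_funTS.
rewrite integral_cst// mulrC EFinM -muleA lee_wpmul2l ?lee_fin ?(ltW l0)//.
by rewrite EFinD ge0_muleDl ?lee_fin// leeD2l// mul1e.
Qed.

Lemma maximal_le_LlogL x :
  (maximal w x <= (expR 1 + 1)%:E * maximal_LlogL w x)%E.
Proof.
have e0 : 0 < expR 1 + 1 :> R by rewrite addr_gt0// expR_gt0.
apply: ge_ereal_sup => _ [Q [cQ Qx] <-].
apply: (@le_trans _ _ ((expR 1 + 1)%:E * Lux_norm tlog Q w)%E).
  apply: le_Lux_norm => // lambda l0 hl.
  by rewrite le_average// muleC; exact: integral_le_LlogL.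
rewrite lee_pmul2l//; apply: ereal_sup_ubound.
by exists Q.
Qed.

(** A value of the maximal function is rounded up to the next [B * 2 ^ j]. *)
Lemma maximal_le_layers (f : Rn -> R) (B : R) (y : Rn) : 0 < B ->
  (maximal f y <= B%:E +
    \sum_(j <oo) (B * 2 ^+ j.+1)%:E * (\1_(maximal_gt f (B * 2 ^+ j)) y)%:E)%E.
Proof.
move=> B0; set S := (\sum_(j <oo) _)%E.
have t0 j : (0 <= (B * 2 ^+ j.+1)%:E * (\1_(maximal_gt f (B * 2 ^+ j)) y)%:E)%E.
  by rewrite mule_ge0// lee_fin// mulr_ge0 ?exprn_ge0// ltW.
have S0 : (0 <= S)%E by exact: nneseries_ge0.
have key r : (r%:E <= maximal f y)%E -> (r%:E <= B%:E + S)%E.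
  move=> rM; have [rB|Br] := leP r B.
    by apply: (@le_trans _ _ B%:E); rewrite ?lee_fin// leeDl.
  have ex : exists k, r <= B * 2 ^+ k.
    exists (archi_bound (r / B)); rewrite mulrC -ler_pdivrMr//.
    exact/ltW/upper_nthrootP.
  case: (ex_minnP ex) => -[|j] rj jmin.
    by move: rj; rewrite expr0 mulr1 leNgt Br.
  have jr : B * 2 ^+ j < r.
    by rewrite ltNge; apply/negP => /jmin; rewrite ltnn.
  apply: (@le_trans _ _ S); last by rewrite leeDr// lee_fin ltW.
  have := @nneseries_lim_ge _ _ xpredT 0%N j.+1 (fun j _ _ => t0 j).
  apply: le_trans; rewrite big_nat_recr//=.
  rewrite indicE mem_set ?mule1; last by rewrite /maximal_gt /= (lt_le_trans _ rM)// lte_fin.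
  apply: (@le_trans _ _ (B * 2 ^+ j.+1)%:E); first by rewrite lee_fin.
  by rewrite leeDr//; apply: sume_ge0.
have M0 := maximal_ge0 f y.
case: (maximal f y) M0 key => [r _ key|_ key|//]; first exact: key.
rewrite leye_eq; apply/eqP/eqyP => A A0; exact/key/leey.
Qed.

(** The integral of the maximal function over a cube, for a function living on
    the triple of this cube: adding up the weak-type bounds over dyadic levels
    produces the logarithm. *)
Lemma integral_maximal_LlogL : exists2 C : R, 0 < C &
  forall (a : Rn) (l lambda : R), 0 < l -> 0 < lambda ->
  let Q3 := cube (\row_i (a ord0 i - l)) (3 * l) in
  (\int[mu]_(y in Q3) (`|w y| / lambda * ln (1 + `|w y| / lambda))%:E <= mu Q3)%E ->
  (\int[mu]_(y in cube a l) maximal (w \_ Q3) y <= (C * lambda)%:E * mu (cube a l))%E.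
Proof.
pose B : R := 2 * 5 ^+ n.
have B0 : 0 < B by rewrite mulr_gt0// exprn_gt0.
have l2 : 0 < ln 2 :> R by rewrite ln_gt0// ltr1n.
pose C := B + 2 * B * 3 ^+ n * (2 / ln 2) * 3 ^+ n.
have C0' : 0 <= 2 * B * 3 ^+ n * (2 / ln 2) * 3 ^+ n.
  by rewrite !mulr_ge0 ?exprn_ge0 ?invr_ge0// ltW.
exists C; first by rewrite ltr_pwDl.
move=> a l lambda l0 la0 Q3 hl.
have l30 : 0 < 3 * l by rewrite mulr_gt0.
have mQ : measurable (cube a l) by exact: measurable_cube.
have mQ3 : measurable Q3 by exact: measurable_cube.
have muQ3 : mu Q3 = ((3 ^+ n)%:E * mu (cube a l))%E.
  by rewrite !mu_cube// -EFinM exprMn.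
set f := w \_ Q3.
have mf : measurable_fun setT f.
  by apply/(measurable_restrictT _ _).1 => //; exact: measurable_funTS.
have fE y : `|f y|%:E = ((fun y => `|w y|%:E) \_ Q3) y.
  by rewrite /f !patchE; case: ifP => // _; rewrite normr0.
have f1 : (\int[mu]_y `|f y|%:E < +oo)%E.
  under eq_integral do rewrite fE.
  rewrite -integral_mkcond; have [_ _ /(_ Q3) hQ] := w_weight.
  apply: le_lt_trans (hQ (@compact_cube R n _ _)).
  by apply: ge0_le_integral_nomeas => y _ //; rewrite ger0_norm.
have pj j : 0 < 2 ^+ j :> R by exact: exprn_gt0.
have mgt j : measurable (maximal_gt f (B * lambda * 2 ^+ j)).
  apply: (@measurable_gopen _ _ 0 1) => //; apply: emax_gt_gopen => //.
  by apply/measurable_EFinP; exact: measurableT_comp.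
have cut0 j y : (0 <= (cutoff (lambda * 2 ^+ j) f y)%:E)%E.
  by rewrite lee_fin cutoff_ge0.
have mcut j : measurable_fun setT (fun y => (cutoff (lambda * 2 ^+ j) f y)%:E).
  by apply/measurable_EFinP; exact: measurable_cutoff.
have weak j : (mu (maximal_gt f (B * lambda * 2 ^+ j)) <=
    (3 ^+ n / (lambda * 2 ^+ j))%:E * \int[mu]_y (cutoff (lambda * 2 ^+ j) f y)%:E)%E.
  have := maximal_weak_type1 n_gt0 mf f1 (mulr_gt0 la0 (pj j)).
  by rewrite /maximal_gt /B -!mulrA.
have Bl0 : 0 < B * lambda by rewrite mulr_gt0.
have t0 j y : (0 <= (B * lambda * 2 ^+ j.+1)%:E *
    (\1_(maximal_gt f (B * lambda * 2 ^+ j)) y : R)%:E)%E.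
  by rewrite mule_ge0// lee_fin// mulr_ge0 ?exprn_ge0// ltW.
have mt j : measurable_fun setT (fun y => (B * lambda * 2 ^+ j.+1)%:E *
    (\1_(maximal_gt f (B * lambda * 2 ^+ j)) y : R)%:E)%E.
  apply: measurable_funeM; apply/measurable_EFinP.
  by apply: measurable_indic; exact: mgt.
apply: (@le_trans _ _ (\int[mu]_(y in cube a l) ((B * lambda)%:E +
   \sum_(j <oo) (B * lambda * 2 ^+ j.+1)%:E *
     (\1_(maximal_gt f (B * lambda * 2 ^+ j)) y)%:E))%E).
  apply: ge0_le_integral_nomeas => y _; first exact: maximal_ge0.
  exact: maximal_le_layers.
rewrite ge0_integralD//; last 3 first.
- by move=> y _; rewrite lee_fin ltW.
- by move=> y _; exact: nneseries_ge0.
- apply: measurable_funTS; exact: ge0_emeasurable_sum.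
rewrite integral_cst// /C (mulrDl B) EFinD ge0_muleDl ?lee_fin ?(ltW Bl0)//; last first.
  by rewrite mulr_ge0// ltW.
apply: leeD => //.
apply: (@le_trans _ _ (\int[mu]_y \sum_(j <oo) (B * lambda * 2 ^+ j.+1)%:E *
     (\1_(maximal_gt f (B * lambda * 2 ^+ j)) y)%:E)%E).
  apply: ge0_subset_integral => //; first exact: ge0_emeasurable_sum.
  by move=> y _; exact: nneseries_ge0.
rewrite integral_nneseries//.
apply: (@le_trans _ _ (\sum_(j <oo) (2 * B * 3 ^+ n)%:E *
    \int[mu]_y (cutoff (lambda * 2 ^+ j) f y)%:E)%E).
  apply: lee_nneseries => j _; first by move=> _; exact: integral_ge0.
  rewrite ge0_integralZl_EFin ?mulr_ge0 ?exprn_ge0 ?(ltW B0) ?(ltW la0)//; last first.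
    by apply/measurable_EFinP; apply: measurable_indic; exact: mgt.
  rewrite integral_indic// setIT.
  apply: (@le_trans _ _ ((B * lambda * 2 ^+ j.+1)%:E *
    ((3 ^+ n / (lambda * 2 ^+ j))%:E * \int[mu]_y (cutoff (lambda * 2 ^+ j) f y)%:E))%E).
    apply: lee_wpmul2l (weak j); rewrite lee_fin.
    by apply: mulr_ge0; rewrite ?exprn_ge0// ltW.
  rewrite muleA -EFinM lee_wpmul2r ?integral_ge0// lee_fin.
  rewrite invfM exprS le_eqVlt; apply/orP; left; apply/eqP.
  transitivity (2 * B * 3 ^+ n * (lambda / lambda) * (2 ^+ j / 2 ^+ j)); first by lra.
  by rewrite !divff ?gt_eqF// !mulr1.
rewrite nneseriesZl; last by move=> j _; exact: integral_ge0.
rewrite -!(mulrA (2 * B * 3 ^+ n)) [in leRHS]EFinM -muleA; apply: lee_wpmul2l.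
  by rewrite lee_fin; apply: mulr_ge0; rewrite ?exprn_ge0// mulr_ge0// ltW.
rewrite -integral_nneseries//.
apply: (@le_trans _ _ (\int[mu]_(y in Q3) ((2 / ln 2 * lambda)%:E *
    (`|w y| / lambda * ln (1 + `|w y| / lambda))%:E))%E).
  rewrite [leRHS]integral_mkcond; apply: ge0_le_integral_nomeas => y _.
    exact: nneseries_ge0.
  rewrite patchE; case: ifPn => yQ; last first.
    rewrite eseries0// => j _ _; rewrite /cutoff /f patchE (negbTE yQ) normr0.
    by rewrite ltNge mulr_ge0 ?exprn_ge0// ltW.
  apply: lime_le; first exact: is_cvg_nneseries.
  apply: nearW => k; rewrite sumEFin -EFinM lee_fin.
  rewrite /cutoff /f patchE yQ.
  set u := `|w y| / lambda.
  have u0 : 0 <= u by rewrite divr_ge0// ltW.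
  have wu : `|w y| = lambda * u by rewrite mulrC divfK// gt_eqF.
  rewrite wu; have -> : \sum_(0 <= j < k) (if lambda * 2 ^+ j < lambda * u
      then lambda * u else 0) =
      lambda * u / ln 2 * \sum_(0 <= j < k) (if 2 ^+ j < u then 1 else 0) * ln 2.
    rewrite mulr_sumr; apply: eq_bigr => j _; rewrite ltr_pM2l//.
    by case: ifP => _; rewrite ?mul0r ?mulr0// mul1r divfK// gt_eqF.
  apply: (@le_trans _ _ (lambda * u / ln 2 * (2 * ln (1 + u)))); last by lra.
  rewrite ler_wpM2l ?sum_dyadic_le_ln//.
  by apply: divr_ge0; [apply: mulr_ge0 => //; exact: ltW|exact: ltW].
rewrite ge0_integralZl_EFin//; last 3 first.
- by move=> y _; rewrite lee_fin tlog_ge0// divr_ge0// ltW.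
- exact: measurable_funTS.
- by rewrite mulr_ge0 ?divr_ge0// ltW.
rewrite (_ : 2 / ln 2 * 3 ^+ n * lambda = 2 / ln 2 * lambda * 3 ^+ n); last by lra.
rewrite [in leRHS]EFinM -muleA; apply: lee_wpmul2l.
  by rewrite lee_fin; apply: mulr_ge0; [apply: divr_ge0|]; rewrite // ltW.
by rewrite -muQ3.
Qed.

(** On a cube, the maximal function splits into the contribution of the triple
    of the cube and that of large cubes, comparable at all points. *)
Lemma maximal_split (a x y : Rn) (l : R) : 0 < l -> cube a l x -> cube a l y ->
  (maximal w y <= (3 ^+ n)%:E * maximal w x +
     maximal (w \_ (cube (\row_i (a ord0 i - l)%R) (3 * l)%R)) y)%E.
Proof.
move=> l0 Qx Qy; set Q3 := cube _ _.
have k0 : (0 <= (3 ^+ n)%:E * maximal w x)%E.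
  by rewrite mule_ge0 ?maximal_ge0// lee_fin exprn_ge0.
apply: ge_ereal_sup => _ [P [[b [p [p0 ->]]] Py] <-].
have [pl|lp] := leP p l.
  rewrite -[leLHS]add0e; apply: leeD => //.
  apply: ereal_sup_ubound; exists (cube b p).
    by split => //; exact: is_cube_cube.
  congr (_ * _)%E; apply: eq_integral => z /set_mem Pz.
  rewrite patchE mem_set// => i; rewrite mxE.
  have /andP[h1 h2] := Pz i; have /andP[h3 h4] := Py i; have /andP[h5 h6] := Qy i.
  by apply/andP; split; lra.
rewrite -[leLHS]adde0; apply: leeD; last exact: maximal_ge0.
have p30 : 0 < 3 * p by rewrite mulr_gt0.
rewrite le_average; last exact: is_cube_cube.
apply: (@le_trans _ _ (mu (cube (\row_i (b ord0 i - p)%R) (3 * p)%R) * maximal w x)%E).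
  apply: le_trans (integral_le_emax _ _ _); last 2 first.
  - exact: is_cube_cube.
  - move=> i; rewrite mxE.
    have /andP[h1 h2] := Qx i; have /andP[h3 h4] := Py i; have /andP[h5 h6] := Qy i.
    by apply/andP; split; lra.
  apply: ge0_subset_integral => //.
  - exact: measurable_cube.
  - exact: measurable_cube.
  - by apply: measurable_funTS; apply/measurable_EFinP; exact: measurableT_comp.
  - move=> z Pz i; rewrite mxE; have /andP[h1 h2] := Pz i.
    by apply/andP; split; lra.
by rewrite !mu_cube// exprMn [in leLHS]mulrC EFinM muleA.
Qed.

(** The average of [maximal w] over a cube [Q] around [x] consists of the
    contribution of large cubes, at most a multiple of [maximal w x], and of that
    of the triple of [Q], a multiple of the Luxemburg norm of [w] there. *)
Lemma emax_maximal_le_LlogL : exists2 C : R, 0 < C &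
  forall x, (emax (maximal w) x <= C%:E * maximal_LlogL w x)%E.
Proof.
have [C C0 hC] := integral_maximal_LlogL.
have e0 : 0 < expR 1 + 1 :> R by rewrite addr_gt0// expR_gt0.
have k0 : 0 < 3 ^+ n * (expR 1 + 1) :> R by rewrite mulr_gt0// exprn_gt0.
exists (3 ^+ n * (expR 1 + 1) + C); first by rewrite addr_gt0.
move=> x; have ML0 : (0 <= maximal_LlogL w x)%E.
  rewrite -(@pmule_rge0 _ (expR 1 + 1)%:E) ?lte_fin//.
  exact: le_trans (maximal_ge0 w x) (maximal_le_LlogL x).
apply: ge_ereal_sup => _ [Q [[a [l [l0 ->]]] Qx] <-].
pose Q3 : set Rn := cube (\row_i (a ord0 i - l)) (3 * l).
have l30 : 0 < 3 * l by rewrite mulr_gt0.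
have cQ : is_cube (cube a l) by exact: is_cube_cube.
have mQ := measurable_is_cube cQ.
have mf : measurable_fun setT (w \_ Q3).
  apply/(measurable_restrictT _ _).1; first exact: measurable_cube.
  exact: measurable_funTS.
have Mx0 : (0 <= (3 ^+ n)%:E * maximal w x)%E.
  by rewrite mule_ge0 ?maximal_ge0// lee_fin exprn_ge0.
rewrite EFinD ge0_muleDl ?lee_fin ?(ltW k0) ?(ltW C0)//.
apply: (@le_trans _ _ ((3 ^+ n)%:E * maximal w x + C%:E * Lux_norm tlog Q3 w)%E).
  apply: (@le_trans _ _ ((3 ^+ n)%:E * maximal w x +
      (mu (cube a l))^-1 * \int[mu]_(y in cube a l) maximal (w \_ Q3) y)%E).
    rewrite le_average//.
    have [r r0 rE] := mu_is_cube cQ.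
    rewrite rE inver gt_eqF// ge0_muleDr//; last first.
      by rewrite mule_ge0 ?lee_fin ?invr_ge0 ?(ltW r0)// integral_ge0// => y _; exact: maximal_ge0.
    rewrite (muleA r%:E (r^-1)%:E) -EFinM divff ?gt_eqF// mul1e.
    have -> : (r%:E * ((3 ^+ n)%:E * maximal w x) =
        \int[mu]_(y in cube a l) cst ((3 ^+ n)%:E * maximal w x) y)%E.
      by rewrite integral_cst// muleC; congr (_ * _)%E; exact/esym.
    rewrite -ge0_integralD//; last 2 first.
    - by move=> y _; exact: maximal_ge0.
    - by apply: measurable_funTS; exact: measurable_maximal.
    apply: ge0_le_integral_nomeas => y Qy; first exact: maximal_ge0.
    exact: maximal_split.
  rewrite leeD2l//; apply: le_Lux_norm => //.
    exact: is_cube_cube.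
  by move=> lambda la0 hl; rewrite le_average// muleC; exact: hC.
apply: leeD.
  rewrite EFinM -muleA lee_wpmul2l ?lee_fin ?exprn_ge0//.
  exact: maximal_le_LlogL.
rewrite lee_wpmul2l ?lee_fin ?(ltW C0)//; apply: ereal_sup_ubound.
exists Q3 => //; split; first exact: is_cube_cube.
move=> i; rewrite mxE; have /andP[h1 h2] := Qx i.
by apply/andP; split; lra.
Qed.

End LlogL.

(** * Principal value integrals and the oscillation estimate *)

Section principal_value.
Context {R : realType} {n : nat}.
Local Notation Rn := 'rV[R]_n.
Local Notation mu := (lebesgue_rV R n).
Variable k : Rn -> Rn -> R.
Hypothesis kCZ : CZ_kernel k.

Lemma enorm_ge0 (x : Rn) : 0 <= enorm x.
Proof. exact: sqrtr_ge0. Qed.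

Lemma enorm_gt_neq (x y : Rn) (e : R) : 0 <= e -> e < enorm (x - y) -> x != y.
Proof.
move=> e0; apply: contraTneq => ->; rewrite subrr /enorm big1 ?sqrtr0 -?leNgt//.
by move=> i _; rewrite mxE expr0n.
Qed.

Lemma measurable_dist :
  measurable_fun setT (fun p : Rn * Rn => enorm (p.1 - p.2)).
Proof.
have m1 (i : 'I_n) : measurable_fun setT (fun p : Rn * Rn => p.1 ord0 i).
  exact: (measurableT_comp (@measurable_coord _ R n i) measurable_fst).
have m2 (i : 'I_n) : measurable_fun setT (fun p : Rn * Rn => p.2 ord0 i).
  exact: (measurableT_comp (@measurable_coord _ R n i) measurable_snd).
apply: (@measurableT_comp _ _ _ _ _ _ (@Num.sqrt R) _
  (fun p : Rn * Rn => \sum_i (p.1 - p.2) ord0 i ^+ 2)).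
  apply: continuous_measurable_fun; exact: sqrt_continuous.
apply: measurable_sum => i; apply: measurable_funX.
under eq_fun do rewrite !mxE.
exact: measurable_funB.
Qed.

Lemma measurable_off_diagonal (e : R) :
  measurable [set p : Rn * Rn | e < enorm (p.1 - p.2)].
Proof.
rewrite -[X in measurable X]setTI (_ : mkset _ =
  (fun p : Rn * Rn => enorm (p.1 - p.2)) @^-1` `]e, +oo[%classic); last first.
  by apply/seteqP; split => p /=; rewrite in_itv/= andbT.
exact: measurable_dist.
Qed.

Lemma off_diagonalE :
  [set p : Rn * Rn | p.1 != p.2] = [set p : Rn * Rn | 0 < enorm (p.1 - p.2)].
Proof.
apply/seteqP; split => p /=; last exact: enorm_gt_neq.
rewrite lt0r enorm_ge0 andbT; apply: contraNN => /eqP.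
rewrite /enorm => /eqP; rewrite sqrtr_eq0 => s0.
have /eqP : \sum_i (p.1 - p.2) ord0 i ^+ 2 = 0.
  by apply/eqP; rewrite eq_le s0 sumr_ge0// => i _; rewrite sqr_ge0.
rewrite psumr_eq0; last by move=> i _; rewrite sqr_ge0.
move=> /allP h; apply/eqP/rowP => i; have := h i (mem_index_enum _).
by rewrite sqrf_eq0 !mxE subr_eq0 => /eqP.
Qed.

(** Measurable on the whole product space, while the kernel itself may not be on
    the diagonal. *)
Definition kernel_cut (e : R) : Rn * Rn -> R :=
  (fun p => k p.1 p.2) \_ [set p : Rn * Rn | e < enorm (p.1 - p.2)].

Lemma measurable_kernel_cut (e : R) : 0 <= e ->
  measurable_fun setT (kernel_cut e).
Proof.
move=> e0; apply/(measurable_restrictT _ _).1; first exact: measurable_off_diagonal.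
have [mk _ _] := kCZ; apply: measurable_funS mk; last first.
  by move=> p; exact: enorm_gt_neq.
by rewrite off_diagonalE; exact: measurable_off_diagonal.
Qed.

Lemma measurable_ball_compl (x : Rn) (e : R) :
  measurable [set y | e < enorm (x - y)].
Proof.
have := @measurable_xsection _ _ _ _ _ x (measurable_off_diagonal e).
by rewrite (_ : xsection _ _ = [set y | e < enorm (x - y)])// /xsection;
  apply/seteqP; split => y /=; rewrite inE.
Qed.

Lemma truncatedE (f : Rn -> R) (x : Rn) (e : R) :
  truncated k f x e = fine (\int[mu]_y (kernel_cut e (x, y) * f y)%:E).
Proof.
rewrite /truncated /Rintegral integral_mkcond; congr fine.
apply: eq_integral => y _; rewrite /kernel_cut !patchE/=.
have [yD|yD] := boolP (y \in _).
  by rewrite ifT// inE; move: yD; rewrite inE.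
rewrite ifF ?mul0r//; apply/negbTE; move: yD; rewrite !notin_setE.
exact.
Qed.

(** Tonelli's theorem for the positive and the negative part of the kernel, cut
    off near the diagonal, times [f]. *)
Lemma measurable_truncated (f : Rn -> R) (e : R) : 0 <= e ->
  measurable_fun setT f ->
  measurable_fun setT (fun x => truncated k f x e).
Proof.
move=> e0 mf; under eq_fun do rewrite truncatedE.
pose F (p : Rn * Rn) := (kernel_cut e p * f p.2)%:E.
have mF : measurable_fun setT F.
  apply/measurable_EFinP/measurable_funM; first exact: measurable_kernel_cut.
  exact: (measurableT_comp mf measurable_snd).
apply: measurableT_comp; first exact: fine_measurable.
rewrite (_ : (fun x => _) = (fubini_F mu (F^\+) \- fubini_F mu (F^\-))%E).
  apply: emeasurable_funB; apply: measurable_fun_fubini_tonelli_F => //.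
  - exact: measurable_funepos.
  - exact: measurable_funeneg.
apply/funext => x; rewrite integralE /fubini_F /=.
by congr (_ - _)%E; apply: eq_integral => y _; rewrite ?funeposE ?funenegE.
Qed.

(** Outside a ball around the singularity the kernel is bounded. *)
Lemma integrable_truncated (f : Rn -> R) (x : Rn) (e : R) : 0 < e ->
  mu.-integrable setT (EFin \o f) ->
  mu.-integrable [set y | e < enorm (x - y)] (EFin \o (fun y => k x y * f y)).
Proof.
move=> e0 If; have [_ [C hC] _] := kCZ.
have mf : measurable_fun setT f by apply/measurable_EFinP; exact: measurable_int If.
have mD := measurable_ball_compl x e.
have mkx : measurable_fun [set y | e < enorm (x - y)] (fun y => k x y).
  apply: (@eq_measurable_fun _ _ _ _ _ (fun y => kernel_cut e (x, y))).
    by move=> y; rewrite /kernel_cut patchE inE /= => yD; rewrite ifT// inE.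
  apply: measurable_funTS; apply: measurableT_comp.
    exact: measurable_kernel_cut (ltW e0).
  exact: measurable_pair1.
apply: (@le_integrable _ _ _ mu _ mD _
  (fun y => (`|C| / e ^+ n)%:E * (EFin \o f) y)%E).
- by apply/measurable_EFinP; apply: measurable_funM => //; exact: measurable_funTS.
- move=> y /= yD; rewrite lee_fin normrM [leRHS]normrM.
  apply: ler_pM => //; apply: (le_trans (hC _ _ (enorm_gt_neq (ltW e0) yD))).
  rewrite [leRHS]ger0_norm ?divr_ge0 ?exprn_ge0 ?(ltW e0)//.
  have d0 : 0 < enorm (x - y) by exact: lt_trans yD.
  apply: (@le_trans _ _ (`|C| / enorm (x - y) ^+ n)).
    by rewrite ler_wpM2r ?ler_norm// invr_ge0 exprn_ge0// ltW.
  rewrite ler_wpM2l// lef_pV2 ?posrE ?exprn_gt0//.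
  by rewrite lerXn2r ?nnegrE ?(ltW e0) ?(ltW d0)// ltW.
- apply: integrableZl => //.
  by apply: integrableS If.
Qed.

Lemma truncatedD (f1 f2 : Rn -> R) (x : Rn) (e : R) : 0 < e ->
  mu.-integrable setT (EFin \o f1) -> mu.-integrable setT (EFin \o f2) ->
  truncated k (f1 \+ f2) x e = truncated k f1 x e + truncated k f2 x e.
Proof.
move=> e0 I1 I2; rewrite /truncated -RintegralD; last 3 first.
- exact: measurable_ball_compl.
- exact: integrable_truncated.
- exact: integrable_truncated.
by apply: eq_Rintegral => y _; rewrite mulrDr.
Qed.

Lemma pv_integralD (f1 f2 : Rn -> R) (x : Rn) :
  mu.-integrable setT (EFin \o f1) -> mu.-integrable setT (EFin \o f2) ->
  pv_exists k f1 x -> pv_exists k f2 x ->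
  pv_integral k (f1 \+ f2) x = pv_integral k f1 x + pv_integral k f2 x.
Proof.
move=> I1 I2 c1 c2; apply/cvg_lim => //.
apply: cvg_trans (cvgD c1 c2); apply: near_eq_cvg; near=> e.
rewrite /= truncatedD//; near: e; exact: nbhs_right_gt.
Unshelve. all: by end_near. Qed.

(** The principal value, where it exists, is a limit along a sequence of radii
    of functions that are measurable everywhere. *)
Lemma pv_integral_measurable_version (f : Rn -> R) : pv_domain k f ->
  exists2 g, measurable_fun setT g &
    {ae mu, forall x, g x = pv_integral k f x}.
Proof.
move=> [If aef].
have mf : measurable_fun setT f by apply/measurable_EFinP; exact: measurable_int If.
pose u (m : nat) (x : Rn) := (truncated k f x m.+1%:R^-1)%:E.
exists (fun x => fine (limn_esup (u^~ x))).
  apply: measurableT_comp; first exact: fine_measurable.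
  apply: measurable_fun_limn_esup => m; apply/measurable_EFinP.
  exact: measurable_truncated.
apply: filterS aef => x cx.
have : u^~ x @ \oo --> (pv_integral k f x)%:E.
  apply/cvg_EFin; first by near=> m.
  move/cvg_at_rightP : cx; apply; split; first by move=> m; rewrite invr_gt0.
  exact: cvg_harmonic.
by move=> /cvg_limn_einf_sup[_ ->].
Unshelve. all: by end_near. Qed.

End principal_value.

(** * From the splitting property to oscillation bounds *)

Section oscillation.
Context {R : realType} {n : nat}.
Hypothesis n_gt0 : (0 < n)%N.
Local Notation Rn := 'rV[R]_n.
Local Notation mu := (lebesgue_rV R n).

Definition inf_maximal (f : Rn -> R) (Q : set Rn) : R :=
  fine (ereal_inf [set maximal f y | y in Q]).

Variable f : Rn -> R.
Hypothesis mf : measurable_fun setT f.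
Hypothesis f1 : (\int[mu]_x `|f x|%:E < +oo)%E.

Let norm_f : R := fine (\int[mu]_x `|f x|%:E).

Let norm_f0 : 0 <= norm_f.
Proof. by rewrite fine_ge0// integral_ge0. Qed.

Let norm_fE : (\int[mu]_x `|f x|%:E)%E = norm_f%:E.
Proof. by rewrite fineK// ge0_fin_numE// integral_ge0. Qed.

(** Otherwise the level set of the maximal function, controlled by the weak-type
    estimate, would contain the cube. *)
Lemma exists_maximal_le (lam : R) (Q : set Rn) : 0 < lam -> is_cube Q ->
  ((3 ^+ n / lam * norm_f)%:E < mu Q)%E ->
  exists2 x, Q x & (maximal f x <= (2 * 5 ^+ n * lam)%:E)%E.
Proof.
move=> lam0 cQ; apply: contraPP => nQ; apply/negP; rewrite -leNgt.
apply: (@le_trans _ _ (mu [set x | (2 * 5 ^+ n * lam)%:E < maximal f x]%E)).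
  apply: le_lebesgue_rV => x Qx /=; rewrite ltNge; apply/negP => h.
  by apply: nQ; exists x.
apply: (le_trans (maximal_weak_type1 n_gt0 mf f1 lam0)).
rewrite [in leRHS]EFinM -norm_fE; apply: lee_wpmul2l.
  by rewrite lee_fin divr_ge0 ?exprn_ge0// ltW.
apply: ge0_le_integral_nomeas => y _; first by rewrite lee_fin cutoff_ge0.
by rewrite lee_fin le_cutoff.
Qed.

Lemma inf_maximalE (Q : set Rn) : is_cube Q ->
  ereal_inf [set maximal f y | y in Q] = (inf_maximal f Q)%:E.
Proof.
move=> cQ; rewrite /inf_maximal fineK//.
have m0 : (0 <= ereal_inf [set maximal f y | y in Q])%E.
  by apply: le_ereal_inf_tmp => _ [y _ <-]; exact: maximal_ge0.
rewrite ge0_fin_numE//; have [r r0 rE] := mu_is_cube cQ.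
pose lam := 3 ^+ n * (norm_f + 1) / r.
have c0 : 0 < norm_f + 1 by rewrite ltr_wpDl.
have lam0 : 0 < lam by rewrite divr_gt0// mulr_gt0// exprn_gt0.
have [|x Qx hx] := @exists_maximal_le lam Q lam0 cQ.
  rewrite rE lte_fin /lam invfM invrK invfM.
  rewrite (_ : _ * _ * norm_f = r * (norm_f / (norm_f + 1)) * (3 ^+ n / 3 ^+ n)); last by lra.
  rewrite divff ?gt_eqF ?exprn_gt0// mulr1 -[ltRHS]mulr1 ltr_pM2l//.
  by rewrite ltr_pdivrMr// mul1r ltrDl.
apply: (@le_lt_trans _ _ (maximal f x)); last exact: le_lt_trans hx (ltry _).
by apply: ereal_inf_lbound; exists x.
Qed.

Lemma inf_maximal_ge0 (Q : set Rn) : is_cube Q -> 0 <= inf_maximal f Q.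
Proof.
move=> cQ; rewrite -lee_fin -inf_maximalE//.
by apply: le_ereal_inf_tmp => _ [y _ <-]; exact: maximal_ge0.
Qed.

Lemma inf_maximal_le (Q : set Rn) (x : Rn) : is_cube Q -> Q x ->
  ((inf_maximal f Q)%:E <= maximal f x)%E.
Proof.
by move=> cQ Qx; rewrite -inf_maximalE//; apply: ereal_inf_lbound; exists x.
Qed.

Lemma inf_maximal_anti (Q Q' : set Rn) : is_cube Q -> is_cube Q' ->
  Q `<=` Q' -> inf_maximal f Q' <= inf_maximal f Q.
Proof.
move=> cQ cQ' sQ; rewrite -lee_fin -!inf_maximalE//.
by apply: ereal_inf_le_tmp; exact: image_subset.
Qed.

(** On a cube the local part [h1] is controlled off a set of small measure and
    the distant part [h2] almost everywhere, so [T f] deviates little from the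
    constant [T h2 xQ] off a set of small measure. *)
Lemma splitting_deviation (k : Rn -> Rn -> R) (g h1 h2 : Rn -> R) (xQ : Rn)
    (Q : set Rn) (c1 c2 s : R) : is_cube Q ->
  measurable_fun setT g -> {ae mu, forall x, g x = pv_integral k f x} ->
  CZ_kernel k -> f = h1 \+ h2 -> pv_domain k h1 -> pv_domain k h2 ->
  (mu [set z | Q z /\ (c1%:E * (inf_maximal f Q)%:E < `|pv_integral k h1 z|%:E)%E]
     < s%:E * mu Q)%E ->
  ('N[mu]_(+oo)[(fun z => (pv_integral k h2 z - pv_integral k h2 xQ)%:E) \_ Q]
     <= c2%:E * (inf_maximal f Q)%:E)%E ->
  (mu [set z | Q z /\ ((c1 + c2) * inf_maximal f Q < `|g z - pv_integral k h2 xQ|)%R]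
     < s%:E * mu Q)%E.
Proof.
move=> cQ mg gT kCZ fE [I1 ae1] [I2 ae2] small; rewrite unlock.
have mQ := measurable_is_cube cQ.
have [r r0 rE] := mu_is_cube cQ.
rewrite ifT; last first.
  apply: (@lt_le_trans _ _ (mu Q)); last exact: le_lebesgue_rV.
  by rewrite [mu Q]rE lte_fin.
move=> /ess_supP ae3; set b := inf_maximal f Q.
set D := [set z | _].
have mD : measurable D.
  rewrite (_ : D = Q `&` (fun z => `|g z - pv_integral k h2 xQ|) @^-1`
      `](c1 + c2) * b, +oo[); last first.
    by apply/seteqP; split => z /=; rewrite in_itv/= andbT.
  have : measurable_fun setT (fun z => `|g z - pv_integral k h2 xQ|).
    by apply: measurableT_comp => //; exact: measurable_funB.
  by move=> /(measurable_funS measurableT (@subsetT _ Q)); exact.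
have [N [mN N0 sN]] : mu.-negligible (~` [set z |
    [/\ pv_exists k h1 z, pv_exists k h2 z, g z = pv_integral k f z &
     Q z -> `|pv_integral k h2 z - pv_integral k h2 xQ| <= c2 * b]]).
  apply: (filterS _ (filterI (filterI ae1 ae2) (filterI gT ae3))).
  move=> z [[p1 p2] [p3 p4]]; split=> // Qz; rewrite -lee_fin EFinM.
  by apply: le_trans p4; rewrite /= patchE mem_set.
apply: le_lt_trans small; apply: (@le_trans _ _ (mu (D `\` N))).
  rewrite -[leRHS]adde0 -N0; apply: le_trans (measureU2 _ _ mN); last exact: measurableD.
  by apply: le_lebesgue_rV => z Dz; have [Nz|Nz] := pselect (N z); [right|left].
apply: le_lebesgue_rV => z [[Qz Dz] Nz]; split=> //.
have [p1 p2 p3 p4] : [/\ pv_exists k h1 z, pv_exists k h2 z, g z = pv_integral k f z &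
     Q z -> `|pv_integral k h2 z - pv_integral k h2 xQ| <= c2 * b].
  by apply: contrapT => np; apply/Nz/sN.
have Tz : pv_integral k f z = pv_integral k h1 z + pv_integral k h2 z.
  by rewrite fE pv_integralD.
rewrite -EFinM lte_fin; move: Dz; rewrite p3 Tz.
have := p4 Qz; rewrite -/b; set u1 := pv_integral k h1 z.
set u2 := pv_integral k h2 z; set u3 := pv_integral k h2 xQ => h2b.
rewrite mulrDl -addrA => hlt; have := ler_normD u1 (u2 - u3); lra.
Qed.

(** On large cubes most points have small values of [g], by the weak-type
    estimate, and a small deviation, so the constants tend to zero. *)
Lemma gam_vanishes (g : Rn -> R) (gam : set Rn -> R) (s kap Cw eps : R) :
  measurable_fun setT g -> 0 <= kap -> s <= 2^-1 -> 0 <= Cw -> 0 < eps ->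
  (forall lam, 0 < lam ->
    (mu [set x | (lam < `|g x|)%R] <= (Cw / lam)%:E * \int[mu]_x `|f x|%:E)%E) ->
  (forall Q, is_cube Q ->
    (mu (deviation g gam (inf_maximal f) kap Q Q) < s%:E * mu Q)%E) ->
  exists M : R, forall Q, is_cube Q -> (M%:E < mu Q)%E -> `|gam Q| <= eps.
Proof.
move=> mg kap0 s2 Cw0 eps0 weak osc.
pose B : R := 2 * 5 ^+ n.
have B0 : 0 < B by rewrite mulr_gt0// exprn_gt0.
have k0 : 0 < kap + 1 by rewrite ltr_wpDl.
pose lam := eps / 2 / (kap + 1) / B.
have e20 : 0 < eps / 2 by rewrite divr_gt0.
have lam0 : 0 < lam by rewrite divr_gt0// divr_gt0.
have M10 : 0 <= 3 ^+ n / lam * norm_f by rewrite mulr_ge0// divr_ge0 ?exprn_ge0// ltW.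
have M20 : 0 <= Cw / (eps / 2) * norm_f by rewrite mulr_ge0// divr_ge0// ltW.
exists (3 ^+ n / lam * norm_f + 2 * (Cw / (eps / 2) * norm_f)) => Q cQ.
have mQ := measurable_is_cube cQ.
have [r r0 rE] := mu_is_cube cQ; rewrite rE lte_fin => Mr.
have [x Qx hx] : exists2 x, Q x & (maximal f x <= (B * lam)%:E)%E.
  by apply: exists_maximal_le => //; rewrite rE lte_fin; lra.
have bQ : kap * inf_maximal f Q <= eps / 2.
  apply: (@le_trans _ _ ((kap + 1) * (B * lam))).
    apply: ler_pM => //; first exact: inf_maximal_ge0.
      by rewrite lerDl.
    by rewrite -lee_fin; apply: le_trans hx; exact: inf_maximal_le.
  rewrite /lam (mulrC B) divfK ?gt_eqF// mulrC divfK// gt_eqF//.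
have mgt : measurable [set x : Rn | eps / 2 < `|g x|].
  rewrite -[X in measurable X]setTI (_ : mkset _ =
    (fun z => `|g z|) @^-1` `]eps / 2, +oo[%classic); last first.
    by apply/seteqP; split => z /=; rewrite in_itv/= andbT.
  exact: measurableT_comp.
have md : measurable (deviation g gam (inf_maximal f) kap Q Q).
  exact: measurable_deviation.
have [z [Qz z1 z2]] : exists z, [/\ Q z, `|g z| <= eps / 2 &
    `|g z - gam Q| <= kap * inf_maximal f Q].
  apply: contrapT => nz; have : (mu Q < mu Q)%E; last by rewrite ltxx.
  apply: (@le_lt_trans _ _ (mu [set x | (eps / 2 < `|g x|)%R] +
      mu (deviation g gam (inf_maximal f) kap Q Q))%E).
    apply: le_trans (measureU2 _ mgt md); apply: le_lebesgue_rV => z Qz.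
    have [zl|zl] := leP `|g z| (eps / 2); last by left.
    right; split => //; rewrite ltNge; apply/negP => zk; apply: nz.
    by exists z.
  apply: (@lt_le_trans _ _ ((Cw / (eps / 2) * norm_f)%:E + s%:E * mu Q)%E).
    have wk := weak _ e20; rewrite norm_fE -EFinM in wk.
    apply: lee_ltD => //; last exact: osc.
    by rewrite ge0_fin_numE//; apply: le_lt_trans wk _; exact: ltry.
  rewrite rE -EFinM -EFinD lee_fin.
  have : s * r <= 2^-1 * r by rewrite ler_wpM2r// ltW.
  lra.
have := ler_normB (g z) (g z - gam Q).
rewrite opprB addrCA subrr addr0; lra.
Qed.

End oscillation.

(** * The modular inequality *)

Section modular.
Context {R : realType} {n : nat}.
Hypothesis n_gt0 : (0 < n)%N.
Local Notation Rn := 'rV[R]_n.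
Local Notation mu := (lebesgue_rV R n).
Variables (Phi : R -> R) (c0 : R).
Hypothesis PhiC : condition_C Phi c0.
Hypothesis c0_ge1 : 1 <= c0.
Variable w : Rn -> R.
Hypothesis mw : measurable_fun setT w.
Hypothesis w0 : forall x, 0 <= w x.

Let c0_gt0 : 0 < c0. Proof. exact: lt_le_trans c0_ge1. Qed.

Lemma limn_einf_ge (u : (\bar R)^nat) (a : \bar R) m :
  (forall p, (m <= p)%N -> (a <= u p)%E) -> (a <= limn_einf u)%E.
Proof.
move=> h; rewrite limn_einf_lim (cvg_lim _ (@cvg_einfs_sup _ u))//.
apply: le_trans (ereal_sup_ubound _); last by exists m.
by apply: le_ereal_inf_tmp => _ [p /= mp <-]; exact: h.
Qed.

Lemma limn_einf_le (u : (\bar R)^nat) (a : \bar R) :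
  (forall p, (u p <= a)%E) -> (limn_einf u <= a)%E.
Proof.
move=> h; rewrite limn_einf_lim (cvg_lim _ (@cvg_einfs_sup _ u))//.
apply: ge_ereal_sup => _ [m _ <-]; apply: le_trans (h m).
by apply: ereal_inf_lbound; exists m => /=.
Qed.

Let qcube (m : nat) : set Rn :=
  gcube (\row_i - m.+1%:R) (2 * m.+1%:R) (0%N, 0).

Let qcubeE m : qcube m =
  hcube (\row_i - m.+1%:R : Rn) (2 * m.+1%:R).
Proof.
rewrite /qcube gcubeE ?mulr_gt0// /gside expr0 divr1; congr hcube.
by apply/rowP => i; rewrite !mxE mul0r addr0.
Qed.

(** Since [gam] tends to zero along the exhausting cubes, at every point where
    [g] does not vanish [|g|] is eventually at most twice [|g - gam|]; the
    doubling of [Phi] and Fatou's lemma do the rest. *)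
Lemma exhaustion (g : Rn -> R) (gam : set Rn -> R) (X : \bar R) :
  measurable_fun setT g ->
  (forall eps, 0 < eps -> exists M : R, forall Q, is_cube Q ->
    (M%:E < mu Q)%E -> `|gam Q| <= eps) ->
  (forall o L c, 0 < L -> (\int[mu]_(x in gcube o L c)
    (Phi `|g x - gam (gclosure o L c)| * w x)%:E <= X)%E) ->
  (\int[mu]_x (Phi `|g x| * w x)%:E <= c0%:E * X)%E.
Proof.
move=> mg gam0 hX.
pose ga m := gam (gclosure (\row_i - m.+1%:R : Rn) (2 * m.+1%:R) (0%N, 0)).
pose F m := (fun x => (Phi `|g x - ga m| * w x)%:E) \_ (qcube m).
have F0 m x : (0 <= F m x)%E.
  rewrite /F patchE; case: ifP => // _.
  by rewrite lee_fin mulr_ge0// (condC_ge0 PhiC).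
have mF m : measurable_fun setT (F m).
  apply/(measurable_restrictT _ _).1.
    by apply: measurable_gcube; rewrite mulr_gt0.
  apply: measurable_funTS; apply/measurable_EFinP; apply: measurable_funM => //.
  by apply: (measurable_condC_norm PhiC); exact: measurable_funB.
pose u m x := (c0%:E * F m x)%E.
have u0 m x : (0 <= u m x)%E by rewrite mule_ge0// lee_fin ltW.
have ga_small eps : 0 < eps -> exists m, forall p, (m <= p)%N -> `|ga p| <= eps.
  move=> /gam0[M hM]; exists (archi_bound M) => p Mp; apply: hM.
    by apply: is_cube_gclosure; rewrite mulr_gt0.
  rewrite mu_gclosure ?mulr_gt0// lte_fin /gside expr0 divr1.
  have Mp1 : M < p.+1%:R.
    apply: (le_lt_trans (ler_norm M)).
    apply: (@lt_le_trans _ _ (archi_bound M)%:R).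
      by have := archi_boundP (normr_ge0 M); rewrite /archi_bound normr_id.
    by rewrite ler_nat leqW.
  apply: (lt_le_trans Mp1); have p1 : 1 <= 2 * p.+1%:R :> R.
    by rewrite -natrM ler1n.
  apply: (@le_trans _ _ (2 * p.+1%:R)); first by rewrite ler_peMl// ler1n.
  by rewrite -[leLHS]expr1 ler_weXn2l.
have pointwise x : ((Phi `|g x| * w x)%:E <= limn_einf (u^~ x))%E.
  have [gx0|gx0] := eqVneq (g x) 0.
    have [_ _ P0 _] := PhiC; rewrite gx0 normr0 P0 mul0r.
    by apply: (@limn_einf_ge _ _ 0%N) => p _; exact: u0.
  have g2 : 0 < `|g x| / 2 by rewrite divr_gt0// normr_gt0.
  have [m1 hm1] := ga_small _ g2.
  pose m2 := archi_bound (\sum_i `|x ord0 i|).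
  apply: (@limn_einf_ge _ _ (maxn m1 m2)) => p; rewrite geq_max => /andP[/hm1 gp mp].
  have xp : x \in qcube p.
    rewrite inE qcubeE => i; rewrite !mxE.
    have : `|x ord0 i| < p.+1%:R.
      apply: (@le_lt_trans _ _ (\sum_i `|x ord0 i|)).
        by rewrite (bigD1 i)//= lerDl sumr_ge0.
      apply: (@lt_le_trans _ _ m2%:R); last by rewrite ler_nat leqW.
      by apply: archi_boundP; exact: sumr_ge0.
    by rewrite ltr_norml => /andP[h1 h2]; apply/andP; split; lra.
  rewrite /u /F patchE xp -EFinM lee_fin mulrA ler_wpM2r//.
  apply: le_trans (condC_double PhiC _) => //.
  apply: (condC_homo PhiC) => //.
  have := ler_normB (g x - ga p) (- ga p); rewrite opprK subrK normrN.
  lra.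
apply: (@le_trans _ _ (\int[mu]_x limn_einf (u^~ x))%E).
  apply: ge0_le_integral_nomeas => x _; last exact: pointwise.
  by rewrite lee_fin mulr_ge0// (condC_ge0 PhiC).
apply: le_trans (fatou _ _ _ _) _ => //.
  by move=> m; exact: measurable_funeM.
apply: limn_einf_le => m; rewrite /u ge0_integralZl_EFin ?(ltW c0_gt0)//.
apply: lee_wpmul2l; first by rewrite lee_fin ltW.
by rewrite -integral_mkcond; apply: hX; rewrite mulr_gt0.
Qed.

(** As [s < 1/2], the bound holds in the limit of infinitely slow growth. *)
Lemma exists_dilation (s : R) : 0 <= s -> s < 2^-1 ->
  exists2 J, (0 < J)%N & s * (1 + (1 + J%:R^-1) ^+ n) <= 1.
Proof.
move=> s0 s2.
have : (fun J : nat => s * (1 + (1 + J.+1%:R^-1) ^+ n)) @ \oo --> s * (1 + (1 + 0) ^+ n).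
  apply: cvgMr; apply: cvgD; first exact: cvg_cst.
  apply: (@continuous_cvg _ _ _ _ _ _ (fun x : R => x ^+ n)).
    exact: exprn_continuous.
  by apply: cvgD; [exact: cvg_cst|exact: cvg_harmonic].
rewrite addr0 expr1n => /cvgr_lt /(_ 1) h.
have [|J hJ] := @filter_ex _ _ _ _ (h _); first lra.
by exists J.+1 => //; exact: ltW.
Qed.

Variables (k : Rn -> Rn -> R) (S : set (Rn -> R)) (s : R).
Hypothesis kCZ : CZ_kernel k.
Hypothesis k_weak : weak_type11 k.
Hypothesis k_split : splitting_property k S s.

(** The local estimate, with [H] the layers of [Phi] at the maximal function of
    [f], on an exhausting sequence of cubes. The parameters [J], [N], [m], [Ck]
    only depend on the data, so the constant does not depend on [f]. *)
Lemma maximal_control (V : Rn -> \bar R) (beta : R) :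
  measurable_fun setT V -> (forall x, (0 <= V x)%E) ->
  condition_F w V beta -> admissible c0 beta s ->
  exists2 K, 0 < K & forall f, S f ->
    (\int[mu]_x (Phi `|pv_integral k f x| * w x)%:E <=
     K%:E * \int[mu]_x (maximal_layers Phi f x * V x))%E.
Proof.
move=> mV V0 [beta0 [cF [alpha [cF0 alpha01 hF]]]].
move=> [/andP[s0 s_le] [t [/andP[t_gt t_lt] contr]]].
have [[S_dom _] [c1 [c2 [c10 c20 hsplit]]]] := k_split.
have [Cw [Cw0 weak]] := k_weak.
have s_lt : s < 2^-1 by lra.
have [J J0 hJ] := exists_dilation (ltW s0) s_lt.
have alpha2 : 0 < alpha / 2 by have /andP[a0 _] := alpha01; rewrite divr_gt0.
have t1 : 0 < 1 - t by lra.
have [N hN] : exists N, (s / (1 - t)) ^+ N <= alpha / 2.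
  have th1 : `|s / (1 - t)| < 1.
    by rewrite ger0_norm ?divr_ge0 ?(ltW s0) ?(ltW t1)// ltr_pdivrMr// mul1r; lra.
  have /cvgr_le /(_ _ alpha2) h := cvg_expr th1.
  exact: (@filter_ex _ _ _ _ h).
have [m] := real_small_power 1 alpha2.
rewrite div1r => /ltW hm.
pose kap := c1 + c2.
have kap0 : 0 <= kap by rewrite addr_ge0// ltW.
have [Ck Ck0 hCk'] := condC_scale PhiC ((2 * J + 2)%:R * kap) (ltW c0_gt0).
have hCk u : 0 <= u -> Phi ((2 * J + 2)%:R * kap * u) <= Ck * Phi u.
  by move=> /hCk'; rewrite ger0_norm// mulr_ge0.
pose K := `|@local_const R n c0 beta cF s t N m Ck| + 1.
have K0 : 0 < K by rewrite ltr_wpDl.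
exists (c0 * K); first by rewrite mulr_gt0.
move=> f Sf; have domf := S_dom _ Sf; have [If _] := domf.
have mf : measurable_fun setT f by apply/measurable_EFinP; exact: measurable_int If.
have f1 : (\int[mu]_x `|f x|%:E < +oo)%E by have /integrableP[] := If.
have [g mg gT] := pv_integral_measurable_version kCZ domf.
have [gam osc] : exists gam : set Rn -> R, forall Q, is_cube Q ->
    (mu (deviation g gam (inf_maximal f) kap Q Q) < s%:E * mu Q)%E.
  have /choice[gam hgam] : forall Q, exists ga : R, is_cube Q ->
      (mu (deviation g (cst ga) (inf_maximal f) kap Q Q) < s%:E * mu Q)%E.
    move=> Q; have [cQ|nQ] := pselect (is_cube Q); last by exists 0.
    have [xQ [_ /(_ _ Sf)[h1 [h2 [fE d1 d2 _ [small lip]]]]]] :=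
      hsplit Q Q cQ cQ (@subset_refl _ Q).
    exists (pv_integral k h2 xQ) => _.
    move: small lip; rewrite (inf_maximalE n_gt0 mf f1 cQ) => small lip.
    exact: splitting_deviation cQ mg gT kCZ fE d1 d2 small lip.
  by exists gam => Q; exact: hgam.
have gweak lam : 0 < lam ->
    (mu [set x | (lam < `|g x|)%R] <= (Cw / lam)%:E * \int[mu]_x `|f x|%:E)%E.
  move=> lam0; have [Z [mZ Z0 sZ]] := gT.
  have mgl : measurable [set x : Rn | lam < `|g x|].
    rewrite -[X in measurable X]setTI (_ : mkset _ =
      (fun z => `|g z|) @^-1` `]lam, +oo[%classic); last first.
      by apply/seteqP; split => z /=; rewrite in_itv/= andbT.
    exact: measurableT_comp.
  apply: le_trans (weak _ domf _ lam0).
  apply: (@le_trans _ _ (mu ([set x : Rn | (lam < `|g x|)%R] `\` Z))).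
    rewrite -[leRHS]adde0 -Z0; apply: le_trans (measureU2 _ _ mZ); last exact: measurableD.
    by apply: le_lebesgue_rV => z Dz; have [Nz|Nz] := pselect (Z z); [right|left].
  apply: le_lebesgue_rV => z [gz nz] /=.
  rewrite (_ : pv_integral k f z = g z)//.
  by apply/esym; apply: contrapT => ne; apply: nz; exact: sZ.
set X := (\int[mu]_x (maximal_layers Phi f x * V x))%E.
have H0 := maximal_layers_ge0 PhiC f.
have mH := measurable_maximal_layers PhiC mf.
have X0 : (0 <= X)%E by apply: integral_ge0 => x _; rewrite mule_ge0.
apply: (@le_trans _ _ (\int[mu]_x (Phi `|g x| * w x)%:E)%E).
  apply: ae_ge0_le_integral_nomeas => [x|x||].
  - by rewrite lee_fin mulr_ge0// (condC_ge0 PhiC).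
  - by rewrite lee_fin mulr_ge0// (condC_ge0 PhiC).
  - apply/measurable_EFinP; apply: measurable_funM => //.
    exact: (measurable_condC_norm PhiC).
  - by apply: filterS gT => x ->.
rewrite EFinM -muleA; apply: (@exhaustion g gam) => //.
  move=> eps eps0.
  exact: (gam_vanishes n_gt0 mf f1 mg kap0 s_le (ltW Cw0) eps0 gweak osc).
move=> o L c L0.
have b0 := inf_maximal_ge0 n_gt0 mf f1.
have banti := inf_maximal_anti n_gt0 mf f1.
have hH Q x : is_cube Q -> Q x -> ((Phi (inf_maximal f Q))%:E <= maximal_layers Phi f x)%E.
  move=> cQ Qx; apply: (maximal_layers_ge PhiC (b0 _ cQ)).
  exact: inf_maximal_le.
apply: le_trans (local_estimate n_gt0 PhiC c0_ge1 mw w0 mV V0 beta0 cF0 alpha01 hF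
  s0 s_lt t_gt t_lt kap0 contr J0 hJ hN hm Ck0 hCk mg b0 banti osc mH H0 hH o L0 c) _.
apply: (@le_trans _ _ (K%:E * \int[mu]_(x in gcube o L c) (maximal_layers Phi f x * V x))%E).
  apply: lee_wpmul2r; first by apply: integral_ge0 => x _; rewrite mule_ge0.
  by rewrite lee_fin /K (le_trans (ler_norm _))// lerDl.
apply: lee_wpmul2l; first by rewrite lee_fin ltW.
apply: ge0_subset_integral => //; first exact: measurable_gcube.
- exact: emeasurable_funM.
- by move=> x _; rewrite mule_ge0.
Qed.

End modular.

Theorem theorem5p4 (R : realType) (n : nat) (n_gt0 : (0 < n)%N)
  (Phi Psi : R -> R) (c0 d0 : R)
  (PhiY : young Phi c0) (PsiY : young Psi d0)
  (PhiPsi : exists c : R, 0 < c /\ forall tau : R, 0 < tau ->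
     (\int[lebesgue_measure]_(sigma in `]0%R, tau[)
        (Phi sigma / sigma ^+ 2)%:E <= (c * (Psi tau / tau))%:E)%E)
  (Phi_dec : exists q : R, 1 < q /\ forall sigma tau : R, 0 < sigma ->
     sigma <= tau -> Phi tau / tau `^ q <= Phi sigma / sigma `^ q)
  (k : 'rV[R]_n -> 'rV[R]_n -> R) (kCZ : CZ_kernel k)
  (k_weak : weak_type11 k)
  (S : set ('rV[R]_n -> R)) (s : R) (k_split : splitting_property k S s)
  (w : 'rV[R]_n -> R) (w_weight : weight w) :
  let mu := lebesgue_rV R n in
  let T := pv_integral k in
  (forall (v : 'rV[R]_n -> R) (beta : R), weight v ->
     condition_F w (EFin \o v) beta -> admissible c0 beta s ->
     exists c : R, 0 < c /\ forall f, S f ->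
       (\int[mu]_x (Phi `|T f x| * w x)%:E <=
        c%:E * \int[mu]_x ((Psi `|f x|)%:E * maximal v x))%E) /\
  (forall (q beta : R), 1 < q -> class_C q w ->
     condition_F w (maximal w) beta -> admissible c0 beta s ->
     exists c : R, 0 < c /\ forall f, S f ->
       (\int[mu]_x (Phi `|T f x| * w x)%:E <=
        c%:E * \int[mu]_x ((Psi `|f x|)%:E * maximal_LlogL w x))%E).
Proof.
move=> mu T.
have [PhiC _ _] := PhiY; have [PsiC _ _] := PsiY.
have c01 := young_const_ge1 PhiY; have d01 := young_const_ge1 PsiY.
have c00 : 0 <= c0 by exact: le_trans c01.
have d00 : 0 <= d0 by exact: le_trans d01.
have [cP [cP0 hP]] := PhiPsi.
have [C C0 hC] := maximal_modular n_gt0 PhiC PsiC c00 hP cP0 d00.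
have [mw w0 _] := w_weight.
have [[S_dom _] _] := k_split.
have main V beta : measurable_fun setT V -> (forall x, (0 <= V x)%E) ->
    condition_F w V beta -> admissible c0 beta s ->
    exists2 K, 0 < K & forall f, S f -> (\int[mu]_x (Phi `|T f x| * w x)%:E <=
      K%:E * \int[mu]_x ((Psi `|f x|)%:E * emax V x))%E.
  move=> mV V0 FV adm.
  have [K K0 hK] := maximal_control n_gt0 PhiC c01 mw w0 kCZ k_weak k_split mV V0 FV adm.
  exists (K * C) => [|f Sf]; first by rewrite mulr_gt0.
  have [If _] := S_dom _ Sf.
  have mf : measurable_fun setT f by apply/measurable_EFinP; exact: measurable_int If.
  have f1 : (\int[mu]_x `|f x|%:E < +oo)%E by have /integrableP[] := If.
  apply: (le_trans (hK f Sf)); rewrite EFinM -muleA; apply: lee_wpmul2l.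
    by rewrite lee_fin ltW.
  exact: hC.
split=> [v beta [mv v0 _] FV adm|q beta _ _ FV adm].
  have [||K K0 hK] := main (EFin \o v) beta _ _ FV adm.
  - exact/measurable_EFinP.
  - by move=> x; rewrite lee_fin.
  have vE x : maximal v x = emax (EFin \o v) x.
    rewrite maximalE; congr (emax _ x); apply/funext => y.
    by rewrite /= ger0_norm.
  exists K; split; [exact: K0|move=> f Sf].
  under [in leRHS]eq_integral do rewrite vE.
  exact: hK.
have [||K K0 hK] := main (maximal w) beta _ _ FV adm.
- exact: measurable_maximal.
- exact: maximal_ge0.
have [D D0 hD] := emax_maximal_le_LlogL n_gt0 w_weight.
exists (K * D); split=> [|f Sf]; first by rewrite mulr_gt0.
apply: (le_trans (hK f Sf)); rewrite EFinM -muleA; apply: lee_wpmul2l.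
  by rewrite lee_fin ltW.
have P0 x : 0 <= Psi `|f x| by apply: (condC_ge0 PsiC).
have L0 x : (0 <= maximal_LlogL w x)%E.
  rewrite -(@pmule_rge0 _ D%:E) ?lte_fin//; apply: le_trans (hD x).
  by apply: emax_ge0 => y; exact: maximal_ge0.
have [If _] := S_dom _ Sf.
have mf : measurable_fun setT f by apply/measurable_EFinP; exact: measurable_int If.
have mPsi : measurable_fun setT (fun x => (Psi `|f x|)%:E).
  by apply/measurable_EFinP; exact: (measurable_condC_norm PsiC).
have M0 x : (0 <= emax (maximal w) x)%E by apply: emax_ge0 => y; exact: maximal_ge0.
have mM : measurable_fun setT (emax (maximal w)).
  by apply: measurable_emax; [exact: measurable_maximal|exact: maximal_ge0].
(* The factor is taken out of the integral on the left, where the integrand is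
   already known to be measurable. *)
rewrite -lee_pdivrMl// -ge0_integralZl_EFin//; last 3 first.
- by move=> x _; rewrite mule_ge0// lee_fin.
- exact: emeasurable_funM.
- by rewrite invr_ge0 ltW.
apply: ge0_le_integral_nomeas => x _.
  by rewrite !mule_ge0 ?lee_fin// invr_ge0 ltW.
rewrite muleCA; apply: lee_wpmul2l; first by rewrite lee_fin.
by rewrite lee_pdivrMl.
Qed.
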